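(* Let $\mathcal{F}$ be a foliation on $\mathbb{P}^2$ of degree $d\geq 3$ such that $\mathrm{Aut}(\mathcal{F})$ is finite and imprimitive, that is, $\mathrm{Aut}(\mathcal{F})$ leaves invariant the union of three lines $L_1$, $L_2$, $L_3$ in general position (meeting in three distinct points). If the lines $L_1,L_2,L_3$ are not $\mathcal{F}$-invariant and support at most reduced singularities (i.e. every singularity of $\mathcal{F}$ lying on $L_1\cup L_2\cup L_3$ is reduced), then $$|\mathrm{Aut}(\mathcal{F})| \leq 3(d^2+d+1).$$
   Context: $\mathbb{P}^2$ is the complex projective plane. A foliation $\mathcal{F}$ on a smooth compact complex surface $X$ is given by an open cover $\{U_i\}$ and holomorphic vector fields $v_i$ on $U_i$ with isolated zeros such that $v_i=f_{ij}v_j$ on $U_i\cap U_j$ with $f_{ij}$ nowhere vanishing holomorphic; the singular set $\mathrm{Sing}(\mathcal{F})$ is the common zero set of the $v_i$, and the line bundle with cocycle $\{f_{ij}\}$ is the canonical bundle $K_{\mathcal{F}}$. A curve is $\mathcal{F}$-invariant if the $v_i$ are tangent to it. A foliation on $\mathbb{P}^2$ has degree $d$ if $K_{\mathcal{F}}=\mathcal{O}_{\mathbb{P}^2}(d-1)$; equivalently, $d$ is the number of tangencies (with multiplicity) of $\mathcal{F}$ with a general line. $\mathrm{Aut}(\mathcal{F})$ is the subgroup of $\mathrm{Aut}(\mathbb{P}^2)=\mathrm{PGL}(3,\mathbb{C})$ of automorphisms preserving $\mathcal{F}$. A singularity $x$ of $\mathcal{F}$ is reduced if the eigenvalues of the linear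 part $Dv_x$ of a local vector field $v$ defining $\mathcal{F}$ at $x$ are not both zero and their quotient, when defined, is not a positive rational number. *)

(* Defs.v *)
From HB Require Import structures.
From mathcomp Require Import all_boot all_order all_algebra.
From mathcomp Require Import finmap complex.
From mathcomp Require Import all_classical all_reals all_analysis.
Set Implicit Arguments.
Unset Strict Implicit.
Unset Printing Implicit Defensive.
Import Order.TTheory GRing.Theory Num.Theory.
Import numFieldNormedType.Exports.
Local Open Scope classical_set_scope.
Local Open Scope ring_scope.

(* The field of complex numbers is R[i] for
   R : realType; it gets its norm topology as MathComp-Analysis does for the
   abstract number fields. "Holomorphic on U" means Frechet-differentiable over
   the scalar field R[i] at every point of the open set U. *)
HB.instance Definition _ (R : rcfType) :=
  NormedModule.copy R[i] (R[i] : numFieldType)^o.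

Section ProjectivePlane.
Variable R : realType.
Local Notation C := R[i].

(* Points of P^2 are the lines through the origin of C^3. *)
Definition P2 : Type := {L : {vspace 'rV[C]_3} | \dim L == 1%N}.

Lemma dim_e0 : \dim <[delta_mx ord0 ord0 : 'rV[C]_3]>%VS == 1%N.
Proof.
rewrite dim_vline; suff -> : (delta_mx ord0 ord0 : 'rV[C]_3) != 0 by [].
by apply/eqP => /matrixP/(_ ord0 ord0); rewrite !mxE => /eqP; rewrite oner_eq0.
Qed.

(* The point [p_0 : p_1 : p_2]; junk value [1 : 0 : 0] when p = 0. *)
Definition proj (p : 'rV[C]_3) : P2 :=
  insubd (Sub <[delta_mx ord0 ord0]>%VS dim_e0) <[p]>%VS.

(* Some homogeneous coordinates of a point; everything below that uses [rep]
   is independent of the choice. *)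
Definition rep (x : P2) : 'rV[C]_3 := vpick (\val x).

Lemma rep_neq0 x : rep x != 0.
Proof. by rewrite vpick0 -dimv_eq0 (eqP (valP x)). Qed.

Lemma repK : cancel rep proj.
Proof.
move=> x; apply: val_inj; rewrite /proj val_insubd dim_vline rep_neq0 eqxx.
apply/eqP; rewrite eqEdim dim_vline rep_neq0 (eqP (valP x)) leqnn andbT.
by rewrite -memvE memv_pick.
Qed.

Lemma projK (p : 'rV[C]_3) : p != 0 -> exists2 a, a != 0 & rep (proj p) = a *: p.
Proof.
move=> p0; have vE : val (proj p) = <[p]>%VS by rewrite val_insubd dim_vline p0.
have : rep (proj p) \in <[p]>%VS by rewrite -vE memv_pick.
case/vlineP => a ha; exists a => //; apply: contra_neq (rep_neq0 (proj p)).
by rewrite ha => ->; rewrite scale0r.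
Qed.

(* The three standard affine charts. [chart k u] has homogeneous coordinates
   1 in position k and the entries of u, in order, in the other positions. *)
Definition homog (k : 'I_3) (u : 'rV[C]_2) : 'rV[C]_3 :=
  \row_j (if unlift k j is Some j' then u 0 j' else 1).

Definition chart (k : 'I_3) (u : 'rV[C]_2) : P2 := proj (homog k u).

Definition chart_dom (k : 'I_3) : set P2 := [set x | rep x 0 k != 0].

Definition affine (k : 'I_3) (x : P2) : 'rV[C]_2 :=
  \row_j (rep x 0 (lift k j) / rep x 0 k).

Definition P2_open (U : set P2) : Prop := forall k, open (chart k @^-1` U).

(* [h] is a holomorphic function on the open set [U]. *)
Definition holo (U : set P2) (h : P2 -> C) : Prop :=
  forall k u, U (chart k u) ->
    differentiable (h \o chart k) u.

Definition nonvanishing_holo (U : set P2) (h : P2 -> C) : Prop :=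
  holo U h /\ forall x, U x -> h x != 0.

(* Holomorphic vector fields on U, by their expressions in the three charts:
   [vf v k] is the expression of the field in the chart k, which only matters
   on [chart k @^-1` U]. *)
Record vector_field (U : set P2) := VectorField {
  vf :> 'I_3 -> 'rV[C]_2 -> 'rV[C]_2;
  vf_holo : forall k u, U (chart k u) -> differentiable (vf k) u;
  vf_compat : forall k l u, U (chart k u) -> chart_dom l (chart k u) ->
    vf l (affine l (chart k u)) = 'd (affine l \o chart k) u (vf k u) }.

Definition isolated_zeros (U : set P2) (v : vector_field U) : Prop :=
  forall k u, U (chart k u) -> v k u = 0 -> \forall w \near u^', v k w != 0.

(* Line bundles given by a cocycle g on an open cover: local sections are
   families s_i of functions with s_i = g_ij s_j. *)
Record cocycle := Cocycle {
  coc_index : Type;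
  coc_open : coc_index -> set P2;
  coc_fun : coc_index -> coc_index -> P2 -> C }.

(* Isomorphisms are multiplication by h_ia on the intersection of the i-th
   open set of the first cover with the a-th one of the second. *)
Definition cocycle_iso (L M : cocycle) : Prop :=
  exists h : coc_index L -> coc_index M -> P2 -> C,
    (forall i a, nonvanishing_holo (coc_open i `&` coc_open a) (h i a)) /\
    (forall i j a b x,
       coc_open i x -> coc_open j x -> coc_open a x -> coc_open b x ->
       h i a x * coc_fun i j x = coc_fun a b x * h j b x).

(* The bundle O(n): a homogeneous polynomial F of degree n is the section
   F / x_k^n on the k-th standard open set. *)
Definition O_P2 (n : int) : cocycle :=
  @Cocycle 'I_3 chart_dom (fun k l x => (rep x 0 l / rep x 0 k) ^ n).

Record foliation := Foliation {
  fol_index : Type;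
  fol_open : fol_index -> set P2;
  fol_openP : forall i, P2_open (fol_open i);
  fol_cover : forall x, exists i, fol_open i x;
  fol_vf : forall i, vector_field (fol_open i);
  fol_isolated : forall i, isolated_zeros (fol_vf i);
  fol_trans : fol_index -> fol_index -> P2 -> C;
  fol_transP : forall i j,
    nonvanishing_holo (fol_open i `&` fol_open j) (fol_trans i j);
  fol_glue : forall i j k u, fol_open i (chart k u) -> fol_open j (chart k u) ->
    fol_vf i k u = fol_trans i j (chart k u) *: fol_vf j k u }.

Definition canonical_bundle (F : foliation) : cocycle :=
  Cocycle (@fol_open F) (@fol_trans F).

Definition has_degree (F : foliation) (d : nat) : Prop :=
  cocycle_iso (canonical_bundle F) (O_P2 (d%:Z - 1)).

Definition Sing (F : foliation) : set P2 :=
  [set x | exists i k u, [/\ @fol_open F i x, chart k u = x & fol_vf i k u = 0]].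

(* 'J acts on row vectors: it is the transpose of the usual Jacobian matrix and
   has the same eigenvalues. *)
Definition reduced_singularity (F : foliation) (x : P2) : Prop :=
  forall (i : fol_index F) k u, fol_open i x -> chart k u = x ->
  forall a b : C,
    char_poly ('J (fol_vf i k) u) = ('X - a%:P) * ('X - b%:P) ->
    ~ (a = 0 /\ b = 0) /\
    (b != 0 -> ~ exists2 q : rat, 0 < q & a / b = ratr q).

(* The line with equation x *m l = 0. *)
Definition line (l : 'cV[C]_3) : set P2 := [set x | rep x *m l = 0].

Definition invariant_line (F : foliation) (l : 'cV[C]_3) : Prop :=
  forall (i : fol_index F) k u,
    fol_open i (chart k u) -> line l (chart k u) ->
    'd (fun w => homog k w *m l) u (fol_vf i k u) = 0.

Definition general_position (l : 'I_3 -> 'cV[C]_3) : Prop :=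
  (forall i j, i != j -> line (l i) <> line (l j)) /\
  (forall x, ~ forall i, line (l i) x).

(* The automorphism of P^2 induced by an invertible matrix. *)
Definition act (M : 'M[C]_3) (x : P2) : P2 := proj (rep x *m M).

(* The class of M in PGL(3, C). *)
Definition pgl (M : 'M[C]_3) : set 'M[C]_3 :=
  [set N | exists2 a : C, a != 0 & N = a *: M].

(* The differential of the automorphism g induced by M maps v_i to a nowhere
   vanishing holomorphic multiple of v_j o g on U_i `&` g^-1(U_j). *)
Definition preserves (F : foliation) (M : 'M[C]_3) : Prop :=
  forall i j : fol_index F, exists h : P2 -> C,
    nonvanishing_holo (fol_open i `&` act M @^-1` fol_open j) h /\
    forall k l u, fol_open i (chart k u) -> fol_open j (act M (chart k u)) ->
      chart_dom l (act M (chart k u)) ->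
      'd (affine l \o act M \o chart k) u (fol_vf i k u)
      = h (chart k u) *: fol_vf j l (affine l (act M (chart k u))).

(* Aut(F), as a set of elements of PGL(3, C). *)
Definition Aut (F : foliation) : set (set 'M[C]_3) :=
  [set pgl M | M in [set M | M \in unitmx /\ preserves F M]].

End ProjectivePlane.

(* Main.v *)
Require Import Defs.
From mathcomp Require Import all_boot all_order all_algebra.
From mathcomp Require Import finmap complex.
From mathcomp Require Import all_classical all_reals all_analysis.
From mathcomp Require Import fingroup perm qpoly.
From mathcomp Require Import ring lra zify.
Import numFieldNormedType.Exports.
Set Implicit Arguments.
Unset Strict Implicit.
Unset Printing Implicit Defensive.
Import Order.TTheory GRing.Theory Num.Theory.
Local Open Scope classical_set_scope.
Local Open Scope ring_scope.

(** Write d = e + 1.  Multiplying the local vector fields of the foliation by an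
    isomorphism of its canonical bundle with O(d - 1) glues them into a field V
    on the cone C^3 \ 0, homogeneous of degree d and defined up to multiples of
    the radial field.  The bivector A(p) = p /\ V(p), stored as a skew matrix,
    removes that ambiguity: it is holomorphic on C^3 \ 0, homogeneous of degree
    d + 1, and a linear map M preserves the foliation only if
    M^T A(p) M = c A(p M) with a factor c which is a nowhere zero holomorphic
    function on the plane, hence a constant ([automorphism_factor]).

    In coordinates where L_1, L_2, L_3 are the coordinate lines, the
    automorphisms become monomial matrices, so Aut(F) maps to the symmetric
    group on the three lines and the kernel consists of diagonal matrices t.
    On a non-invariant coordinate line q_k = 0 the k-th component of V is a
    nonzero binary form of degree d.  Each of its monomials, x^m y^(d - m) say,
    forces t_i t_j t_k / c = t_i^(m + 1) t_j^(d + 1 - m)  ([line_weight]).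
    The three lines give three exponent vectors, one on each side of the
    triangle of monomials of degree d + 2 and none at a corner.  They are not
    collinear, and the lattice generated by their differences has index at most
    d^2 + d + 1 ([three_sides_bound]); the kernel is therefore no larger
    ([three_weights]).

    This settles the case where the image in the symmetric group has at most
    three elements.  Otherwise it is the whole group, the relations satisfied by
    t hold after every permutation of its entries, and reducedness enters.  At a
    vertex of the triangle the foliation is nonsingular or has a nonzero linear
    part; either way one more relation appears ([vertex_weight]).  Together with
    its permutations and those of a single line relation it makes t trivial, or
    makes the ratios of its entries square roots or cube roots of unity, which
    is far below the bound ([full_weights]).

    Two facts of complex analysis are needed about functions that are only
    assumed complex differentiable: an entire function whose growth is that of a
    polynomial is a polynomial, and a holomorphic function on a projective line
    is constant.  Both come from Cauchy's formula on squares, that is from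
    Goursat's bisection argument, followed by an expansion of the Cauchy kernel
    ([goursat], [cauchy_formula], [liouville]). *)

Local Notation Re := complex.Re.
Local Notation Im := complex.Im.
Local Notation proj := Defs.proj.

(** * Bisection of squares and integrals of continuous functions *)

Section Cousin.
Variable R : realType.

(** The bisection principle: a property of squares which passes from the four
    quarters to the whole and which holds for all small squares around any point
    holds for every square.  A counterexample would produce nested
    counterexamples shrinking to a point. *)
Lemma square_bisection (P : R -> R -> R -> Prop) :
  (forall a b s : R, 0 < s -> P a b s -> P (a + s) b s -> P a (b + s) s ->
     P (a + s) (b + s) s -> P a b (s *+ 2)) ->
  (forall x y : R, exists2 e : R, 0 < e & forall a b s : R, 0 < s -> s < e ->
     a <= x <= a + s -> b <= y <= b + s -> P a b s) ->
  forall a b s : R, 0 < s -> P a b s.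
Proof.
move=> Padd Ploc a0 b0 s0 s0_gt0; apply: contrapT => nP.
pose T := {q : R * R * R | 0 < q.2 /\ ~ P q.1.1 q.1.2 q.2}.
have step (q : T) : exists q' : T, let: (a, b, s) := sval q in
   let: (a', b', s') := sval q' in
   [/\ s = s' *+ 2, a' = a \/ a' = a + s' & b' = b \/ b' = b + s'].
  case: q => -[[a b] s] /= [s_gt0 nPq].
  have h_gt0 : 0 < s / 2 by rewrite divr_gt0.
  have sE : s = (s / 2) *+ 2 by rewrite -mulr_natr divfK.
  have : ~ [/\ P a b (s/2), P (a + s/2) b (s/2), P a (b + s/2) (s/2) &
       P (a + s/2) (b + s/2) (s/2)].
    by move=> [h1 h2 h3 h4]; apply: nPq; rewrite sE; apply: Padd.
  move=> h; apply: contrapT => hn; apply: h.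
  have aux a' b' : a' = a \/ a' = a + s / 2 -> b' = b \/ b' = b + s / 2 ->
     P a' b' (s / 2).
    move=> ha hb; apply: contrapT => nP'; apply: hn.
    by exists (exist _ (a', b', s/2) (conj h_gt0 nP')).
  by split; apply: aux; auto.
have [g gP] := choice step.
pose q n := iter n g (exist _ (a0, b0, s0) (conj s0_gt0 nP) : T).
pose a n := (sval (q n)).1.1; pose b n := (sval (q n)).1.2.
pose s n := (sval (q n)).2.
have qS n : [/\ s n = s n.+1 *+ 2, a n.+1 = a n \/ a n.+1 = a n + s n.+1 &
   b n.+1 = b n \/ b n.+1 = b n + s n.+1].
  rewrite /a /b /s /q iterS; have := gP (q n); rewrite /q.
  by case: (sval _) => [[? ?] ?]; case: (sval _) => [[? ?] ?].
have s_gt0 n : 0 < s n by rewrite /s; case: (q n) => -[[? ?] ?] [].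
have nPn n : ~ P (a n) (b n) (s n) by rewrite /a /b /s; case: (q n) => -[[? ?] ?] [].
have sn n : s n * 2 ^+ n = s0.
  elim: n => [|n IH]; first by rewrite mulr1.
  by rewrite -IH; have [-> _ _] := qS n; rewrite exprS -mulr_natr; ring.
(* The lower left corners increase and stay within the current side of one
   another, so their supremum lies in every square of the nest. *)
have main (c : nat -> R) : (forall n, c n.+1 = c n \/ c n.+1 = c n + s n.+1) ->
    exists x, forall n, c n <= x <= c n + s n.
  move=> cS.
  have cmono n m : c n <= c (n + m)%N <= c n + s n - s (n + m)%N.
    elim: m => [|m]; first by rewrite addn0; lra.
    rewrite addnS; move: (cS (n + m)%N) (qS (n + m)%N) (s_gt0 (n + m).+1).
    by move=> [->|->] [-> _ _]; lra.
  have cle n m : c n <= c m + s m.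
    have [h|h] := leqP n m.
      have := cmono n (m - n)%N; rewrite subnKC // => /andP[? _].
      by have := s_gt0 m; lra.
    have := cmono m (n - m)%N; rewrite subnKC ?(ltnW h) // => /andP[_ ?].
    by have := s_gt0 n; lra.
  have ub m : ubound (range c) (c m + s m) by move=> _ [n _ <-].
  exists (sup (range c)) => n; apply/andP; split.
    by apply: ub_le_sup; [exists (c 0%N + s 0%N) | exists n].
  by apply: ge_sup => //; exists (c 0%N); exists 0%N.
have [x xP] : exists x, forall n, a n <= x <= a n + s n.
  by apply: main => n; have [] := qS n.
have [y yP] : exists x, forall n, b n <= x <= b n + s n.
  by apply: main => n; have [] := qS n.
have [e e_gt0 /(_ _ _ _ _ _ (xP _) (yP _)) h] := Ploc x y.
have [n hn] : exists n, s n < e.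
  exists (Num.bound (s0 / e)); set n := Num.bound _.
  have /archi_boundP : 0 <= s0 / e by rewrite divr_ge0 // ltW.
  rewrite -/n ltr_pdivrMr // -(sn n) mulrC => h1.
  have h2 : (n%:R : R) < 2 ^+ n by rewrite -natrX ltr_nat ltn_expl.
  have {}h1 : 2 ^+ n * s n < 2 ^+ n * e.
    by rewrite (lt_trans h1) // ltr_pM2r.
  by rewrite ltr_pM2l in h1.
exact: nPn (h n (s_gt0 n) hn).
Qed.
End Cousin.

Section RealIntegral.
Variable R : realType.
Local Notation mu := (@lebesgue_measure R).
Implicit Types (h : R -> R).

Definition seg_integral h a b := (\int[mu]_(x in `[a, b]) h x)%R.

Lemma seg_integrable h a b : continuous h -> mu.-integrable `[a, b] (EFin \o h).
Proof.
move=> hc; apply: continuous_compact_integrable; first exact: segment_compact.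
by apply: continuous_subspaceT.
Qed.

Lemma seg_integralD h1 h2 a b : continuous h1 -> continuous h2 ->
  seg_integral (fun x => h1 x + h2 x) a b = seg_integral h1 a b + seg_integral h2 a b.
Proof. by move=> c1 c2; apply: RintegralD => //; exact: seg_integrable. Qed.

Lemma seg_integralZ h c a b : continuous h -> seg_integral (fun x => c * h x) a b = c * seg_integral h a b.
Proof. by move=> c1; apply: RintegralZl => //; exact: seg_integrable. Qed.

Lemma seg_integral_cst (c a b : R) : a <= b -> seg_integral (fun=> c) a b = c * (b - a).
Proof.
move=> ab; rewrite /seg_integral Rintegral_cst //= lebesgue_measure_itv /= lte_fin.
by case: ltP => //= ba; rewrite (_ : b = a) ?subrr //; apply/eqP; rewrite eq_le ab ba.
Qed.

Lemma seg_integral_split h a c b : continuous h -> a <= c -> c <= b ->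
  seg_integral h a b = seg_integral h a c + seg_integral h c b.
Proof.
move=> hc ac cb; have I := seg_integrable a b hc.
have := @Rintegral_itvB R h (BLeft a) (BRight b) c I.
rewrite !bnd_simp => /(_ ac cb) E.
rewrite -[LHS](subrK (seg_integral h a c)) [X in X + _]E addrC; congr (_ + _).
by rewrite Rintegral_itv_obnd_cbnd //; apply: integrableS I => //; apply: subset_itvr; rewrite bnd_simp.
Qed.

Lemma seg_integral_id a b : a <= b -> seg_integral id a b = (b ^+ 2 - a ^+ 2) / 2.
Proof.
rewrite le_eqVlt => /predU1P[->|ab].
  by rewrite /seg_integral set_itv1 Rintegral_set1 subrr mul0r.
have dF x : is_derive x (1 : R) (fun x : R => x ^+ 2 / 2) x.
  have h : is_derive x (1 : R) (fun x : R => x ^+ 2 * 2^-1) (x *+ 2 * 2^-1).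
    have -> : (fun x : R => x ^+ 2 * 2^-1) = 2^-1 *: (id ^+ 2).
      by apply/funext => y; rewrite /GRing.scale /= mulrC.
    apply: is_derive_eq.
    by rewrite /= /GRing.scale /=; ring.
  by apply: is_derive_eq; field.
rewrite /seg_integral /Rintegral (_ : (fun x => _) = (fun x => (id x)%:E)) //.
rewrite (@continuous_FTC2 _ _ (fun x => x ^+ 2 / 2) a b ab) //=.
- by rewrite mulrBl.
- by apply: continuous_subspaceT => x; exact: cvg_id.
- split.
  + by move=> x _; case: (dF x).
  + apply: cvg_at_right_filter.
    have /derivable1_diffP/differentiable_continuous := @ex_derive _ _ _ _ _ _ _ (dF a).
    exact.
  + apply: cvg_at_left_filter.
    have /derivable1_diffP/differentiable_continuous := @ex_derive _ _ _ _ _ _ _ (dF b).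
    exact.
- by move=> x _; rewrite derive1E; case: (dF x).
Qed.

Lemma seg_integral_bound h a b M : a <= b -> continuous h -> (forall x, a <= x <= b -> `|h x| <= M) ->
  `|seg_integral h a b| <= M * (b - a).
Proof.
move=> ab hc hM; have I := seg_integrable a b hc.
apply: le_trans (le_normr_Rintegral _ I) _ => //.
rewrite -seg_integral_cst //; apply: le_Rintegral => //.
- by apply: integrable_abse I.
- by apply: seg_integrable => x; exact: cvg_cst.
Qed.

Lemma seg_integral_ge h a b M : a <= b -> continuous h -> (forall x, a <= x <= b -> M <= h x) ->
  M * (b - a) <= seg_integral h a b.
Proof.
move=> ab hc hM; have I := seg_integrable a b hc.
rewrite -seg_integral_cst //; apply: le_Rintegral => //.
by apply: seg_integrable => x; exact: cvg_cst.
Qed.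
End RealIntegral.

(** * Modulus, continuity and complex derivatives *)

Section ComplexNorm.
Variable R : realType.
Local Notation C := R[i].
Implicit Types z w : C.

Definition cabs z : R := ComplexField.Normc.normc z.

Lemma cabsE z : `|z| = (cabs z)%:C%C.
Proof. by []. Qed.

Lemma cabs_ge0 z : 0 <= cabs z.
Proof. by case: z => a b; apply: sqrtr_ge0. Qed.

Lemma cabs0 : cabs 0 = 0.
Proof. exact: ComplexField.Normc.normc0. Qed.

Lemma cabs_eq0 z : (cabs z == 0) = (z == 0).
Proof.
apply/eqP/eqP => [|->]; last exact: cabs0.
exact: ComplexField.Normc.eq0_normc.
Qed.

Lemma cabs_gt0 z : (0 < cabs z) = (z != 0).
Proof. by rewrite lt_neqAle cabs_ge0 andbT eq_sym cabs_eq0. Qed.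

Lemma cabsM z w : cabs (z * w) = cabs z * cabs w.
Proof. exact: ComplexField.Normc.normcM. Qed.

Lemma cabs1 : cabs 1 = 1.
Proof. exact: ComplexField.Normc.normc1. Qed.

Lemma cabsX z n : cabs (z ^+ n) = cabs z ^+ n.
Proof. by elim: n => [|n IH]; rewrite ?expr0 ?cabs1 // !exprS cabsM IH. Qed.

Lemma cabsV z : cabs (z^-1) = (cabs z)^-1.
Proof. exact: ComplexField.Normc.normcV. Qed.

Lemma cabsN z : cabs (- z) = cabs z.
Proof. by case: z => a b; rewrite /cabs /= !sqrrN. Qed.

Lemma ler_cabsD z w : cabs (z + w) <= cabs z + cabs w.
Proof. by rewrite -lecR rmorphD /= -!cabsE; apply: ler_normD. Qed.

Lemma ler_cabsB z w : cabs z - cabs w <= cabs (z + w).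
Proof.
have := ler_cabsD (z + w) (- w); rewrite addrK cabsN; lra.
Qed.

Lemma Re_le_cabs z : `|Re z| <= cabs z.
Proof.
case: z => a b; rewrite /cabs /= -sqrtr_sqr ler_wsqrtr // lerDl sqr_ge0 //.
Qed.

Lemma Im_le_cabs z : `|Im z| <= cabs z.
Proof.
case: z => a b; rewrite /cabs /= -[leLHS]sqrtr_sqr ler_wsqrtr // lerDr sqr_ge0 //.
Qed.

Lemma cabs_real (a : R) : cabs (a%:C)%C = `|a|.
Proof. by rewrite /cabs /= expr0n addr0 sqrtr_sqr. Qed.

Lemma cabs_i : cabs 'i%C = 1.
Proof. by rewrite /cabs /= expr0n expr1n add0r sqrtr1. Qed.

Lemma cabs_le z : cabs z <= `|Re z| + `|Im z|.
Proof.
rewrite {1}[z]complexE; apply: le_trans (ler_cabsD _ _) _.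
by rewrite cabsM cabs_i mul1r !cabs_real.
Qed.

Lemma cabs_sum (I : Type) (r : seq I) (F : I -> C) :
  cabs (\sum_(i <- r) F i) <= \sum_(i <- r) cabs (F i).
Proof.
elim/big_rec2: _ => [|i x y _ h]; first by rewrite cabs0.
by apply: le_trans (ler_cabsD _ _) _; rewrite lerD2l.
Qed.

Lemma ReD z w : Re (z + w) = Re z + Re w. Proof. by case: z; case: w. Qed.
Lemma ImD z w : Im (z + w) = Im z + Im w. Proof. by case: z; case: w. Qed.
Lemma ReN z : Re (- z) = - Re z. Proof. by case: z. Qed.
Lemma ImN z : Im (- z) = - Im z. Proof. by case: z. Qed.
Lemma ReM z w : Re (z * w) = Re z * Re w - Im z * Im w.
Proof. by case: z; case: w. Qed.
Lemma ImM z w : Im (z * w) = Re z * Im w + Im z * Re w.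
Proof. by case: z; case: w. Qed.

Lemma complex_ext z w : Re z = Re w -> Im z = Im w -> z = w.
Proof. by case: z => a b; case: w => c d /= -> ->. Qed.

Lemma gt0_complex (e : C) : 0 < e -> 0 < Re e /\ e = (Re e)%:C%C.
Proof. by case: e => a b; rewrite ltcE /= => /andP[/eqP -> ->]. Qed.

(** Continuity and differentiability are spelled out with real epsilons: all
    estimates below are estimates of moduli. *)
Definition ccont (f : C -> C) z := forall e : R, 0 < e -> exists2 d : R, 0 < d &
  forall h, cabs h < d -> cabs (f (z + h) - f z) < e.

Definition cdiff (f : C -> C) z (D : C) := forall e : R, 0 < e -> exists2 d : R, 0 < d &
  forall h, cabs h < d -> cabs (f (z + h) - f z - D * h) <= e * cabs h.

Lemma ccont_cst (k : C) z : ccont (fun=> k) z.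
Proof. by move=> e e0; exists 1 => // h _; rewrite subrr cabs0. Qed.

Lemma ccont_id z : ccont id z.
Proof. by move=> e e0; exists e => // h; rewrite addrAC subrr add0r. Qed.

Lemma ccontD f g z : ccont f z -> ccont g z -> ccont (fun z => f z + g z) z.
Proof.
move=> fc gc e e0; have e20 : 0 < e / 2 by rewrite divr_gt0.
have [d1 d10 h1] := fc _ e20; have [d2 d20 h2] := gc _ e20.
exists (Num.min d1 d2) => [|h]; first by rewrite lt_min d10.
rewrite lt_min => /andP[/h1 k1 /h2 k2].
rewrite (_ : _ - _ = (f (z + h) - f z) + (g (z + h) - g z)); last by ring.
by apply: le_lt_trans (ler_cabsD _ _) _; lra.
Qed.

Lemma ccontM f g z : ccont f z -> ccont g z -> ccont (fun z => f z * g z) z.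
Proof.
move=> fc gc e e0; set a := cabs (f z); set b := cabs (g z).
have a0 : 0 <= a by exact: cabs_ge0.
have b0 : 0 <= b by exact: cabs_ge0.
pose e' := Num.min 1 (e / (1 + a + b)).
have k0 : 0 < 1 + a + b by lra.
have e'0 : 0 < e' by rewrite lt_min ltr01 divr_gt0.
have [d1 d10 h1] := fc _ e'0; have [d2 d20 h2] := gc _ e'0.
exists (Num.min d1 d2) => [|h]; first by rewrite lt_min d10.
rewrite lt_min => /andP[/h1 k1 /h2 k2].
rewrite (_ : _ - _ = (f (z + h) - f z) * (g (z + h) - g z) +
  (f z * (g (z + h) - g z) + g z * (f (z + h) - f z))); last by ring.
apply: le_lt_trans (ler_cabsD _ _) _.
apply: le_lt_trans (lerD (lexx _) (ler_cabsD _ _)) _.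
rewrite !cabsM -/a -/b.
have e'1 : e' <= 1 by rewrite ge_min lexx.
have e'2 : e' * (1 + a + b) <= e by rewrite -ler_pdivlMr // ge_min lexx orbT.
have := cabs_ge0 (f (z + h) - f z); have := cabs_ge0 (g (z + h) - g z).
move: (cabs _) (cabs _) k1 k2 => u v k1 k2 v0 u0.
have : v * u < e' * 1.
  by apply: (le_lt_trans (y := v * 1)); [rewrite ler_wpM2l//; lra|lra].
nra.
Qed.

Lemma cabs_half u h : u != 0 -> cabs h < cabs u / 2 -> cabs u / 2 < cabs (u + h).
Proof. by move=> u0 hh; have := ler_cabsB u h; lra. Qed.

Lemma ccontV f z : ccont f z -> f z != 0 -> ccont (fun z => (f z)^-1) z.
Proof.
move=> fc f0 e e0; set a := cabs (f z).
have a0 : 0 < a by rewrite cabs_gt0.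
pose e' := Num.min (a / 2) (e * a ^+ 2 / 2).
have e'0 : 0 < e' by rewrite lt_min !divr_gt0 // mulr_gt0 // exprn_gt0.
have [d d0 hd] := fc _ e'0; exists d => // h /hd.
set r := f (z + h) - f z; rewrite lt_min => /andP[k1 k2].
have fE : f (z + h) = f z + r by rewrite /r; ring.
have k3 := cabs_half f0 k1; rewrite -fE in k3.
have fh0 : f (z + h) != 0 by rewrite -cabs_gt0 (lt_trans _ k3) // divr_gt0.
rewrite (_ : _ - _ = - r / (f (z + h) * f z)); last first.
  by rewrite {1}/r; field; rewrite f0.
rewrite cabsM cabsN cabsV cabsM ltr_pdivrMr ?mulr_gt0 ?cabs_gt0 // -/a.
apply: lt_le_trans k2 _.
have -> : e * a ^+ 2 / 2 = e * (a / 2 * a) by ring.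
by rewrite ler_pM2l // ler_pM2r // ltW.
Qed.

Lemma ccontX f n z : ccont f z -> ccont (fun z => f z ^+ n) z.
Proof.
move=> fc; elim: n => [|n IH]; first exact: ccont_cst.
rewrite (_ : (fun z => _) = fun z => f z * f z ^+ n); first exact: ccontM.
by apply/funext => u; rewrite exprS.
Qed.

Lemma cdiff_cont f z D : cdiff f z D -> ccont f z.
Proof.
move=> fd e e0; have [d d0 hd] := fd 1 ltr01.
have k0 : 0 < 1 + cabs D by rewrite ltr_wpDr ?cabs_ge0.
exists (Num.min d (e / (1 + cabs D))); first by rewrite lt_min d0 divr_gt0.
move=> h; rewrite lt_min ltr_pdivlMr // => /andP[/hd h1 h2].
have := ler_cabsD (f (z + h) - f z - D * h) (D * h).
rewrite subrK cabsM mul1r in h1 *; have := cabs_ge0 h; nra.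
Qed.

(** Off the pole w the quotient inherits a derivative because
    q(z + h) - q(z) - D' h is (r - D' h^2) / (z + h - w), where r is the error
    of f at z. *)
Lemma cdiff_quot (f : C -> C) w z (c D : C) : z != w -> cdiff f z D ->
  exists D', cdiff (fun u => (f u - c) / (u - w)) z D'.
Proof.
move=> zw fd; set u0 := z - w; have u0n : u0 != 0 by rewrite subr_eq0.
have a0 : 0 < cabs u0 by rewrite cabs_gt0.
pose g0 := (f z - c) / u0; pose D' := (D - g0) / u0; exists D' => e e0.
set a := cabs u0.
have e'0 : 0 < e * a / 4 by rewrite divr_gt0 // mulr_gt0.
have [d d0 hd] := fd _ e'0.
have k0 : 0 < 1 + cabs D' by rewrite ltr_wpDr ?cabs_ge0.
exists (Num.min d (Num.min (a / 2) (e * a / 4 / (1 + cabs D')))).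
  by rewrite !lt_min d0 /= divr_gt0 //= divr_gt0 // divr_gt0 // mulr_gt0.
move=> h; rewrite !lt_min => /and3P[/hd h1 /(cabs_half u0n) h2 h3].
rewrite -/a in h2; set r := f (z + h) - f z - D * h in h1.
have hu0 : u0 + h != 0 by rewrite -cabs_gt0 (lt_trans _ h2) // divr_gt0.
rewrite (_ : _ - _ = (r - D' * h * h) / (u0 + h)); last first.
  rewrite (_ : z + h - w = u0 + h); last by rewrite /u0 addrAC.
  rewrite (_ : f (z + h) = f z + D * h + r); last by rewrite /r; ring.
  rewrite -/u0 /D' /g0; field; rewrite u0n hu0 //.
rewrite cabsM cabsV ler_pdivrMr ?cabs_gt0 //.
apply: (@le_trans _ _ (e * cabs h * (a / 2))); last first.
  by apply: ler_wpM2l; [rewrite mulr_ge0 ?cabs_ge0 // ltW|exact: ltW].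
apply: le_trans (ler_cabsD _ _) _; rewrite cabsN (cabsM _ h) (cabsM D' h).
rewrite ltr_pdivlMr // in h3.
have hp := cabs_ge0 h; have Dp := cabs_ge0 D'.
have h4 : cabs D' * cabs h <= e * a / 4.
  by move: h3; rewrite mulrDr mulr1 [cabs h * _]mulrC; move: (cabs D' * _) => t; lra.
have : cabs D' * cabs h * cabs h <= e * a / 4 * cabs h by exact: ler_wpM2r.
move=> h5; apply: le_trans (lerD h1 h5) _.
by rewrite le_eqVlt; apply/orP; left; apply/eqP; field.
Qed.

Lemma cdiffP (f : C -> C) z : differentiable f z -> exists D, cdiff f z D.
Proof.
move=> df; have dfv := diff_derivable (v := (1 : C)) df.
exists ('D_(1 : C) f z) => e e0; have e0' : 0 < e%:C%C by rewrite ltcR.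
move: dfv; rewrite /derivable => /cvgrPdist_lt/(_ _ e0').
case/nbhs_ballP => d /gt0_complex[d0 dE] hd.
exists (Re d) => // h hh.
have [->|h0] := eqVneq h 0; first by rewrite addr0 subrr sub0r mulr0 oppr0 cabs0 mulr0.
have hb : ball 0 d h by rewrite -ball_normE /= sub0r normrN dE cabsE ltcR.
have hle := hd _ hb h0.
have {}hle : `|'D_(1 : C) f z - h^-1 * (f (z + h) - f z)| < e%:C%C.
  congr (`|_ - _ * (f _ - _)| < _) : hle.
  by rewrite [z + h]addrC -[h *: _]/(h * 1) mulr1.
have h0' : 0 < cabs h by rewrite cabs_gt0.
rewrite -ler_pdivrMr // -cabsV -cabsM -cabsN.
move: hle; rewrite cabsE ltcR => /ltW; congr (cabs _ <= _).
by rewrite mulrBl opprB mulfK // mulrC.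
Qed.
End ComplexNorm.

(** * Contour integrals over squares *)

Section Contour.
Variable R : realType.
Local Notation C := R[i].

Definition path_continuous (h : R -> C) := continuous (fun t => Re (h t)) /\ continuous (fun t => Im (h t)).

Definition path_integral (h : R -> C) (a b : R) : C :=
  Complex (seg_integral (fun t => Re (h t)) a b) (seg_integral (fun t => Im (h t)) a b).

Lemma path_integralD h1 h2 a b : path_continuous h1 -> path_continuous h2 ->
  path_integral (fun t => h1 t + h2 t) a b = path_integral h1 a b + path_integral h2 a b.
Proof.
move=> [r1 i1] [r2 i2]; apply: complex_ext; rewrite ?ReD ?ImD /= -seg_integralD //.
- by congr seg_integral; apply/funext => t; rewrite ReD.
- by congr seg_integral; apply/funext => t; rewrite ImD.
Qed.

Lemma path_integralZ (c : C) h a b : path_continuous h -> path_integral (fun t => c * h t) a b = c * path_integral h a b.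
Proof.
move=> [r1 i1].
have c1 (k : R) (g : R -> R) : continuous g -> continuous (fun t => k * g t).
  by move=> gc t; apply: cvgM; [exact: cvg_cst|exact: gc].
apply: complex_ext; rewrite ?ReM ?ImM /=.
- rewrite -[RHS]/(_ + _) -mulNr -!seg_integralZ // -seg_integralD; [|exact: c1 ..].
  by congr seg_integral; apply/funext => t; rewrite ReM mulNr.
- rewrite -!seg_integralZ // -seg_integralD; [|exact: c1 ..].
  by congr seg_integral; apply/funext => t; rewrite ImM.
Qed.

Lemma path_integral_split h a c b : path_continuous h -> a <= c -> c <= b ->
  path_integral h a b = path_integral h a c + path_integral h c b.
Proof. by move=> [r1 i1] ac cb; apply: complex_ext; rewrite ?ReD ?ImD /= -seg_integral_split. Qed.

Lemma path_integral_bound h a b M : a <= b -> path_continuous h -> (forall t, a <= t <= b -> cabs (h t) <= M) ->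
  cabs (path_integral h a b) <= (M * (b - a)) *+ 2.
Proof.
move=> ab [r1 i1] hM; apply: le_trans (cabs_le _) _; rewrite mulr2n /=.
by apply: lerD; apply: seg_integral_bound => // t /hM; apply: le_trans; rewrite ?Re_le_cabs ?Im_le_cabs.
Qed.

Lemma path_integral_affine (al be : C) a b : a <= b ->
  path_integral (fun t => al + be * t%:C%C) a b =
    al * (b - a)%:C%C + be * ((b ^+ 2 - a ^+ 2) / 2)%:C%C.
Proof.
move=> ab.
have cid : continuous (@id R) by move=> x; exact: cvg_id.
have cc (k : R) : continuous (fun _ : R => k) by move=> x; exact: cvg_cst.
have c1 (k : R) : continuous (fun t : R => k * id t).
  by move=> t; apply: cvgM; [exact: cvg_cst|exact: cvg_id].
apply: complex_ext; rewrite /path_integral ?ReD ?ImD ?ReM ?ImM /= !mulr0 ?subr0 ?add0r ?addr0.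
- rewrite -seg_integral_id // -seg_integral_cst // -seg_integralZ // -seg_integralD //.
  by congr seg_integral; apply/funext => t; rewrite ReD ReM /= mulr0 subr0.
- rewrite -seg_integral_id // -seg_integral_cst // -seg_integralZ // -seg_integralD //.
  by congr seg_integral; apply/funext => t; rewrite ImD ImM /= mulr0 add0r.
Qed.

Implicit Types g : C -> C.

Definition hline g (y : R) (x : R) : C := g (Complex x y).
Definition vline g (x : R) (y : R) : C := g (Complex x y).

Definition contour g (a b s : R) : C :=
  path_integral (hline g b) a (a + s) - path_integral (hline g (b + s)) a (a + s)
  + 'i%C * (path_integral (vline g (a + s)) b (b + s) - path_integral (vline g a) b (b + s)).

(** The integrals along the sides only involve restrictions of the integrand to
    the four full lines that carry them.  Asking for continuity on those lines
    avoids any subset topology, and costs nothing for a kernel whose pole lies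
    in the open square. *)
Definition on_side_lines (a b s : R) (z : C) :=
  [\/ Im z = b, Im z = b + s, Re z = a | Re z = a + s].

Definition on_boundary (a b s : R) (z : C) :=
  [/\ on_side_lines a b s z, a <= Re z <= a + s & b <= Im z <= b + s].

Definition sides_continuous g a b s := forall z, on_side_lines a b s z -> ccont g z.

Lemma rcontP (f : R -> R) x : (forall e : R, 0 < e -> exists2 d : R, 0 < d &
    forall t, `|t - x| < d -> `|f t - f x| < e) -> {for x, continuous f}.
Proof.
move=> fc; apply/cvgrPdist_lt => e e0.
have [d d0 hd] := fc _ e0.
apply/nbhs_ballP; exists d => //.
by move=> t; rewrite /ball_ /= distrC => /hd; rewrite distrC.
Qed.

Lemma continuous_hline g y : (forall x, ccont g (Complex x y)) -> path_continuous (hline g y).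
Proof.
move=> gc; split => x; apply: rcontP => e e0;
  have [d d0 hd] := gc x _ e0; exists d => // t ht;
  (have {ht}/hd : cabs ((t - x)%:C%C) < d by rewrite cabs_real);
  (rewrite (_ : Complex x y + _ = Complex t y); last by apply: complex_ext; rewrite ?ReD ?ImD /=; ring).
- by apply: le_lt_trans; rewrite -ReN -ReD Re_le_cabs.
- by apply: le_lt_trans; rewrite -ImN -ImD Im_le_cabs.
Qed.

Lemma continuous_vline g x : (forall y, ccont g (Complex x y)) -> path_continuous (vline g x).
Proof.
move=> gc; split => y; apply: rcontP => e e0;
  have [d d0 hd] := gc y _ e0; exists d => // t ht;
  (have {ht}/hd : cabs ('i%C * (t - y)%:C%C) < d by rewrite cabsM cabs_i mul1r cabs_real);
  (rewrite (_ : Complex x y + _ = Complex x t); last by apply: complex_ext; rewrite ?ReD ?ImD ?ReM ?ImM /=; ring).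
- by apply: le_lt_trans; rewrite -ReN -ReD Re_le_cabs.
- by apply: le_lt_trans; rewrite -ImN -ImD Im_le_cabs.
Qed.

Lemma sides_continuous_lines g a b s : sides_continuous g a b s ->
  [/\ path_continuous (hline g b), path_continuous (hline g (b + s)), path_continuous (vline g (a + s)) & path_continuous (vline g a)].
Proof.
by move=> gc; split; (apply: continuous_hline || apply: continuous_vline) => t; apply: gc;
  [apply: Or41|apply: Or42|apply: Or44|apply: Or43].
Qed.

Lemma eq_contour g1 g2 a b s : (forall z, on_side_lines a b s z -> g1 z = g2 z) ->
  contour g1 a b s = contour g2 a b s.
Proof.
move=> h; rewrite /contour; congr (path_integral _ _ _ - path_integral _ _ _ + _ * (path_integral _ _ _ - path_integral _ _ _));
  apply/funext => t; apply: h;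
  [apply: Or41|apply: Or42|apply: Or44|apply: Or43] => //.
Qed.

Lemma contourD g1 g2 a b s : sides_continuous g1 a b s -> sides_continuous g2 a b s ->
  contour (fun z => g1 z + g2 z) a b s = contour g1 a b s + contour g2 a b s.
Proof.
move=> /sides_continuous_lines[c1 c2 c3 c4] /sides_continuous_lines[d1 d2 d3 d4].
by rewrite /contour !path_integralD //; ring.
Qed.

Lemma contourZ (c : C) g a b s : sides_continuous g a b s ->
  contour (fun z => c * g z) a b s = c * contour g a b s.
Proof.
move=> /sides_continuous_lines[c1 c2 c3 c4].
by rewrite /contour !path_integralZ //; ring.
Qed.

Lemma sides_continuousD g1 g2 a b s : sides_continuous g1 a b s -> sides_continuous g2 a b s -> sides_continuous (fun z => g1 z + g2 z) a b s.
Proof. by move=> c1 c2 z hz; apply: ccontD; [exact: c1|exact: c2]. Qed.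

Lemma sides_continuousZ (c : C) g a b s : sides_continuous g a b s -> sides_continuous (fun z => c * g z) a b s.
Proof. by move=> c1 z hz; apply: ccontM; [exact: ccont_cst|exact: c1]. Qed.

Lemma contour0 a b s : contour (fun=> 0) a b s = 0.
Proof.
have h : sides_continuous (fun _ : C => 0 : C) a b s by move=> z _; exact: ccont_cst.
transitivity ((0 : C) * contour (fun _ : C => 0) a b s); last exact: mul0r.
by rewrite -contourZ //; apply: eq_contour => z _; exact/esym/mul0r.
Qed.

Lemma contour_sum n (G : nat -> C -> C) a b s : (forall k, sides_continuous (G k) a b s) ->
  contour (fun z => \sum_(k < n) G k z) a b s = \sum_(k < n) contour (G k) a b s
  /\ sides_continuous (fun z => \sum_(k < n) G k z) a b s.
Proof.
move=> Gc; elim: n => [|n [IH1 IH2]].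
  have -> : (fun z => \sum_(k < 0) G k z) = (fun _ : C => 0 : C).
    by apply/funext => z; rewrite big_ord0.
  by rewrite big_ord0; split; [exact: contour0|move=> z _; exact: ccont_cst].
have -> : (fun z => \sum_(k < n.+1) G k z) = (fun z => (\sum_(k < n) G k z) + G n z).
  by apply/funext => z; rewrite big_ord_recr.
by rewrite contourD // big_ord_recr /= IH1; split => //; apply: sides_continuousD.
Qed.

Lemma contour_bound g a b s M : 0 <= s -> sides_continuous g a b s ->
  (forall z, on_boundary a b s z -> cabs (g z) <= M) -> cabs (contour g a b s) <= 8 * M * s.
Proof.
move=> s0 /sides_continuous_lines[c1 c2 c3 c4] hM.
have B h c : path_continuous h -> (forall t, c <= t <= c + s -> cabs (h t) <= M) ->
    cabs (path_integral h c (c + s)) <= (M * s) *+ 2.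
  move=> hl hb; have := path_integral_bound (_ : c <= c + s) hl hb.
  by rewrite addrAC subrr add0r; apply; rewrite lerDl.
rewrite /contour; apply: le_trans (ler_cabsD _ _) _.
rewrite cabsM cabs_i mul1r.
have := ler_cabsD (path_integral (hline g b) a (a + s)) (- path_integral (hline g (b + s)) a (a + s)).
have := ler_cabsD (path_integral (vline g (a + s)) b (b + s)) (- path_integral (vline g a) b (b + s)).
rewrite !cabsN.
have b1 : cabs (path_integral (hline g b) a (a + s)) <= (M * s) *+ 2.
  by apply: B => // t ht; apply: hM; split => //=; [apply: Or41|rewrite lexx lerDl].
have b2 : cabs (path_integral (hline g (b + s)) a (a + s)) <= (M * s) *+ 2.
  by apply: B => // t ht; apply: hM; split => //=; [apply: Or42|rewrite lexx lerDl s0].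
have b3 : cabs (path_integral (vline g (a + s)) b (b + s)) <= (M * s) *+ 2.
  by apply: B => // t ht; apply: hM; split => //=; [apply: Or44|rewrite lexx lerDl s0].
have b4 : cabs (path_integral (vline g a) b (b + s)) <= (M * s) *+ 2.
  by apply: B => // t ht; apply: hM; split => //=; [apply: Or43|rewrite lexx lerDl s0].
lra.
Qed.

(** Affine functions have primitives; here the cancellation is a computation
    with the moments of order zero and one of a segment. *)
Lemma contour_affine (al be : C) a b s : 0 <= s ->
  contour (fun z => al + be * z) a b s = 0.
Proof.
move=> s0; rewrite /contour.
have H y x1 x2 : x1 <= x2 -> path_integral (hline (fun z => al + be * z) y) x1 x2 =
   (al + be * 'i%C * y%:C%C) * (x2 - x1)%:C%C + be * ((x2 ^+ 2 - x1 ^+ 2) / 2)%:C%C.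
  move=> h; rewrite -path_integral_affine //; congr path_integral; apply/funext => t.
  by rewrite /hline [Complex t y]complexE /=; ring.
have V y x1 x2 : x1 <= x2 -> path_integral (vline (fun z => al + be * z) y) x1 x2 =
   (al + be * y%:C%C) * (x2 - x1)%:C%C + be * 'i%C * ((x2 ^+ 2 - x1 ^+ 2) / 2)%:C%C.
  move=> h; rewrite -path_integral_affine //; congr path_integral; apply/funext => t.
  by rewrite /vline [Complex y t]complexE /=; ring.
rewrite !H ?V ?lerDl //.
apply: complex_ext; rewrite !(ReD,ImD,ReN,ImN,ReM,ImM) /=; field => //.
Qed.

Lemma contour_bisect g a b s : 0 <= s -> (forall z, ccont g z) ->
  contour g a b (s *+ 2) = contour g a b s + contour g (a + s) b s + contour g a (b + s) s
    + contour g (a + s) (b + s) s.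
Proof.
move=> s0 gc.
have H y c : path_integral (hline g y) c (c + s *+ 2) =
    path_integral (hline g y) c (c + s) + path_integral (hline g y) (c + s) (c + s + s).
  rewrite mulr2n addrA; apply: path_integral_split; rewrite ?lerDl //.
  by apply: continuous_hline => x; exact: gc.
have V y c : path_integral (vline g y) c (c + s *+ 2) =
    path_integral (vline g y) c (c + s) + path_integral (vline g y) (c + s) (c + s + s).
  rewrite mulr2n addrA; apply: path_integral_split; rewrite ?lerDl //.
  by apply: continuous_vline => x; exact: gc.
by rewrite /contour !H !V mulr2n !addrA; ring.
Qed.
End Contour.

(** * Goursat's theorem *)

Section Cauchy.
Variable R : realType.
Local Notation C := R[i].

(** The number of one-sided neighbourhoods of x that [a, a + s] contains.  It is
    additive under bisection, also when x is an end point, so that the product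
    of two of them counts quadrants at a point of the plane. *)
Definition incidence (x a s : R) : R := (a <= x < a + s)%R%:R + (a < x <= a + s)%R%:R.

Lemma incidence_split x a s : 0 < s ->
  incidence x a (s *+ 2) = incidence x a s + incidence x (a + s) s.
Proof.
move=> s0; rewrite /incidence mulr2n addrA.
case: (ltrgtP x a) => h1; case: (ltrgtP x (a + s)) => h2 /=;
  case: (ltrgtP x (a + s + s)) => h3 /=; try lra; by rewrite ?addr0 ?add0r //.
Qed.

Lemma incidence_ge1 x a s : 0 < s -> a <= x <= a + s -> 1 <= incidence x a s.
Proof.
move=> s0 /andP[h1 h2]; rewrite /incidence h1 h2 andbT /=.
have [h|h] := ltP x (a + s); first by rewrite lerDl ler0n.
by rewrite (lt_le_trans _ h) ?ltrDl // add0r.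
Qed.

Lemma incidence_ge0 x a s : 0 <= incidence x a s.
Proof. by rewrite addr_ge0 ?ler0n. Qed.

Lemma incidence_le2 x a s : incidence x a s <= 2.
Proof. by rewrite (natrD _ 1 1) lerD // lern1 leq_b1. Qed.

Lemma on_boundary_near (x y a b s : R) z : 0 < s -> a <= x <= a + s -> b <= y <= b + s ->
  on_boundary a b s z -> cabs (z - Complex x y) <= s *+ 2.
Proof.
move=> s0 hx hy [_ h1 h2]; apply: le_trans (cabs_le _) _.
rewrite ReD ImD ReN ImN /= mulr2n; apply: lerD; rewrite ler_norml; lra.
Qed.

(** Continuity at the exceptional point w suffices there: the integral over
    a small square containing w is at most proportional to its side.  This error
    is charged to the number of quadrants at w contained in the square, which
    bisection preserves; at the other points the usual quadratic error is
    charged to the area. *)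
Lemma goursat (g : C -> C) (w : C) (a b s : R) : 0 < s ->
  (forall z, ccont g z) -> (forall z, z != w -> exists D, cdiff g z D) ->
  contour g a b s = 0.
Proof.
move=> s0 gc gd; apply/eqP; rewrite -cabs_eq0 eq_le cabs_ge0 andbT.
suff H e : 0 < e -> cabs (contour g a b s) <= e * (s ^+ 2 + 4).
  rewrite leNgt; apply/negP => h.
  have k : 0 < s ^+ 2 + 4 by rewrite ltr_wpDl // sqr_ge0.
  have := H (cabs (contour g a b s) / 2 / (s ^+ 2 + 4)).
  by rewrite divfK ?gt_eqF // !divr_gt0 // => /(_ isT); lra.
move=> e0.
have gb a' b' s' : sides_continuous g a' b' s' by move=> z _; exact: gc.
pose P a b s := cabs (contour g a b s) <=
   e * s ^+ 2 + e * (incidence (Re w) a s * incidence (Im w) b s).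
(* The error terms are additive under bisection, and the second one is at most
   4 e for any square. *)
have main : forall a b s : R, 0 < s -> P a b s.
  clear a b s s0.
  apply: square_bisection => [a b s s0 P1 P2 P3 P4|x y].
    rewrite /P contour_bisect ?(ltW s0) // !incidence_split //.
    have := ler_cabsD (contour g a b s) (contour g (a + s) b s).
    have := ler_cabsD (contour g a b s + contour g (a + s) b s) (contour g a (b + s) s).
    have := ler_cabsD (contour g a b s + contour g (a + s) b s + contour g a (b + s) s)
      (contour g (a + s) (b + s) s).
    move: P1 P2 P3 P4; rewrite /P.
    move: (incidence _ a _) (incidence _ (a + s) _) (incidence _ b _) (incidence _ (b + s) _).
    move=> i1 i2 j1 j2 P1 P2 P3 P4 h1 h2 h3.
    apply: le_trans h1 _; apply: le_trans (lerD h2 P4) _.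
    apply: le_trans (lerD (lerD h3 P3) (lexx _)) _.
    apply: le_trans (lerD (lerD (lerD P1 P2) (lexx _)) (lexx _)) _.
    by rewrite le_eqVlt; apply/orP; left; apply/eqP; rewrite -mulr_natr; ring.
  have [zw|zw] := eqVneq (Complex x y) w.
    have [d d0 hd] := gc w _ ltr01.
    pose M := 1 + cabs (g w); have M0 : 0 < M by rewrite ltr_wpDr ?cabs_ge0.
    exists (Num.min (d / 4) (e / (8 * M))); first by rewrite lt_min !divr_gt0 // mulr_gt0.
    move=> a b s s0; rewrite lt_min => /andP[h1 h2] hx hy; rewrite /P -zw /=.
    have h3 : cabs (contour g a b s) <= 8 * M * s.
      apply: contour_bound => //; first exact: ltW.
      move=> z /(on_boundary_near s0 hx hy); rewrite zw => hz.
      have := hd (z - w); rewrite [w + _]addrC subrK.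
      have -> : cabs (z - w) < d by move: hz; rewrite mulr2n; lra.
      move=> /(_ isT) h; rewrite -(subrK (g w) (g z)).
      by apply: le_trans (ler_cabsD _ _) _; rewrite /M; lra.
    rewrite ltr_pdivlMr ?mulr_gt0 // in h2.
    have k1 := incidence_ge1 s0 hx; have k2 := incidence_ge1 s0 hy.
    have k3 : e * 1 <= e * (incidence x a s * incidence y b s).
      by rewrite ler_pM2l // -[leLHS]mulr1 ler_pM.
    have k4 : 0 <= e * s ^+ 2 by rewrite mulr_ge0 ?sqr_ge0 // ltW.
    by rewrite mulr1 in k3; apply: le_trans h3 _; lra.
  have [D gD] := gd _ zw; have e'0 : 0 < e / 16 by rewrite divr_gt0.
  have [d d0 hd] := gD _ e'0.
  exists (d / 2); first by rewrite divr_gt0.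
  move=> a b s s0 h1 hx hy; rewrite /P.
  set z0 := Complex x y in gD hd.
  (* Subtracting the affine part does not change the integral. *)
  pose r z := g z - (g z0 - D * z0 + D * z).
  have rc : sides_continuous r a b s.
    move=> z _; rewrite /r (_ : (fun z => _) = fun z => g z + (- (g z0 - D * z0) + (- D) * z)).
      apply: ccontD => //; apply: ccontD; first exact: ccont_cst.
      by apply: ccontM; [exact: ccont_cst|exact: ccont_id].
    by apply/funext => u; rewrite opprD mulNr.
  have -> : contour g a b s = contour r a b s.
    have -> : contour g a b s = contour (fun z => r z + ((g z0 - D * z0) + D * z)) a b s.
      by apply: eq_contour => z _; rewrite /r subrK.
    rewrite contourD ?contour_affine ?addr0 ?ltW //.
    move=> z _; apply: ccontD; first exact: ccont_cst.
    by apply: ccontM; [exact: ccont_cst|exact: ccont_id].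
  have h3 : cabs (contour r a b s) <= 8 * (e / 16 * (s *+ 2)) * s.
    apply: contour_bound => //; first exact: ltW.
    move=> z /(on_boundary_near s0 hx hy) hz.
    have zE : z = z0 + (z - z0) by rewrite addrC subrK.
    rewrite /r (_ : _ - _ = g (z0 + (z - z0)) - g z0 - D * (z - z0)); last first.
      by rewrite -zE; ring.
    apply: le_trans (hd _ _) _; first by apply: le_lt_trans hz _; rewrite mulr2n; lra.
    by rewrite ler_pM2l.
  apply: le_trans h3 _.
  rewrite (_ : 8 * _ * s = e * s ^+ 2); last by rewrite -mulr_natr; field.
  by rewrite lerDl !mulr_ge0 ?incidence_ge0 // ltW.
apply: le_trans (main a b s s0) _.
rewrite -mulrDr (ler_pM2l e0) lerD2l.
rewrite (_ : (4 : R) = 2 * 2); last by rewrite -natrM.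
by apply: ler_pM; rewrite ?incidence_ge0 ?incidence_le2.
Qed.
End Cauchy.

(** * Cauchy's formula *)

Section Liouville.
Variable R : realType.
Local Notation C := R[i].

Lemma cdiff_local (f g : C -> C) z (d : R) D : 0 < d ->
  (forall h, cabs h < d -> f (z + h) = g (z + h)) -> cdiff f z D -> cdiff g z D.
Proof.
move=> d0 E fc e e0; have [d1 d10 h1] := fc e e0.
exists (Num.min d d1) => [|h]; first by rewrite lt_min d0.
rewrite lt_min => /andP[k1 k2]; rewrite -E //.
by have := E 0; rewrite addr0 => <-; [exact: h1|rewrite cabs0].
Qed.

Definition centered_contour (g : C -> C) (r : R) := contour g (- r) (- r) (r *+ 2).
Definition on_centered_lines (r : R) := on_side_lines (- r) (- r) (r *+ 2).

Lemma on_centered_lines_ge (r : R) z : 0 < r -> on_centered_lines r z -> r <= cabs z.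
Proof.
move=> r0; have := Re_le_cabs z; have := Im_le_cabs z; rewrite !ler_norml /on_centered_lines /on_side_lines mulr2n.
by move=> /andP[h1 h2] /andP[h3 h4] [] h; lra.
Qed.

Lemma centered_contour_bound g r M : 0 < r -> (forall z, on_centered_lines r z -> ccont g z) ->
  (forall z, on_centered_lines r z -> cabs (g z) <= M) -> cabs (centered_contour g r) <= 16 * M * r.
Proof.
move=> r0 gc gM; rewrite (_ : 16 * M * r = 8 * M * (r *+ 2)); last by rewrite -mulr_natr; ring.
by apply: contour_bound => [|//|z [/gM]//]; rewrite pmulrn_lge0 // ltW.
Qed.

(** Goursat's theorem for the difference quotient of f at w, extended by f'(w).
    The winding integral on the left is kept as it is: its value is never
    needed, only a lower bound for it. *)
Lemma cauchy_formula (f : C -> C) (w : C) (r : R) : (forall z, exists D, cdiff f z D) ->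
  cabs w < r ->
  f w * centered_contour (fun z => (z - w)^-1) r = centered_contour (fun z => f z * (z - w)^-1) r.
Proof.
move=> fd wr; have r0 : 0 < r by apply: le_lt_trans wr; exact: cabs_ge0.
have [D fD] := fd w.
pose g (z : C) := if z == w then D else (f z - f w) / (z - w).
have near (z : C) : z != w -> exists2 d : R, 0 < d & forall h, cabs h < d ->
    (f (z + h) - f w) / (z + h - w) = g (z + h).
  move=> zw; exists (cabs (z - w)) => [|h hh]; first by rewrite cabs_gt0 subr_eq0.
  rewrite /g; case: eqP => // E; have hE : cabs h = cabs (z - w).
    by rewrite -E opprD addrA subrr add0r cabsN.
  by rewrite hE ltxx in hh.
have gd z : z != w -> exists D, cdiff g z D.
  move=> zw; have [d d0 hd] := near z zw; have [D1 fD1] := fd z.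
  have [D' qD] := cdiff_quot (f w) zw fD1.
  by exists D'; apply: cdiff_local d0 _ qD => h /hd.
have gc z : ccont g z.
  have [->|/gd[D1 gD1]] := eqVneq z w; last exact: cdiff_cont gD1.
  move=> e e0; have e20 : 0 < e / 2 by rewrite divr_gt0.
  have [d d0 hd] := fD _ e20; exists d => // h /hd hh.
  rewrite {2}/g eqxx /g; case: eqP => [_|/eqP hw]; first by rewrite subrr cabs0.
  have h0 : h != 0 by apply: contra_neq hw => ->; rewrite addr0.
  rewrite (_ : w + h - w = h); last by ring.
  rewrite (_ : _ - D = (f (w + h) - f w - D * h) / h); last by field.
  rewrite cabsM cabsV ltr_pdivrMr ?cabs_gt0 //; apply: le_lt_trans hh _.
  by rewrite ltr_pM2r ?cabs_gt0 //; lra.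
have kc z : on_centered_lines r z -> z != w.
  move=> /(on_centered_lines_ge r0) h; apply/eqP => E; by rewrite E leNgt wr in h.
have ic z : on_centered_lines r z -> ccont (fun z => (z - w)^-1) z.
  move=> /kc h; apply: ccontV; last by rewrite subr_eq0.
  by apply: ccontD; [exact: ccont_id|exact: ccont_cst].
have fc z : ccont f z by have [D1 h] := fd z; exact: cdiff_cont h.
have : centered_contour g r = 0 by apply: goursat gc gd; rewrite pmulrn_lgt0.
rewrite /centered_contour (@eq_contour _ _ (fun z => f z * (z - w)^-1 + (- f w) * (z - w)^-1)).
  rewrite contourD ?contourZ; first by rewrite mulNr => /eqP; rewrite subr_eq0 => /eqP ->.
  - by move=> z /ic.
  - by move=> z /ic h; apply: ccontM.
  - by move=> z /ic h; apply: ccontM => //; exact: ccont_cst.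
by move=> z /kc /negPf zw; rewrite /g zw mulrBl mulNr.
Qed.

(** Each of the four sides contributes at least 1 to the imaginary part, since
    r / (t^2 + r^2) is at least 1 / (2 r) for |t| <= r. *)
Lemma winding_ge (r : R) : 0 < r -> 4 <= cabs (centered_contour (fun z => z^-1) r).
Proof.
move=> r0; apply: le_trans (Im_le_cabs _); apply: le_trans (ler_norm _).
have r20 : 0 <= r *+ 2 by rewrite pmulrn_lge0 // ltW.
have ic z : on_centered_lines r z -> ccont (fun z => z^-1) z.
  move=> /(on_centered_lines_ge r0) h; apply: ccontV; first exact: ccont_id.
  by rewrite -cabs_gt0 (lt_le_trans r0).
have [[_ c1] [_ c2] [c3 _] [c4 _]] := sides_continuous_lines ic.
have ImE (A B X Y : C) : Im (A - B + 'i%C * (X - Y)) = Im A - Im B + (Re X - Re Y).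
  by case: A B X Y => [? ?] [? ?] [? ?] [? ?] /=; ring.
rewrite /centered_contour /contour ImE.
set b := - r + r *+ 2 in c2 c3 *; have bE : b = r by rewrite /b mulr2n; ring.
have bd (t : R) : - r <= t <= b -> (r *+ 2)^-1 <= r / (t ^+ 2 + r ^+ 2).
  rewrite bE => /andP[h1 h2].
  have t0 : 0 < t ^+ 2 + r ^+ 2 by rewrite ltr_wpDl ?sqr_ge0 // exprn_gt0.
  rewrite ler_pdivlMr // ler_pdivrMl ?pmulrn_lgt0 //.
  suff : 0 <= (r - t) * (r + t) by rewrite mulr2n; nra.
  by rewrite mulr_ge0 //; lra.
have val : (r *+ 2)^-1 * (b - - r) = 1.
  by rewrite bE opprK -mulr2n mulVf // gt_eqF // pmulrn_lgt0.
have rb : - r <= b by rewrite bE; lra.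
have k1 : 1 <= seg_integral (fun t : R => Im (hline (fun z : C => z^-1) (- r) t)) (- r) b.
  rewrite -val; apply: seg_integral_ge => // t /bd h; apply: le_trans h _.
  by rewrite le_eqVlt; apply/orP; left; apply/eqP; rewrite /= sqrrN; field; nra.
have k2 : 1 <= - seg_integral (fun t : R => Im (hline (fun z : C => z^-1) b t)) (- r) b.
  rewrite -mulN1r -seg_integralZ // -{1}val; apply: seg_integral_ge => //.
    by move=> t; apply: cvgM; [exact: cvg_cst|exact: c2].
  move=> t /bd h; apply: le_trans h _; rewrite bE.
  by rewrite le_eqVlt; apply/orP; left; apply/eqP; rewrite /=; field; nra.
have k3 : 1 <= seg_integral (fun t : R => Re (vline (fun z : C => z^-1) b t)) (- r) b.
  rewrite -val; apply: seg_integral_ge => // t /bd h; apply: le_trans h _.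
  by rewrite le_eqVlt; apply/orP; left; apply/eqP; rewrite /= bE addrC.
have k4 : 1 <= - seg_integral (fun t : R => Re (vline (fun z : C => z^-1) (- r) t)) (- r) b.
  rewrite -mulN1r -seg_integralZ // -{1}val; apply: seg_integral_ge => //.
    by move=> t; apply: cvgM; [exact: cvg_cst|exact: c4].
  move=> t /bd h; apply: le_trans h _.
  by rewrite le_eqVlt; apply/orP; left; apply/eqP; rewrite /= sqrrN; field; nra.
by move: k1 k2 k3 k4; rewrite /path_integral /=; lra.
Qed.
End Liouville.

(** * Liouville's theorem for polynomial growth *)

Section Polynomials.
Variable R : realType.
Local Notation C := R[i].

Lemma natr_inj_complex : injective (fun n => n%:R : C).
Proof. by move=> m n /eqP; rewrite eqr_nat => /eqP. Qed.

(** A pointwise limit of polynomials of bounded degree is the polynomial that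
    interpolates it at enough points. *)
Lemma poly_limit (n : nat) (f : C -> C) (P : R -> {poly C}) :
  (forall r, size (P r) <= n.+1)%N ->
  (forall w, exists K, exists r0, forall r, r0 <= r -> cabs (f w - (P r).[w]) * r <= K) ->
  exists2 p : {poly C}, (size p <= n.+1)%N & forall w, f w = p.[w].
Proof.
move=> sP lim; pose x (i : nat) : C := i%:R.
pose L := tnth (lagrange n.+1 x).
exists (\sum_(i < n.+1) (f (x i))%:P * (L i : {poly C})).
  apply: leq_trans (size_sum _ _ _) _; apply/bigmax_leqP => i _.
  apply: leq_trans (size_mul_leq _ _) _.
  rewrite size_lagrange_ //; last exact: natr_inj_complex.
  by rewrite size_polyC; case: eqP => //=; rewrite addnS.
move=> w; apply/eqP; rewrite -subr_eq0 -cabs_eq0 eq_le cabs_ge0 andbT.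
have [Kw [rw hw]] := lim w.
have /choice[K hK] : forall i : 'I_n.+1, exists Kr : R * R, forall r, Kr.2 <= r ->
    cabs (f (x i) - (P r).[x i]) * r <= Kr.1.
  by move=> i; have [K [r0 h]] := lim (x i); exists (K, r0).
pose T := Kw + \sum_(i < n.+1) (K i).1 * cabs (L i : {poly C}).[w].
pose r0 := Num.max 1 (Num.max rw (\big[Num.max/1]_(i < n.+1) (K i).2)).
rewrite leNgt; apply/negP => gt0.
set D := cabs _ in gt0.
pose r := Num.max r0 ((T + 1) / D).
have r00 : 0 < r0 by rewrite lt_max ltr01.
have r1 : 0 < r by rewrite lt_max r00.
suff : D * r <= T.
  apply/negP; rewrite -ltNge; apply: (@lt_le_trans _ _ (T + 1)); first by rewrite ltrDl.
  by rewrite -ler_pdivrMl // mulrC le_max lexx orbT.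
have h1 : cabs (f w - (P r).[w]) * r <= Kw by apply: hw; rewrite !le_max lexx !orbT.
have h2 (i : 'I_n.+1) : cabs (f (x i) - (P r).[x i]) * r <= (K i).1.
  apply: hK; rewrite !le_max; apply/orP; left; apply/orP; right; apply/orP; right.
  by apply: le_bigmax.
have h3 : (P r).[w] = \sum_(i < n.+1) (P r).[x i] * (L i : {poly C}).[w].
  rewrite {1}[P r](@lagrange_gen _ n.+1 x) //; last exact: natr_inj_complex.
  by rewrite horner_sum; apply: eq_bigr => i _; rewrite hornerM hornerC.
have h4 : f w - (\sum_(i < n.+1) (f (x i))%:P * (L i : {poly C})).[w] =
   (f w - (P r).[w]) - \sum_(i < n.+1) (f (x i) - (P r).[x i]) * (L i : {poly C}).[w].
  rewrite horner_sum.
  rewrite (eq_bigr (fun i : 'I_n.+1 => f (x i) * (L i : {poly C}).[w])); last first.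
    by move=> i _; rewrite hornerM hornerC.
  rewrite [in RHS](eq_bigr (fun i : 'I_n.+1 => f (x i) * (L i : {poly C}).[w]
      - (P r).[x i] * (L i : {poly C}).[w])); last by move=> i _; rewrite mulrBl.
  by rewrite sumrB -h3; ring.
rewrite /D h4.
apply: (@le_trans _ _ ((cabs (f w - (P r).[w]) +
  \sum_(i < n.+1) cabs (f (x i) - (P r).[x i]) * cabs (L i : {poly C}).[w]) * r)).
  rewrite ler_pM2r //; apply: le_trans (ler_cabsD _ _) _; rewrite lerD2l cabsN.
  apply: le_trans (cabs_sum _ _) _; apply: ler_sum => i _.
  by rewrite cabsM.
rewrite mulrDl; apply: lerD => //; rewrite mulr_suml; apply: ler_sum => i _.
by rewrite mulrAC ler_wpM2r ?cabs_ge0.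
Qed.

(** Expand 1 / (z - w) to order n + 1 in w / z inside Cauchy's formula on
    a square of half-side r: the expansion contributes a polynomial of degree n
    in w, and the remainder is O(1 / r). *)
Lemma liouville (f : C -> C) n (K : R) : (forall z, exists D, cdiff f z D) ->
  (forall z, 1 <= cabs z -> cabs (f z) <= K * cabs z ^+ n) ->
  exists2 p : {poly C}, (size p <= n.+1)%N & forall w, f w = p.[w].
Proof.
move=> fd fK.
pose ka r := centered_contour (fun z : C => z^-1) r.
pose c (r : R) k := centered_contour (fun z => f z * z^-1 ^+ k.+1) r.
pose P r := (ka r)^-1 *: \poly_(k < n.+1) c r k.
have fc z : ccont f z by have [D1 h] := fd z; exact: cdiff_cont h.
apply: (@poly_limit n f P) => [r|w].
  by apply: leq_trans (size_scale_leq _ _) _; exact: size_poly.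
have K0 : 0 <= K.
  have := fK 1; rewrite cabs1 expr1n mulr1 => /(_ (lexx _)).
  exact: le_trans (cabs_ge0 _).
exists (8 * (cabs (f w) * cabs w + K * cabs w ^+ n.+1)), (1 + cabs w *+ 2) => r hr.
have w0 := cabs_ge0 w; rewrite mulr2n in hr.
have r1 : 1 <= r by lra.
have r0 : 0 < r by lra.
have wr : cabs w < r by lra.
have kar := winding_ge r0; rewrite -/(ka r) in kar.
have ka0 : ka r != 0 by rewrite -cabs_gt0 (lt_le_trans _ kar).
have on0 z : on_centered_lines r z -> z != 0.
  by move=> /(on_centered_lines_ge r0) h; rewrite -cabs_gt0 (lt_le_trans r0).
have onw z : on_centered_lines r z -> r / 2 <= cabs (z - w).
  by move=> /(on_centered_lines_ge r0) h; have := ler_cabsB z (- w); rewrite cabsN; lra.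
have onw0 z : on_centered_lines r z -> z - w != 0.
  by move=> /onw h; rewrite -cabs_gt0 (lt_le_trans _ h) // divr_gt0.
have ic z : on_centered_lines r z -> ccont (fun z => z^-1) z.
  by move=> /on0 h; apply: ccontV => //; exact: ccont_id.
have icw z : on_centered_lines r z -> ccont (fun z => (z - w)^-1) z.
  move=> /onw0 h; apply: ccontV => //.
  by apply: ccontD; [exact: ccont_id|exact: ccont_cst].
pose kaw := centered_contour (fun z => (z - w)^-1) r.
(* The winding integrals around w and around 0 differ by O(1 / r), so the
   second one, which does not depend on w, may replace the first one. *)
have E1 : kaw - ka r = centered_contour (fun z => w * (z^-1 * (z - w)^-1)) r.
  rewrite /kaw /ka /centered_contour.
  rewrite (@eq_contour _ (fun z => (z - w)^-1) (fun z => z^-1 + w * (z^-1 * (z - w)^-1))).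
    rewrite contourD; first by rewrite addrC addKr.
    - exact: ic.
    - move=> z hz; apply: ccontM; first exact: ccont_cst.
      by apply: ccontM; [exact: ic|exact: icw].
  by move=> z hz; field; rewrite (on0 z hz) (onw0 z hz).
(* The remainder of the geometric expansion of 1 / (z - w). *)
pose rem z := f z * w ^+ n.+1 * z^-1 ^+ n.+1 * (z - w)^-1.
have remc z : on_centered_lines r z -> ccont rem z.
  move=> hz; apply: ccontM; last exact: icw.
  apply: ccontM; last by apply: ccontX; exact: ic.
  by apply: ccontM => //; exact: ccont_cst.
have E2 : f w * kaw - \sum_(k < n.+1) w ^+ k * c r k = centered_contour rem r.
  rewrite cauchy_formula // /centered_contour.
  rewrite (@eq_contour _ (fun z => f z * (z - w)^-1)
    (fun z => (\sum_(k < n.+1) w ^+ k * (f z * z^-1 ^+ k.+1)) + rem z)).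
    have [] := @contour_sum _ n.+1 (fun k z => w ^+ k * (f z * z^-1 ^+ k.+1))
      (- r) (- r) (r *+ 2).
      move=> k; apply: sides_continuousZ => z hz; apply: ccontM => //.
      by apply: ccontX; exact: ic.
    move=> S1 S2; rewrite contourD // S1 addrAC -[RHS]add0r; congr (_ + _).
    apply/eqP; rewrite subr_eq0; apply/eqP; apply: eq_bigr => k _.
    rewrite contourZ // => z hz; apply: ccontM => //.
    by apply: ccontX; exact: ic.
  move=> z hz; have z0 := on0 z hz; have zw0 := onw0 z hz.
  have q1 : 1 - w / z != 0.
    apply: contra_neq zw0 => /eqP; rewrite subr_eq0 => /eqP h.
    by rewrite -[z]mulr1 h mulrCA mulfV // mulr1 subrr.
  have : \sum_(k < n.+1) (w / z) ^+ k = (1 - (w / z) ^+ n.+1) / (1 - w / z).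
    apply: (mulIf q1); rewrite divfK //.
    by have := subrX1 (w / z) n.+1 => h; rewrite -[LHS]opprK -mulrN opprB mulrC -h opprB.
  have -> : \sum_(k < n.+1) w ^+ k * (f z * z^-1 ^+ k.+1) =
     f z * z^-1 * \sum_(k < n.+1) (w / z) ^+ k.
    by rewrite mulr_sumr; apply: eq_bigr => k _; rewrite exprMn exprS; ring.
  move=> ->; rewrite /rem exprMn; field.
  by rewrite zw0 z0.
have B1 : cabs (kaw - ka r) * r <= 32 * cabs w.
  have : cabs (kaw - ka r) <= 16 * (2 * cabs w / r ^+ 2) * r.
    rewrite E1; apply: centered_contour_bound => // z hz.
      apply: ccontM; first exact: ccont_cst.
      by apply: ccontM; [exact: ic|exact: icw].
    have z1 := on_centered_lines_ge r0 hz; have z2 := onw z hz.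
    rewrite !cabsM !cabsV [_ * cabs w]mulrC -!mulrA; apply: ler_wpM2l => //.
    have -> : 2 / r ^+ 2 = r^-1 * (r / 2)^-1 by field; rewrite gt_eqF.
    apply: ler_pM; rewrite ?invr_ge0 ?cabs_ge0 // lef_pV2 // posrE ?divr_gt0 //.
      exact: lt_le_trans z1.
    by apply: lt_le_trans z2; rewrite divr_gt0.
  rewrite -(ler_pM2r r0) => h; apply: le_trans h _.
  by rewrite le_eqVlt; apply/orP; left; apply/eqP; field; rewrite gt_eqF.
have B2 : cabs (centered_contour rem r) * r <= 32 * (K * cabs w ^+ n.+1).
  have : cabs (centered_contour rem r) <= 16 * (2 * (K * cabs w ^+ n.+1) / r ^+ 2) * r.
    apply: centered_contour_bound => // z hz.
    have z1 := on_centered_lines_ge r0 hz; have z2 := onw z hz.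
    have z3 : 0 < cabs z by exact: lt_le_trans z1.
    rewrite !cabsM !cabsX !cabsV.
    have -> : 2 * (K * cabs w ^+ n.+1) / r ^+ 2 = K * cabs w ^+ n.+1 * r^-1 * (r / 2)^-1.
      by field; rewrite gt_eqF.
    apply: ler_pM; rewrite ?mulr_ge0 ?exprn_ge0 ?invr_ge0 ?cabs_ge0 //; last first.
      by rewrite lef_pV2 // posrE ?(lt_le_trans _ z2) ?divr_gt0.
    have fz := fK z (le_trans r1 z1).
    apply: (@le_trans _ _ (K * cabs w ^+ n.+1 * (cabs z)^-1)); last first.
      by rewrite ler_wpM2l ?mulr_ge0 ?exprn_ge0 ?cabs_ge0 // lef_pV2.
    rewrite (_ : K * _ * _ = K * cabs z ^+ n * cabs w ^+ n.+1 * (cabs z)^-1 ^+ n.+1).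
      by rewrite !ler_wpM2r ?exprn_ge0 ?invr_ge0 ?cabs_ge0.
    rewrite [in RHS]exprVn [cabs z ^+ n.+1]exprS; field.
    by rewrite expf_neq0 ?gt_eqF.
  rewrite -(ler_pM2r r0) => h; apply: le_trans h _.
  by rewrite le_eqVlt; apply/orP; left; apply/eqP; field; rewrite gt_eqF.
have E3 : f w - (P r).[w] = (centered_contour rem r - f w * (kaw - ka r)) / ka r.
  rewrite -E2 /P hornerZ horner_poly.
  have -> : \sum_(i < n.+1) c r i * w ^+ i = \sum_(i < n.+1) w ^+ i * c r i.
    by apply: eq_bigr => i _; rewrite mulrC.
  by field.
rewrite E3 cabsM cabsV mulrAC ler_pdivrMr; last by rewrite cabs_gt0.
apply: (@le_trans _ _ (8 * (cabs (f w) * cabs w + K * cabs w ^+ n.+1) * 4)); last first.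
  apply: ler_wpM2l => //; rewrite mulr_ge0 // addr_ge0 // mulr_ge0 ?cabs_ge0 //.
  by rewrite exprn_ge0.
apply: (@le_trans _ _ ((cabs (centered_contour rem r) + cabs (f w) * cabs (kaw - ka r)) * r)).
  rewrite ler_pM2r //; apply: le_trans (ler_cabsD _ _) _.
  by rewrite cabsN cabsM.
rewrite mulrDl.
have B3 : cabs (f w) * cabs (kaw - ka r) * r <= cabs (f w) * (32 * cabs w).
  by rewrite -mulrA ler_wpM2l ?cabs_ge0.
by apply: le_trans (lerD B2 B3) _; rewrite le_eqVlt; apply/orP; left; apply/eqP; ring.
Qed.
End Polynomials.

(** * Holomorphic functions on the projective line *)

Section Growth.
Variable R : realType.
Local Notation C := R[i].

Lemma ccont_bounded (f : C -> C) : (forall z, ccont f z) ->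
  exists M, forall z, cabs z <= 1 -> cabs (f z) <= M.
Proof.
move=> fc.
pose P (a b s : R) := exists M, forall z, a <= Re z <= a + s -> b <= Im z <= b + s ->
  cabs (f z) <= M.
have main : forall a b s : R, 0 < s -> P a b s.
  apply: square_bisection => [a b s s0 [M1 h1] [M2 h2] [M3 h3] [M4 h4]|x y].
    exists (Num.max (Num.max M1 M2) (Num.max M3 M4)) => z hx hy; rewrite !le_max.
    rewrite mulr2n !addrA in hx hy.
    case: (lerP (Re z) (a + s)) => kx; case: (lerP (Im z) (b + s)) => ky.
    - by rewrite h1 //; lra.
    - by rewrite h3 ?orbT //; lra.
    - by rewrite h2 ?orbT //; lra.
    - by rewrite h4 ?orbT //; lra.
  have [d d0 hd] := fc (Complex x y) _ ltr01.
  exists (d / 2); first by rewrite divr_gt0.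
  move=> a b s s0 hs hx hy; exists (1 + cabs (f (Complex x y))) => z zx zy.
  have := hd (z - Complex x y); rewrite [Complex x y + _]addrC subrK => hz.
  have /hz {}hz : cabs (z - Complex x y) < d.
    apply: le_lt_trans (cabs_le _) _; rewrite ReD ImD ReN ImN /=.
    apply: (@le_lt_trans _ _ (s + s)); last by lra.
    by apply: lerD; rewrite ler_norml; lra.
  rewrite -(subrK (f (Complex x y)) (f z)); apply: le_trans (ler_cabsD _ _) _.
  by rewrite lerD2r ltW.
have [M hM] := main (-1) (-1) 2 (ltr0Sn _ _).
exists M => z z1; apply: hM; have := Re_le_cabs z; have := Im_le_cabs z;
  rewrite !ler_norml; lra.
Qed.

(** f and g are the two affine expressions of a section of O(n) on the projective
    line; g is bounded on the unit disc, which controls f at infinity. *)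
Lemma entire_poly (f g : C -> C) n : (forall z, differentiable f z) ->
  (forall z, differentiable g z) -> (forall z, z != 0 -> f z = z ^+ n * g z^-1) ->
  exists2 p : {poly C}, (size p <= n.+1)%N & forall z, f z = p.[z].
Proof.
move=> fd gd fg.
have [M hM] : exists M, forall z, cabs z <= 1 -> cabs (g z) <= M.
  by apply: ccont_bounded => z; have [D h] := cdiffP (gd z); exact: cdiff_cont h.
apply: (@liouville _ f n M) => [z|z z1]; first exact: cdiffP.
have z0 : z != 0 by rewrite -cabs_gt0 (lt_le_trans ltr01).
rewrite fg // cabsM cabsX mulrC ler_wpM2r ?exprn_ge0 ?cabs_ge0 // hM //.
by rewrite cabsV invf_le1 // (lt_le_trans ltr01).
Qed.

Lemma entire_const (f g : C -> C) : (forall z, differentiable f z) ->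
  (forall z, differentiable g z) -> (forall z, z != 0 -> f z = g z^-1) ->
  forall z w, f z = f w.
Proof.
move=> fd gd fg.
have [|p p1 pE] := entire_poly (n := 0) fd gd; first by move=> z /fg ->; rewrite mul1r.
by move=> z w; rewrite !pE (size1_polyC p1) !hornerC.
Qed.
End Growth.

(** * Affine charts, differentials and exterior products *)

Lemma near_eq_differentiable (K : numFieldType) (V W : normedModType K) (f g : V -> W) (x : V) :
  (\forall y \near x, f y = g y) -> differentiable f x -> differentiable g x.
Proof.
move=> fg df; have gx : f x = g x by exact: nbhs_singleton fg.
have [dc fE] := (diff_locallyP x f).1 df.
have gE : g \o shift x = cst (g x) + 'd f x +o_ (0 : V) id.
  apply/eqaddoP => e e0; move/eqaddoP : fE => /(_ e e0).
  move: fg; rewrite (near_shift 0 x) subr0 => fg.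
  apply: filterS2 fg => h /= E.
  by rewrite !fctE /= -E -gx.
have dd := diff_unique dc gE.
by apply/diff_locallyP; rewrite dd.
Qed.

Lemma scale_factor (K : fieldType) (c x y a b g : K) n : c != 0 -> x != 0 -> y != 0 -> b != 0 ->
  (c * x) ^+ n * a * (c * y / (c * x)) * g / ((c * y) ^+ n * b) =
  x ^+ n * a * (y / x) * g / (y ^+ n * b).
Proof.
move=> c0 x0 y0 b0; rewrite (_ : c * y / (c * x) = y / x); last by field; rewrite c0 x0.
rewrite !exprMn; field.
by rewrite !expf_neq0 // x0 b0.
Qed.

Section Generic.
Variable K : numFieldType.

Lemma differentiable_row (V : normedModType K) n (f : V -> 'rV[K]_n.+1) (u : V) :
  (forall j, differentiable (fun w => f w 0 j : K) u) -> differentiable f u.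
Proof.
move=> df; rewrite (_ : f = \sum_(j < n.+1) (fun w => (f w 0 j : K) *: (delta_mx 0 j : 'rV[K]_n.+1))).
  by apply: differentiable_sum => j; apply: differentiableZl.
apply/funext => w; rewrite [LHS]row_sum_delta fct_sumE.
by apply: eq_bigr.
Qed.

Lemma differentiable_entry (V : normedModType K) m n (f : V -> 'M[K]_(m.+1, n.+1)) (u : V) i j :
  differentiable f u -> differentiable (fun w => f w i j : K) u.
Proof.
move=> df; apply: (@differentiable_comp _ _ _ _ f (fun M => M i j)) => //.
exact: differentiable_coord.
Qed.

Lemma differentiable_mulmx_entry m n (M : 'M[K]_(m.+1, n)) u j :
  differentiable (fun w : 'rV[K]_m.+1 => (w *m M) 0 j : K) u.
Proof.
rewrite (_ : (fun w : 'rV[K]_m.+1 => _) = \sum_(i < m.+1) (fun w : 'rV[K]_m.+1 => M i j *: (w 0 i : K))).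
  apply: differentiable_sum => i; apply: differentiableZ.
  exact: differentiable_coord.
apply/funext => w; rewrite mxE fct_sumE; apply: eq_bigr => i _.
by rewrite mulrC.
Qed.

Lemma is_derive_mulmx_entry m n (M : 'M[K]_(m.+1, n)) (u v : 'rV[K]_m.+1) j :
  is_derive u v (fun w : 'rV[K]_m.+1 => (w *m M) 0 j : K) ((v *m M) 0 j).
Proof.
have E : (fun h : K => h^-1 *: (((h *: v + u) *m M) 0 j - (u *m M) 0 j : K)) @ 0^' --> (v *m M) 0 j.
  apply: cvg_near_cst; near=> h.
  have h0 : h != 0 by near: h; exact: nbhs_dnbhs_neq.
  rewrite mulmxDl -scalemxAl !mxE -[X in X = _]/(h^-1 * _).
  by rewrite addrK mulKf.
apply: DeriveDef; first by apply/cvg_ex; exists ((v *m M) 0 j).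
exact: cvg_lim E.
Unshelve. all: by end_near.
Qed.

(** Chart coordinates and homogeneous coordinates: [hom k] inserts a 1 in position
    k, [emb k] is its linear part, and [aff k] dehomogenizes. *)
Definition emb (k : 'I_3) (v : 'rV[K]_2) : 'rV[K]_3 :=
  \row_j (if unlift k j is Some j' then v 0 j' else 0).

Definition hom (k : 'I_3) (v : 'rV[K]_2) : 'rV[K]_3 :=
  \row_j (if unlift k j is Some j' then v 0 j' else 1).

Definition aff (k : 'I_3) (p : 'rV[K]_3) : 'rV[K]_2 :=
  \row_j (p 0 (lift k j) / p 0 k).

Definition embmx (k : 'I_3) : 'M[K]_(2, 3) := \matrix_(i, j) (lift k i == j)%:R.

Lemma embE k v : emb k v = v *m embmx k.
Proof.
apply/rowP => j; rewrite !mxE; case: unliftP => [j' ->|->].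
  rewrite (bigD1 j') //= big1 ?addr0 => [|i ij]; rewrite mxE ?eqxx ?mulr1 //.
  by rewrite (inj_eq lift_inj) (negPf ij) mulr0.
by rewrite big1 // => i _; rewrite mxE eq_sym (negPf (neq_lift _ _)) mulr0.
Qed.

Lemma homE k v : hom k v = delta_mx 0 k + emb k v.
Proof.
apply/rowP => j; rewrite !mxE /=; case: unliftP => [j' ->|->].
  by rewrite eq_sym (negPf (neq_lift _ _)) add0r.
by rewrite eqxx addr0.
Qed.

Lemma emb_k k v : emb k v 0 k = 0.
Proof. by rewrite mxE unlift_none. Qed.

Lemma emb_lift k v j : emb k v 0 (lift k j) = v 0 j.
Proof. by rewrite mxE liftK. Qed.

Lemma hom_k k v : hom k v 0 k = 1.
Proof. by rewrite mxE unlift_none. Qed.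

Lemma hom_lift k v j : hom k v 0 (lift k j) = v 0 j.
Proof. by rewrite mxE liftK. Qed.

Lemma hom_neq0 k v : hom k v != 0.
Proof. by apply/eqP => /rowP/(_ k)/eqP; rewrite hom_k mxE oner_eq0. Qed.

Lemma aff_hom k v : aff k (hom k v) = v.
Proof. by apply/rowP => j; rewrite mxE hom_lift hom_k divr1. Qed.

Lemma hom_aff k (p : 'rV[K]_3) : p 0 k != 0 -> hom k (aff k p) = (p 0 k)^-1 *: p.
Proof.
move=> pk; apply/rowP => j; rewrite !mxE; case: unliftP => [j' ->|->].
  by rewrite mxE mulrC.
by rewrite mulVf.
Qed.

Lemma affZ k (a : K) (p : 'rV[K]_3) : a != 0 -> aff k (a *: p) = aff k p.
Proof.
move=> a0; apply/rowP => j; rewrite !mxE invfM mulrACA divff // mul1r //.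
Qed.

Lemma hom_mulmx n k w (M : 'M[K]_(3, n)) j :
  (hom k w *m M) 0 j = M k j + (w *m (embmx k *m M)) 0 j.
Proof.
rewrite homE mulmxDl embE -mulmxA mxE; congr (_ + _).
by rewrite -rowE mxE.
Qed.

Lemma is_derive_hom n k (M : 'M[K]_(3, n)) u v j :
  is_derive u v (fun w => (hom k w *m M) 0 j : K) ((emb k v *m M) 0 j).
Proof.
rewrite (_ : (fun w => _) = cst (M k j) + (fun w => (w *m (embmx k *m M)) 0 j : K)); last first.
  by apply/funext => w; rewrite hom_mulmx.
have h := is_derive_mulmx_entry (embmx k *m M) u v j.
by apply: is_derive_eq; rewrite add0r embE mulmxA.
Qed.

Lemma differentiable_hom n k (M : 'M[K]_(3, n)) u j :
  differentiable (fun w => (hom k w *m M) 0 j : K) u.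
Proof.
rewrite (_ : (fun w => _) = cst (M k j) + (fun w => (w *m (embmx k *m M)) 0 j : K)); last first.
  by apply/funext => w; rewrite hom_mulmx.
by apply: differentiableD => //; exact: differentiable_mulmx_entry.
Qed.

Lemma differentiable_pow (V : normedModType K) (f : V -> K) n u :
  differentiable f u -> differentiable (fun w => f w ^+ n) u.
Proof.
case: n => [|n] df; first exact: differentiable_cst.
by have := differentiableX n df; rewrite exprfctE.
Qed.

Lemma differentiable_div (V : normedModType K) (f g : V -> K) u :
  differentiable f u -> differentiable g u -> g u != 0 ->
  differentiable (fun w => f w / g w) u.
Proof.
move=> df dg g0; apply: differentiableM => //.
exact: differentiableV.
Qed.

Lemma differentiable_aff k (p : 'rV[K]_3) : p 0 k != 0 -> differentiable (aff k) p.
Proof.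
move=> pk; apply: differentiable_row => j.
rewrite (_ : (fun w => _) = fun w : 'rV[K]_3 => w 0 (lift k j) / w 0 k); last first.
  by apply/funext => w; rewrite mxE.
by apply: differentiable_div => //; exact: differentiable_coord.
Qed.

Lemma differentiable_affhom k l (M : 'M[K]_3) u : (hom k u *m M) 0 l != 0 ->
  differentiable (fun w => aff l (hom k w *m M)) u.
Proof.
move=> s0; apply: differentiable_row => j.
rewrite (_ : (fun w => _) = fun w => (hom k w *m M) 0 (lift l j) / (hom k w *m M) 0 l); last first.
  by apply/funext => w; rewrite mxE.
by apply: differentiable_div => //; exact: differentiable_hom.
Qed.

(** Coordinate functions are linear and continuous, so they commute with
    differentials. *)
Lemma diff_entry (V : normedModType K) m n (f : V -> 'M[K]_(m, n)) (u v : V) i j :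
  differentiable f u -> 'd f u v i j = 'd (fun w => f w i j : K) u v.
Proof.
move=> df.
have @c : {linear 'M[K]_(m, n) -> K}.
  by exists (fun N : 'M[K]_(_, _) => N i j); do 2![eexists]; do ?[constructor];
     rewrite ?mxE// => ? *; rewrite ?mxE//; move=> ?; rewrite !mxE.
have cc : continuous c by exact: coord_continuous.
have -> : (fun w => f w i j : K) = c \o f by [].
have cd : differentiable c (f u) by exact: linear_differentiable.
by rewrite (diff_comp df cd) /= (diff_lin _ cc).
Qed.

Lemma is_derive_div (V : normedModType K) (f g : V -> K) (u v : V) (df dg : K) :
  is_derive u v f df -> is_derive u v g dg -> g u != 0 ->
  is_derive u v (fun w => f w / g w) ((g u)^-1 * df - (g u) ^- 2 * dg * f u).
Proof.
move=> h1 h2 g0; have dV := derivableV g0 (@ex_derive _ _ _ _ _ _ _ h2).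
have d1 : derivable f u v by exact: ex_derive.
have eV := deriveV g0 (@ex_derive _ _ _ _ _ _ _ h2).
apply: DeriveDef; first exact: (derivableM d1 dV).
rewrite (deriveM d1 dV) eV !derive_val /GRing.scale /=.
by ring.
Qed.

(** The differential of a projective map read in two affine charts.  The first
    term is the linear map itself and the second one is radial, so that it
    disappears in exterior products with the image point. *)
Lemma emb_diff_affhom k l (M : 'M[K]_3) u v :
  let P := hom k u *m M in let Q := emb k v *m M in
  P 0 l != 0 ->
  emb l ('d (fun w => aff l (hom k w *m M)) u v) =
    (P 0 l)^-1 *: Q - ((P 0 l) ^- 2 * Q 0 l) *: P.
Proof.
move=> P Q s0; have df := differentiable_affhom s0.
have E m : is_derive u v (fun w => (hom k w *m M) 0 m / (hom k w *m M) 0 l : K)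
    ((P 0 l)^-1 * Q 0 m - (P 0 l) ^- 2 * Q 0 l * P 0 m).
  by apply: is_derive_div => //; exact: is_derive_hom.
apply/rowP => j; rewrite [RHS]mxE [X in _ = X + _]mxE [X in _ = _ + X]mxE [X in _ = _ - X]mxE.
have [j' ->|->] := unliftP l j; last first.
  rewrite emb_k expr2 invfM; field; exact: s0.
rewrite emb_lift diff_entry //.
rewrite (_ : (fun w => _) = fun w => (hom k w *m M) 0 (lift l j') / (hom k w *m M) 0 l); last first.
  by apply/funext => w; rewrite mxE.
rewrite -deriveE ?derive_val //.
by apply: differentiable_div => //; exact: differentiable_hom.
Qed.

(** The bivector x /\ y as a skew matrix; it vanishes when y is a multiple of x. *)
Definition wedge (x y : 'rV[K]_3) : 'M[K]_3 := x^T *m y - y^T *m x.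

Lemma wedgeE x y i j : wedge x y i j = x 0 i * y 0 j - y 0 i * x 0 j.
Proof. by rewrite !mxE !big_ord1 !mxE. Qed.

Lemma wedgeZl a x y : wedge (a *: x) y = a *: wedge x y.
Proof. by apply/matrixP => i j; rewrite [RHS]mxE !wedgeE !mxE; ring. Qed.

Lemma wedgeZr a x y : wedge x (a *: y) = a *: wedge x y.
Proof. by apply/matrixP => i j; rewrite [RHS]mxE !wedgeE !mxE; ring. Qed.

Lemma wedgeBr x y z : wedge x (y - z) = wedge x y - wedge x z.
Proof. by rewrite /wedge mulmxBr linearB mulmxBl !opprD !opprK addrACA. Qed.

Lemma wedgexx x : wedge x x = 0.
Proof. by rewrite /wedge subrr. Qed.

Lemma wedge_mulmx (M : 'M[K]_3) x y : M^T *m wedge x y *m M = wedge (x *m M) (y *m M).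
Proof. by rewrite /wedge mulmxBr mulmxBl !trmx_mul !mulmxA. Qed.

(** Exterior multiplication by the image point kills the radial term, which turns
    the action on tangent vectors into the linear action on bivectors. *)
Lemma wedge_diff_affhom k l (M : 'M[K]_3) u v (a : K) (q : 'rV[K]_3) :
  hom k u *m M = a *: q -> a != 0 -> q 0 l != 0 ->
  wedge q (emb l ('d (fun w => aff l (hom k w *m M)) u v)) =
    (a * q 0 l)^-1 *: wedge q (emb k v *m M).
Proof.
move=> E a0 ql.
have Pl : (hom k u *m M) 0 l = a * q 0 l by rewrite E mxE.
rewrite emb_diff_affhom Pl ?mulf_neq0 // E wedgeBr !wedgeZr wedgexx !scaler0 subr0 //.
Qed.

Lemma wedge_mul_line x y n (l : 'M[K]_(3, n)) : x *m l = 0 ->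
  wedge x y *m l = x^T *m (y *m l).
Proof. by move=> xl; rewrite /wedge mulmxBl -!mulmxA xl mulmx0 subr0. Qed.
End Generic.

(** * Homogeneous coordinates on the projective plane *)

Section Projective.
Variable R : realType.
Local Notation C := R[i].
Implicit Types (p : 'rV[C]_3) (x : P2 R) (M : 'M[C]_3).

Lemma homog_hom k (u : 'rV[C]_2) : homog k u = hom k u.
Proof. by []. Qed.

Lemma affine_aff k x : affine k x = aff k (rep x).
Proof. by []. Qed.

Lemma projZ (a : C) p : a != 0 -> proj (a *: p) = proj p.
Proof.
move=> a0; rewrite /proj; congr insubd; apply/eqP; rewrite eqEsubv -!memvE.
by rewrite memvZ ?memv_line //= -{1}[p](scalerK a0) memvZ ?memv_line.
Qed.

Lemma chart_dom_proj k p : p != 0 -> chart_dom k (proj p) <-> p 0 k != 0.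
Proof.
by move=> /Defs.projK[a a0 E]; rewrite /chart_dom /= E mxE mulf_eq0 negb_or a0.
Qed.

Lemma neq0_entry p k : p 0 k != 0 -> p != 0.
Proof. by apply: contra_neq => ->; rewrite mxE. Qed.

Lemma chart_aff k p : p 0 k != 0 -> chart k (aff k p) = proj p.
Proof.
by move=> pk; rewrite /chart homog_hom hom_aff // projZ // invr_neq0.
Qed.

Lemma affine_proj k p : p != 0 -> affine k (proj p) = aff k p.
Proof. by move=> /Defs.projK[a a0 E]; rewrite affine_aff E affZ. Qed.

Lemma mulmx_neq0 M p : M \in unitmx -> p != 0 -> p *m M != 0.
Proof.
by move=> Mu; apply: contra_neq => E; rewrite -(mulmxK Mu p) E mul0mx.
Qed.

Lemma act_proj M p : M \in unitmx -> p != 0 -> act M (proj p) = proj (p *m M).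
Proof.
move=> Mu p0; have [a a0 E] := Defs.projK p0.
by rewrite /act E -scalemxAl projZ.
Qed.

Lemma act_chart M k u : M \in unitmx -> act M (chart k u) = proj (hom k u *m M).
Proof. by move=> Mu; rewrite act_proj // hom_neq0. Qed.

Lemma act1 x : act 1%:M x = x.
Proof. by rewrite /act mulmx1 Defs.repK. Qed.

Lemma affine_act_chart M k l : M \in unitmx ->
  affine l \o act M \o chart k = fun w => aff l (hom k w *m M).
Proof.
move=> Mu; apply/funext => w /=.
by rewrite act_chart // affine_proj // mulmx_neq0 // hom_neq0.
Qed.

Lemma affine_chart k l : affine l \o chart k = fun w : 'rV[C]_2 => aff l (hom k w *m 1%:M).
Proof.
rewrite -affine_act_chart ?unitmx1 //.
by apply/funext => w /=; rewrite act1.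
Qed.

Lemma exists_entry p : p != 0 -> exists k, p 0 k != 0.
Proof.
move=> p0; apply: contrapT => h; move: p0; apply/negP; rewrite negbK.
apply/eqP/rowP => k; rewrite mxE; apply/eqP; apply: contrapT => hk.
by apply: h; exists k; apply/negP.
Qed.

Lemma near_entry p k : p 0 k != 0 -> \forall q \near p, (q : 'rV[C]_3) 0 k != 0.
Proof.
move=> pk; have := @differentiable_coord C 1 3 p 0 k.
move=> /differentiable_continuous c.
exact: cvgr_neq0 c pk.
Qed.

End Projective.

(** * The bivector field of a foliation *)

Section Bivector.
Variable R : realType.
Local Notation C := R[i].
Implicit Types (p q : 'rV[C]_3) (x : P2 R) (M : 'M[C]_3).

Lemma continuous_aff k p : p 0 k != 0 -> {for p, continuous (aff k : 'rV[C]_3 -> 'rV[C]_2)}.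
Proof. by move=> pk; apply: differentiable_continuous; exact: differentiable_aff. Qed.

(** Sets and functions on the plane are pulled back to the cone C^3 \ 0, where no
    choice of chart is needed. *)
Lemma P2_open_near (U : set (P2 R)) p : P2_open U -> p != 0 -> U (proj p) ->
  \forall q \near p, U (proj q).
Proof.
move=> Uo p0 Up; have [k pk] := exists_entry p0.
have Ua : nbhs (aff k p) (chart k @^-1` U).
  by apply: open_nbhs_nbhs; split; [exact: Uo|rewrite /= chart_aff].
have c := continuous_aff pk Ua.
apply: filterS2 (near_entry pk) c => q qk /=.
by rewrite chart_aff.
Qed.

Lemma holo_proj (U : set (P2 R)) (g : P2 R -> C) p : holo U g -> p != 0 -> U (proj p) ->
  differentiable (fun q => g (proj q)) p.
Proof.
move=> gh p0 Up; have [k pk] := exists_entry p0.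
apply: (@near_eq_differentiable _ _ _ (fun q => (g \o chart k) (aff k q))).
  by apply: filterS (near_entry pk) => q qk /=; rewrite chart_aff.
apply: (@differentiable_comp _ _ _ _ (aff k) (g \o chart k)); first exact: differentiable_aff.
by apply: gh; rewrite chart_aff.
Qed.

Variables (F : foliation R) (e : nat) (h : fol_index F -> 'I_3 -> P2 R -> C).
Hypothesis h_nv : forall i k, nonvanishing_holo (fol_open i `&` chart_dom k) (h i k).
Hypothesis h_eq : forall i j k l x, fol_open i x -> fol_open j x -> chart_dom k x ->
  chart_dom l x -> h i k x * @fol_trans _ F i j x = (rep x 0 l / rep x 0 k) ^+ e * h j l x.

Definition field_lift i k p : 'rV[C]_3 := emb k (@fol_vf _ F i k (aff k p)).

(** The bivector p /\ V(p) computed in the chart k from the i-th local vector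
    field, normalized by the isomorphism with O(e).  The power of p_k makes it
    homogeneous of degree e + 2 in p. *)
Definition local_bivector i k p : 'M[C]_3 :=
  (p 0 k ^+ e.+1 * h i k (proj p)) *: wedge p (field_lift i k p).

Lemma differentiable_field_lift i k p a : p 0 k != 0 -> fol_open i (proj p) ->
  differentiable (fun q => field_lift i k q 0 a : C) p.
Proof.
move=> pk Up; rewrite (_ : (fun q => _) = fun q => (fol_vf i k (aff k q) *m embmx _ k) 0 a); last first.
  by apply/funext => q; rewrite /field_lift embE.
apply: (@differentiable_comp _ _ _ _ (fun q => fol_vf i k (aff k q)) (fun w => (w *m embmx _ k) 0 a)).
  apply: (@differentiable_comp _ _ _ _ (aff k) (fol_vf i k)); first exact: differentiable_aff.
  by apply: vf_holo; rewrite chart_aff.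
exact: differentiable_mulmx_entry.
Qed.

Lemma ratio_proj p k l : p != 0 ->
  rep (proj p) 0 l / rep (proj p) 0 k = p 0 l / p 0 k.
Proof.
move=> /Defs.projK[a a0 ->]; rewrite !mxE.
by rewrite invfM mulrACA divff // mul1r.
Qed.

Lemma wedge_field_lift i k l p : p 0 k != 0 -> p 0 l != 0 -> fol_open i (proj p) ->
  wedge p (field_lift i l p) = (p 0 k / p 0 l) *: wedge p (field_lift i k p).
Proof.
move=> pk pl Up; have p0 := neq0_entry pk.
have cu := chart_aff pk.
have := @vf_compat _ _ (fol_vf i) k l (aff k p).
rewrite cu affine_proj // => /(_ Up) vc.
have {}vc := vc ((chart_dom_proj l p0).2 pl).
have E1 : hom k (aff k p) *m 1%:M = (p 0 k)^-1 *: p by rewrite mulmx1 hom_aff.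
have W := wedge_diff_affhom (fol_vf i k (aff k p)) E1 (invr_neq0 pk) pl.
rewrite /field_lift vc affine_chart.
rewrite W.
rewrite mulmx1.
congr (_ *: _).
rewrite invfM.
by rewrite invrK.
Qed.

Lemma field_lift_trans i j k p : p 0 k != 0 -> fol_open i (proj p) -> fol_open j (proj p) ->
  field_lift i k p = fol_trans i j (proj p) *: field_lift j k p.
Proof.
move=> pk Ui Uj; have := @fol_glue _ F i j k (aff k p).
rewrite chart_aff // => /(_ Ui Uj) E.
by rewrite /field_lift E !embE scalemxAl.
Qed.

(** A change of chart multiplies the lifted field by p_k / p_l up to a radial
    term, a change of local field multiplies it by the transition function, and
    the cocycle relation for O(e) compensates for both. *)
Lemma local_bivector_indep i j k l p : p 0 k != 0 -> p 0 l != 0 ->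
  fol_open i (proj p) -> fol_open j (proj p) -> local_bivector i k p = local_bivector j l p.
Proof.
move=> pk pl Ui Uj; have p0 := neq0_entry pk.
have Dk := (chart_dom_proj k p0).2 pk; have Dl := (chart_dom_proj l p0).2 pl.
rewrite /local_bivector (field_lift_trans pk Ui Uj) (wedge_field_lift pk pl Uj) wedgeZr !scalerA.
congr (_ *: _).
rewrite -mulrA (h_eq (l := l)) // ratio_proj // expr_div_n [p 0 k ^+ _]exprS [p 0 l ^+ e.+1]exprS.
by field; rewrite pl expf_neq0.
Qed.

Lemma bivector_exists : exists A : 'rV[C]_3 -> 'M[C]_3, forall p i k,
  p 0 k != 0 -> fol_open i (proj p) -> A p = local_bivector i k p.
Proof.
suff /choice[A AP] : forall p, exists Ap, forall i k,
    p 0 k != 0 -> fol_open i (proj p) -> Ap = local_bivector i k p.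
  by exists A => p i k; exact: AP.
move=> p; have [->|p0] := eqVneq p 0.
  by exists 0 => i k; rewrite mxE eqxx.
have [k pk] := exists_entry p0; have [i Ui] := fol_cover F (proj p).
exists (local_bivector i k p) => j l pl Uj; exact: local_bivector_indep.
Qed.

Variable A : 'rV[C]_3 -> 'M[C]_3.
Hypothesis A_local : forall p i k, p 0 k != 0 -> fol_open i (proj p) -> A p = local_bivector i k p.

Lemma bivectorZ (c : C) p : c != 0 -> p != 0 -> A (c *: p) = c ^+ e.+2 *: A p.
Proof.
move=> c0 p0; have [k pk] := exists_entry p0; have [i Ui] := fol_cover F (proj p).
have cpk : (c *: p) 0 k != 0 by rewrite mxE mulf_neq0.
rewrite (A_local pk Ui) (@A_local _ i k cpk) ?projZ //.
rewrite /local_bivector projZ // /field_lift affZ // wedgeZl !scalerA mxE exprMn; congr (_ *: _).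
by rewrite [c ^+ e.+2]exprS; ring.
Qed.

(** Being divisible by p is what remains of the field V once its radial part
    has been forgotten. *)
Lemma bivector_wedge p : p != 0 -> exists V, A p = wedge p V.
Proof.
move=> p0; have [k pk] := exists_entry p0; have [i Ui] := fol_cover F (proj p).
by rewrite (A_local pk Ui) /local_bivector -wedgeZr; exists ((p 0 k ^+ e.+1 * h i k (proj p)) *: field_lift i k p).
Qed.

Lemma differentiable_bivector p a b : p != 0 -> differentiable (fun q => A q a b : C) p.
Proof.
move=> p0; have [k pk] := exists_entry p0; have [i Ui] := fol_cover F (proj p).
have Dk := (chart_dom_proj k p0).2 pk.
have near_k := near_entry pk.
have near_U := P2_open_near (@fol_openP _ F i) p0 Ui.
apply: (@near_eq_differentiable _ _ _ (fun q => (q 0 k ^+ e.+1 * h i k (proj q)) *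
   (q 0 a * field_lift i k q 0 b - field_lift i k q 0 a * q 0 b))).
  apply: filterS2 near_k near_U => q qk Uq.
  by rewrite (A_local qk Uq) /local_bivector [RHS]mxE wedgeE.
have co j : differentiable (fun q : 'rV[C]_3 => q 0 j : C) p by exact: differentiable_coord.
have dv j : differentiable (fun q => field_lift i k q 0 j : C) p by exact: differentiable_field_lift.
apply: differentiableM; first apply: differentiableM.
- exact: differentiable_pow (co k).
- by apply: (@holo_proj (fol_open i `&` chart_dom k)) => //; have [] := h_nv i k.
- by apply: differentiableB; apply: differentiableM.
Qed.
End Bivector.

(** * Automorphisms rescale the bivector field *)

Section Automorphisms.
Variable R : realType.
Local Notation C := R[i].
Implicit Types (p q : 'rV[C]_3) (x : P2 R) (M : 'M[C]_3).

Variables (F : foliation R) (e : nat) (h : fol_index F -> 'I_3 -> P2 R -> C).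
Hypothesis h_nv : forall i k, nonvanishing_holo (fol_open i `&` chart_dom k) (h i k).
Variable A : 'rV[C]_3 -> 'M[C]_3.
Hypothesis A_local : forall p i k, p 0 k != 0 -> fol_open i (proj p) -> A p = local_bivector e h i k p.

Lemma wedge_emb_eq0 k p (v : 'rV[C]_2) : p 0 k != 0 -> wedge p (emb k v) = 0 -> v = 0.
Proof.
move=> pk /matrixP E; apply/rowP => j; have := E k (lift k j).
rewrite wedgeE emb_k emb_lift mul0r subr0 !mxE => /eqP.
by rewrite mulf_eq0 (negPf pk) => /eqP.
Qed.

Lemma coef_neq0 i k p : p 0 k != 0 -> fol_open i (proj p) ->
  p 0 k ^+ e.+1 * h i k (proj p) != 0.
Proof.
move=> pk Ui; rewrite mulf_neq0 ?expf_neq0 //.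
by have [_] := h_nv i k; apply; split => //; apply/chart_dom_proj => //; exact: neq0_entry pk.
Qed.

Lemma continuous_scaled_hom k (c : C) : continuous (fun w : 'rV[C]_2 => c *: hom k w).
Proof.
move=> u; apply: differentiable_continuous; apply: differentiable_row => j.
rewrite (_ : (fun w => _) = fun w => c * ((hom k w *m 1%:M) 0 j : C)); last first.
  by apply/funext => w; rewrite mulmx1 mxE.
by apply: differentiableM; [exact: differentiable_cst|exact: differentiable_hom].
Qed.

(** The zeros are isolated, which makes the factor of an automorphism
    well defined also at the singular points. *)
Lemma bivector_not_near0 p : p != 0 -> ~ (\forall q \near p, A q = 0).
Proof.
move=> p0 A0; have [k pk] := exists_entry p0; have [i Ui] := fol_cover F (proj p).
pose u := aff k p; have pE : p = p 0 k *: hom k u by rewrite hom_aff // scalerA mulfV // scale1r.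
have nearU := P2_open_near (@fol_openP _ F i) p0 Ui.
have vz : \forall q \near p, fol_vf i k (aff k q) = 0.
  apply: filterS3 A0 nearU (near_entry pk) => q Aq Uq qk.
  apply: (@wedge_emb_eq0 k q) => //.
  move: Aq; rewrite (A_local qk Uq) => /eqP; rewrite scaler_eq0 (negPf (coef_neq0 qk Uq)).
  by move=> /eqP.
have vz' : \forall w \near u, fol_vf i k w = 0.
  have vz2 : \forall w \near u, fol_vf i k (aff k (p 0 k *: hom k w)) = 0.
    by apply: (@continuous_scaled_hom k (p 0 k) u (fun q => fol_vf i k (aff k q) = 0)); rewrite -pE.
  by apply: filterS vz2 => w; rewrite /= affZ // aff_hom.
have Uu : fol_open i (chart k u) by rewrite chart_aff.
have := @fol_isolated _ F i k u Uu (nbhs_singleton vz').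
rewrite /dnbhs /within /= => iso.
(* A zero that is isolated among locally vanishing values would make u an
   isolated point of the plane. *)
have both : \forall w \near u, w = u.
  apply: filterS2 vz' iso => w E h1; apply/eqP; apply: contrapT => /negP /h1.
  by rewrite E eqxx.
have ct : {for (0 : C), continuous (fun t : C => t *: (delta_mx 0 0 : 'rV[C]_2) + u)}.
  apply: differentiable_continuous; apply: differentiableD; last exact: differentiable_cst.
  exact: differentiableZl.
have : \forall t \near (0 : C), t *: (delta_mx 0 0 : 'rV[C]_2) + u = u.
  by apply: (ct (fun w => w = u)); rewrite scale0r add0r.
move=> near0.
have : \forall t \near (0 : C)^', False.
  near=> t.
  have t0 : t != 0 by near: t; exact: nbhs_dnbhs_neq.
  have : t *: (delta_mx 0 0 : 'rV[C]_2) + u = u by near: t; apply: nbhs_dnbhs.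
  move=> /eqP; rewrite -subr_eq0 addrK scaler_eq0 (negPf t0) /= => /eqP /rowP/(_ 0).
  by rewrite !mxE => /eqP; rewrite oner_eq0.
by move/filter_ex => [].
Unshelve. all: by end_near.
Qed.

Section OneAutomorphism.
Variable M : 'M[C]_3.
Hypothesis M_unit : M \in unitmx.
Variable g : fol_index F -> fol_index F -> P2 R -> C.
Hypothesis g_nv : forall i j,
  nonvanishing_holo (fol_open i `&` act M @^-1` fol_open j) (g i j).
Hypothesis g_eq : forall i j k l u, fol_open i (chart k u) ->
  fol_open j (act M (chart k u)) -> chart_dom l (act M (chart k u)) ->
  'd (affine l \o act M \o chart k) u (fol_vf i k u) =
  g i j (chart k u) *: fol_vf j l (affine l (act M (chart k u))).

Definition admissible i k j l q := [/\ q 0 k != 0, @fol_open _ F i (proj q),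
  (q *m M) 0 l != 0 & @fol_open _ F j (proj (q *m M))].

(** The scalar by which the linear map M rescales the bivector field, computed with
    the charts k, l and the local fields i, j at the source and at the target. *)
Definition factor i k j l q : C :=
  q 0 k ^+ e.+1 * h i k (proj q) * ((q *m M) 0 l / q 0 k) * g i j (proj q) /
  ((q *m M) 0 l ^+ e.+1 * h j l (proj (q *m M))).

Lemma differentiable_mulmxr q : differentiable (fun q : 'rV[C]_3 => q *m M) q.
Proof. by apply: differentiable_row => j; exact: differentiable_mulmx_entry. Qed.

Lemma near_mulmxr (P : set 'rV[C]_3) q : nbhs (q *m M) P -> \forall q' \near q, P (q' *m M).
Proof.
move=> hP; have := differentiable_continuous (differentiable_mulmxr q).
exact.
Qed.

Lemma near_admissible i k j l q : admissible i k j l q -> \forall q' \near q, admissible i k j l q'.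
Proof.
move=> [qk Ui ql Uj]; have q0 := neq0_entry qk.
have n1 := near_entry qk; have n2 := P2_open_near (@fol_openP _ F i) q0 Ui.
have n3 := near_mulmxr (near_entry ql).
have n4 := near_mulmxr (P2_open_near (@fol_openP _ F j) (neq0_entry ql) Uj).
apply: filterS2 (filterI n1 n2) (filterI n3 n4) => q' [h1 h2] [h3 h4].
by split.
Qed.

Lemma exists_admissible q : q != 0 -> exists i k j l, admissible i k j l q.
Proof.
move=> q0; have [k qk] := exists_entry q0; have [i Ui] := fol_cover F (proj q).
have qM0 := mulmx_neq0 M_unit q0.
have [l ql] := exists_entry qM0; have [j Uj] := fol_cover F (proj (q *m M)).
by exists i, k, j, l.
Qed.

Lemma admissible_act i k j l q : admissible i k j l q ->
  (fol_open i `&` act M @^-1` fol_open j) (proj q).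
Proof. by move=> [qk Ui ql Uj]; split => //=; rewrite act_proj // (neq0_entry qk). Qed.

Lemma factor_neq0 i k j l q : admissible i k j l q -> factor i k j l q != 0.
Proof.
move=> adm; have [qk Ui ql Uj] := adm.
rewrite /factor; do ![rewrite mulf_neq0 ?invr_neq0 ?coef_neq0 //].
by have [_] := g_nv i j; apply; exact: admissible_act adm.
Qed.

Lemma differentiable_factor i k j l q : admissible i k j l q -> differentiable (factor i k j l) q.
Proof.
move=> adm; have [qk Ui ql Uj] := adm; have q0 := neq0_entry qk.
have qM0 := neq0_entry ql.
have Dk := (chart_dom_proj k q0).2 qk; have Dl := (chart_dom_proj l qM0).2 ql.
have d1 : differentiable (fun q : 'rV[C]_3 => q 0 k : C) q by exact: differentiable_coord.
have d2 : differentiable (fun q : 'rV[C]_3 => (q *m M) 0 l : C) q by exact: differentiable_mulmx_entry.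
have d3 : differentiable (fun q => h i k (proj q)) q.
  by apply: (@holo_proj _ (fol_open i `&` chart_dom k)) => //; have [] := h_nv i k.
have d4 : differentiable (fun q => g i j (proj q)) q.
  apply: (@holo_proj _ (fol_open i `&` act M @^-1` fol_open j)) => //; first by have [] := g_nv i j.
  exact: admissible_act adm.
have d5 : differentiable (fun q : 'rV[C]_3 => h j l (proj (q *m M))) q.
  apply: (@differentiable_comp _ _ _ _ (fun q : 'rV[C]_3 => q *m M) (fun q => h j l (proj q))).
    exact: differentiable_mulmxr.
  by apply: (@holo_proj _ (fol_open j `&` chart_dom l)) => //; have [] := h_nv j l.
apply: differentiable_div; last exact: coef_neq0.
  apply: differentiableM => //; apply: differentiableM; last exact: differentiable_div.
  by apply: differentiableM => //; exact: differentiable_pow.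
by apply: differentiableM => //; exact: differentiable_pow.
Qed.

Lemma factor_eq i k j l q : admissible i k j l q ->
  M^T *m A q *m M = factor i k j l q *: A (q *m M).
Proof.
move=> adm; have [qk Ui ql Uj] := adm; have q0 := neq0_entry qk.
have qM0 := neq0_entry ql.
have Dl := (chart_dom_proj l qM0).2 ql.
have := @g_eq i j k l (aff k q); rewrite chart_aff // act_proj // affine_proj //.
move=> /(_ Ui Uj Dl); rewrite affine_act_chart // => gE.
pose s := (q *m M) 0 l / q 0 k.
have PE : hom k (aff k q) *m M = (q 0 k)^-1 *: (q *m M) by rewrite hom_aff // scalemxAl.
have Pl : (hom k (aff k q) *m M) 0 l = s by rewrite PE mxE mulrC.
have s0 : s != 0 by rewrite mulf_neq0 // invr_neq0.
have gE' : wedge (q *m M) (field_lift i k q *m M) = (s * g i j (proj q)) *: wedge (q *m M) (field_lift j l (q *m M)).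
  have E := wedge_diff_affhom (fol_vf i k (aff k q)) PE (invr_neq0 qk) ql.
  rewrite gE !embE -scalemxAl -!embE wedgeZr mulrC in E.
  by rewrite -scalerA E -/s scalerKV.
rewrite (A_local qk Ui) (A_local ql Uj) /local_bivector -scalemxAr -scalemxAl wedge_mulmx gE' !scalerA.
congr (_ *: _); rewrite /factor -/s mulrA.
by rewrite divfK // coef_neq0.
Qed.

(** Two expressions of the factor both satisfy [factor_eq] near q.  If they
    differed at q they would differ near q, and the bivector would vanish there. *)
Lemma factor_indep i k j l i' k' j' l' q : admissible i k j l q -> admissible i' k' j' l' q ->
  factor i k j l q = factor i' k' j' l' q.
Proof.
move=> a1 a2; apply/eqP; apply: contrapT => /negP; rewrite -subr_eq0 => ne.
have [qk _ _ _] := a1; have q0 := neq0_entry qk.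
have d : differentiable (fun q => factor i k j l q - factor i' k' j' l' q) q.
  by apply: differentiableB; exact: differentiable_factor.
have nne : \forall q' \near q, factor i k j l q' - factor i' k' j' l' q' != 0.
  by move/differentiable_continuous: d => d; exact: cvgr_neq0 d ne.
apply: (bivector_not_near0 q0).
apply: filterS3 nne (near_admissible a1) (near_admissible a2) => q' n b1 b2.
have := factor_eq b1; have := factor_eq b2 => -> /eqP; rewrite -subr_eq0 -scalerBl scaler_eq0.
rewrite -oppr_eq0 opprB (negPf n) /= => /eqP E.
have := factor_eq b1; rewrite E scaler0 => /(congr1 (fun X => X *m invmx M)).
rewrite mulmxK // mul0mx => /(congr1 (fun X => invmx M^T *m X)).
by rewrite mulKmx ?unitmx_tr // mulmx0.
Qed.

Lemma factorZ i k j l (c : C) q : c != 0 -> admissible i k j l q ->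
  admissible i k j l (c *: q) /\ factor i k j l (c *: q) = factor i k j l q.
Proof.
move=> c0 [qk Ui ql Uj]; have q0 := neq0_entry qk; have qM0 := neq0_entry ql.
split; first by split; rewrite -?scalemxAl ?projZ // mxE mulf_neq0.
rewrite /factor -!scalemxAl !projZ // (mxE _ _ 0 k) (mxE _ _ 0 l).
have [_] := h_nv j l => /(_ (proj (q *m M))) hn.
have {}hn : h j l (proj (q *m M)) != 0 by apply: hn; split => //; apply/chart_dom_proj.
exact: scale_factor.
Qed.

(** The factor is a holomorphic function on the plane, so it is constant on every
    projective line, and any two points lie on a common line. *)
Lemma automorphism_factor_exists : exists2 c : C, c != 0 &
  forall q, q != 0 -> M^T *m A q *m M = c *: A (q *m M).
Proof.
have /choice[c cP] : forall q, exists cq : C, forall i k j l, admissible i k j l q -> cq = factor i k j l q.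
  move=> q; have [->|q0] := eqVneq q 0.
    by exists 0 => i k j l []; rewrite mxE eqxx.
  have [i [k [j [l a]]]] := exists_admissible q0.
  by exists (factor i k j l q) => i' k' j' l' a'; exact: factor_indep.
have cd q : q != 0 -> differentiable c q.
  move=> q0; have [i [k [j [l a]]]] := exists_admissible q0.
  apply: (@near_eq_differentiable _ _ _ (factor i k j l)); last exact: differentiable_factor.
  by apply: filterS (near_admissible a) => q' /cP.
have cZ (a : C) q : a != 0 -> q != 0 -> c (a *: q) = c q.
  move=> a0 q0; have [i [k [j [l ad]]]] := exists_admissible q0.
  have [ad' E] := factorZ a0 ad.
  by rewrite (cP _ _ _ _ _ ad) (cP _ _ _ _ _ ad').
have cline p q : (forall x : C, p + x *: q != 0) -> (forall x : C, q + x *: p != 0) -> c p = c q.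
  move=> n1 n2.
  have dl (a b : 'rV[C]_3) : (forall x : C, a + x *: b != 0) ->
      forall z : C, differentiable (fun x : C => c (a + x *: b)) z.
    move=> n z; apply: (@differentiable_comp _ _ _ _ (fun x : C => a + x *: b) c).
      by apply: differentiableD; [exact: differentiable_cst|exact: differentiableZl].
    exact: cd.
  have E : forall z : C, z != 0 -> c (p + z *: q) = c (q + z^-1 *: p).
    by move=> z z0; rewrite -[RHS](cZ z) // scalerDr scalerA mulfV // scale1r addrC.
  have E' : forall z : C, z != 0 -> c (q + z *: p) = c (p + z^-1 *: q).
    by move=> z z0; rewrite -[RHS](cZ z) // scalerDr scalerA mulfV // scale1r addrC.
  (* The parameters x and 1 / x describe the same line; both ends meet at p + q. *)
  have k1 := entire_const (dl _ _ n1) (dl _ _ n2) E 0 1.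
  have k2 := entire_const (dl _ _ n2) (dl _ _ n1) E' 0 1.
  rewrite /= scale0r addr0 scale1r in k1; rewrite /= scale0r addr0 scale1r in k2.
  by rewrite k1 k2 addrC.
have cc p q : p != 0 -> q != 0 -> c p = c q.
  move=> p0 q0.
  have dep (a b : 'rV[C]_3) (x : C) : a != 0 -> b != 0 -> a + x *: b = 0 -> c a = c b.
    move=> an bn /eqP; rewrite addr_eq0 -scaleNr => /eqP E; rewrite E cZ //.
    by apply: contra_neq an => E'; rewrite E E' scale0r.
  case: (pselect (exists x : C, p + x *: q = 0)) => [[x /dep]|n1]; first exact.
  case: (pselect (exists x : C, q + x *: p = 0)) => [[x /dep]|n2]; first by move=> ->.
  apply: cline => x; apply/eqP => E; [apply: n1|apply: n2]; by exists x.
pose p1 : 'rV[C]_3 := delta_mx 0 0.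
have p10 : p1 != 0 by apply/eqP => /rowP/(_ 0)/eqP; rewrite !mxE oner_eq0.
exists (c p1).
  have [i [k [j [l a]]]] := exists_admissible p10.
  by rewrite (cP _ _ _ _ _ a) factor_neq0.
move=> q q0; have [i [k [j [l a]]]] := exists_admissible q0.
by rewrite (cc p1 q) // (cP _ _ _ _ _ a); exact: factor_eq.
Qed.
End OneAutomorphism.

Lemma automorphism_factor M : M \in unitmx -> preserves F M ->
  exists2 c : C, c != 0 & forall q, q != 0 -> M^T *m A q *m M = c *: A (q *m M).
Proof.
move=> Mu Mp.
have [g gP] := choice (fun ij : fol_index F * fol_index F => Mp ij.1 ij.2).
apply: (@automorphism_factor_exists M Mu (fun i j => g (i, j))) => i j; first by have [] := gP (i, j).
by move=> k l u U1 U2 D; have [_] := gP (i, j); apply.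
Qed.
End Automorphisms.

(** * Invariant lines and reduced singularities *)

Section LocalConditions.
Variable R : realType.
Local Notation C := R[i].
Implicit Types (p q : 'rV[C]_3) (x : P2 R) (M : 'M[C]_3).

Variables (F : foliation R) (e : nat) (h : fol_index F -> 'I_3 -> P2 R -> C).
Hypothesis h_nv : forall i k, nonvanishing_holo (fol_open i `&` chart_dom k) (h i k).
Variable A : 'rV[C]_3 -> 'M[C]_3.
Hypothesis A_local : forall p i k, p 0 k != 0 -> fol_open i (proj p) -> A p = local_bivector e h i k p.

Lemma line_proj (l : 'cV[C]_3) p : p != 0 -> line l (proj p) <-> p *m l = 0.
Proof.
move=> /Defs.projK[a a0 E]; rewrite /line /= E -scalemxAl; split => [/eqP|->].
  by rewrite scaler_eq0 (negPf a0) => /eqP.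
by rewrite scaler0.
Qed.

(** On the line p l = 0 the product (p /\ V) l is p^T (V l). *)
Lemma invariant_line_bivector (l : 'cV[C]_3) :
  (forall p, p != 0 -> p *m l = 0 -> A p *m l = 0) -> invariant_line F l.
Proof.
move=> Al i k u Ui /line_proj; rewrite homog_hom => /(_ (hom_neq0 _ _)) pl.
set v := fol_vf i k u; pose p := hom k u.
have pk : p 0 k != 0 by rewrite hom_k oner_eq0.
have Up : fol_open i (proj p) by [].
have := Al p (hom_neq0 _ _) pl; rewrite (A_local pk Up) /local_bivector -scalemxAl => /eqP.
rewrite scaler_eq0 (negPf (coef_neq0 e h_nv pk Up)) orFb.
rewrite (wedge_mul_line _ pl).
move=> /eqP /colP/(_ k); rewrite !mxE big_ord1 mxE hom_k mul1r.
rewrite /field_lift aff_hom -/v => vl.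
have dE (w : 'rV[C]_2) : differentiable (fun w : 'rV[C]_2 => homog k w *m l) w.
  rewrite (_ : (fun w => _) = fun w => \row_(j < 1) (hom k w *m l) 0 j); last first.
    by apply/funext => w'; apply/rowP => j; rewrite mxE.
  apply: differentiable_row => j.
  rewrite (_ : (fun w => _) = fun w => (hom k w *m l) 0 j); last by apply/funext => w'; rewrite mxE.
  exact: differentiable_hom.
apply/matrixP => a b; rewrite !ord1 diff_entry // [RHS]mxE.
rewrite -deriveE; last exact: differentiable_hom.
have D := is_derive_hom k l u v 0.
by rewrite (@derive_val _ _ _ _ _ _ _ D).
Qed.

(** In a chart the components of the field are entries of the bivector divided by
    a nowhere zero function, so a double zero of the bivector is a singularity
    whose linear part has characteristic polynomial X^2. *)
Lemma vanishing_not_reduced p : p != 0 -> A p = 0 ->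
  (forall a b v, 'd (fun q => A q a b : C) p v = 0) ->
  Sing F (proj p) /\ ~ reduced_singularity F (proj p).
Proof.
move=> p0 A0 dA.
have [k pk] := exists_entry p0; have [i Ui] := fol_cover F (proj p).
pose u := aff k p; have pE : p = p 0 k *: hom k u by rewrite hom_aff // scalerA mulfV // scale1r.
have cu : chart k u = proj p by exact: chart_aff.
have v0 : fol_vf i k u = 0.
  apply: (@wedge_emb_eq0 _ k p) => //.
  move: A0; rewrite (A_local pk Ui) => /eqP; rewrite scaler_eq0 (negPf (coef_neq0 e h_nv pk Ui)).
  by move/eqP.
split; first by exists i, k, u.
move=> red; have := red i k u Ui cu 0 0.
suff J0 : 'J (fol_vf i k) u = 0.
  rewrite J0 => /(_ _)[|]; last by move=> [].
  rewrite /char_poly /char_poly_mx map_mx0 subr0 det_scalar !subr0 expr2 //.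
have dv : differentiable (fol_vf i k) u by apply: vf_holo; rewrite cu.
apply/matrixP => a b; rewrite mxE [RHS]mxE.
set w := delta_mx 0 a.
rewrite diff_entry //.
pose inner (w : 'rV[C]_2) : 'rV[C]_3 := hom k w *m (p 0 k)%:M.
have innerE w' : inner w' = p 0 k *: hom k w' by rewrite /inner mul_mx_scalar.
have inner_u : inner u = p by rewrite innerE -pE.
have di : differentiable inner u.
  by apply: differentiable_row => j; exact: differentiable_hom.
(* Near u the b-th component of the field is N / H, where N has a double zero. *)
pose N (w : 'rV[C]_2) : C := A (inner w) k (lift k b).
have dAp : differentiable (fun q => A q k (lift k b) : C) (inner u).
  by rewrite inner_u; exact: (differentiable_bivector h_nv A_local).
have dN : differentiable N u by exact: (differentiable_comp di dAp).
have N0 : N u = 0 by rewrite /N inner_u A0 mxE.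
have DN : is_derive u w N 0.
  apply: DeriveDef; first exact: diff_derivable.
  by rewrite deriveE // (diff_comp di dAp) /= inner_u dA.
pose H (w : 'rV[C]_2) : C := p 0 k ^+ e.+2 * h i k (chart k w).
have Dk := (chart_dom_proj k p0).2 pk.
have hh := h_nv i k.
have dH : differentiable H u.
  apply: differentiableM; first exact: differentiable_cst.
  by have [hol _] := hh; apply: hol; rewrite cu; split.
have H0 : H u != 0.
  rewrite mulf_neq0 ?expf_neq0 //; have [_ hn] := hh; rewrite cu; apply: hn; by split.
have DH : is_derive u w H ('D_w H u).
  by apply: DeriveDef => //; exact: diff_derivable.
have near_eq : \forall w' \near u, N w' / H w' = fol_vf i k w' 0 b.
  have nU : nbhs u (chart k @^-1` fol_open i).
    apply: open_nbhs_nbhs; split; first exact: fol_openP.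
    by rewrite /= cu.
  apply: filterS nU => w' Uw.
  have qk : inner w' 0 k != 0 by rewrite innerE mxE hom_k mulr1.
  have qproj : proj (inner w') = chart k w' by rewrite innerE projZ.
  have Uq : fol_open i (proj (inner w')) by rewrite qproj.
  have hw0 : h i k (chart k w') != 0.
    rewrite -qproj; have [_ hn] := hh; apply: hn; split => //.
    by apply/chart_dom_proj => //; exact: neq0_entry qk.
  rewrite /N (A_local qk Uq) /local_bivector [X in X / _]mxE wedgeE qproj /field_lift emb_k emb_lift mul0r subr0.
  rewrite innerE affZ // aff_hom mxE hom_k mulr1 /H.
  by rewrite [p 0 k ^+ e.+2]exprSr; field; rewrite pk hw0 expf_neq0.
have := near_eq_is_derive near_eq (is_derive_div DN DH H0).
rewrite mulr0 N0 mulr0 subr0 => D.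
rewrite -deriveE; last exact: differentiable_entry.
by rewrite (@derive_val _ _ _ _ _ _ _ D).
Qed.
End LocalConditions.

(** * Exponents along a coordinate line *)

Lemma poly_eq0_pointwise (K : numFieldType) (p : {poly K}) : (forall x, p.[x] = 0) -> p = 0.
Proof.
move=> p0; apply: (@roots_geq_poly_eq0 _ p (mkseq (fun i => i%:R) (size p))).
- by apply/allP => x _; apply/rootP.
- rewrite map_inj_uniq ?iota_uniq // => m n /eqP.
  by rewrite eqr_nat => /eqP.
- by rewrite size_mkseq.
Qed.

Lemma scaled_poly_coef (K : numFieldType) (p : {poly K}) (a b lam : K) m :
  (forall x, a * p.[x] = b * p.[lam * x]) -> p`_m != 0 -> a = b * lam ^+ m.
Proof.
move=> E pm; pose q := \poly_(i < size p) (a * p`_i - b * (lam ^+ i * p`_i)).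
have q0 : q = 0.
  apply: poly_eq0_pointwise => x; rewrite horner_poly.
  have := E x; rewrite !horner_coef !mulr_sumr => /eqP; rewrite -subr_eq0 -sumrB => /eqP S0.
  rewrite -[RHS]S0.
  by apply: eq_bigr => i _; rewrite exprMn; ring.
have := congr1 (fun r : {poly K} => r`_m) q0; rewrite coef0 coef_poly.
case: ltnP => [_|h]; last by rewrite nth_default // eqxx in pm.
move=> /eqP; rewrite mulrA -mulrBl mulf_eq0 (negPf pm) orbF subr_eq0 => /eqP //.
Qed.

Section BivectorFields.
Variable R : realType.
Local Notation C := R[i].
Local Notation E_ i := (delta_mx 0 i : 'rV[C]_3).

(** What the group-theoretic part retains of a foliation of degree e + 1. *)
Record bivector_field (e : nat) (B : 'rV[C]_3 -> 'M[C]_3) : Prop := BivectorField {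
  bf_homog : forall (c : C) q, c != 0 -> q != 0 -> B (c *: q) = c ^+ e.+2 *: B q;
  bf_wedge : forall q, q != 0 -> exists V, B q = wedge q V;
  bf_diff : forall q a b, q != 0 -> differentiable (fun q => B q a b : C) q }.

Definition torus_act (t q : 'rV[C]_3) : 'rV[C]_3 := \row_i (q 0 i * t 0 i).

(** The diagonal matrix t preserves the foliation with factor c. *)
Record semi_invariant (B : 'rV[C]_3 -> 'M[C]_3) (t : 'rV[C]_3) (c : C) : Prop := SemiInvariant {
  si_neq0 : forall i, t 0 i != 0;
  si_c0 : c != 0;
  si_eq : forall q a b, q != 0 -> t 0 a * t 0 b * B q a b = c * B (torus_act t q) a b }.

Variables (e : nat) (B : 'rV[C]_3 -> 'M[C]_3).
Hypothesis Bf : bivector_field e B.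

Lemma line_point (i j : 'I_3) (x y : C) a : i != j ->
  (x *: E_ i + y *: E_ j) 0 a = if a == i then x else if a == j then y else 0.
Proof.
move=> ij; rewrite !mxE /=.
case: eqVneq => [->|ai]; first by rewrite (negPf ij) mulr1 mulr0 addr0.
by rewrite mulr0 add0r; case: eqVneq => _; rewrite ?mulr1 ?mulr0.
Qed.

Lemma line_point_neq0 (i j : 'I_3) (x y : C) : i != j -> (x != 0) || (y != 0) ->
  x *: E_ i + y *: E_ j != 0.
Proof.
move=> ij h; apply/eqP => /rowP E; have := E i; have := E j; rewrite !line_point // !mxE !eqxx.
by rewrite eq_sym (negPf ij) => x0 y0; rewrite x0 y0 eqxx in h.
Qed.

Lemma differentiable_line (q v : 'rV[C]_3) a b : (forall x : C, q + x *: v != 0) ->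
  forall z : C, differentiable (fun x : C => B (q + x *: v) a b : C) z.
Proof.
move=> n z; apply: (@differentiable_comp _ _ _ _ (fun x : C => q + x *: v) (fun q => B q a b)).
  by apply: differentiableD; [exact: differentiable_cst|exact: differentiableZl].
exact: (bf_diff Bf).
Qed.

Section OneLine.
Variables (i j k : 'I_3).
Hypotheses (ij : i != j) (ik : i != k) (jk : j != k).

Definition line_fun (x y : C) a b := B (x *: E_ i + y *: E_ j) a b.

Lemma diff_line_x a b (z : C) : differentiable (fun x => line_fun x 1 a b) z.
Proof.
rewrite (_ : (fun x => _) = fun x : C => B (E_ j + x *: E_ i) a b); last first.
  by apply/funext => x; rewrite /line_fun scale1r addrC.
apply: differentiable_line => x; rewrite addrC -[E_ j]scale1r.
by apply: line_point_neq0; rewrite // oner_eq0 orbT.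
Qed.

Lemma diff_line_y a b (z : C) : differentiable (fun y => line_fun 1 y a b) z.
Proof.
rewrite (_ : (fun x => _) = fun x : C => B (E_ i + x *: E_ j) a b); last first.
  by apply/funext => x; rewrite /line_fun scale1r.
apply: differentiable_line => x; rewrite -[E_ i]scale1r.
by apply: line_point_neq0; rewrite // oner_eq0.
Qed.

Lemma line_funZ c x y a b : c != 0 -> (x != 0) || (y != 0) ->
  line_fun (c * x) (c * y) a b = c ^+ e.+2 * line_fun x y a b.
Proof.
move=> c0 h; rewrite /line_fun -!scalerA -scalerDr (bf_homog Bf) ?line_point_neq0 //.
by rewrite mxE.
Qed.

(** On the line q_k = 0 both entries are multiples of the k-th component of V,
    which is the form cutting out the tangencies with that line. *)
Lemma line_fun_k x y : (x != 0) || (y != 0) -> exists V, line_fun x y i k = x * V /\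
  line_fun x y j k = y * V.
Proof.
move=> h; have [V VE] := bf_wedge Bf (line_point_neq0 ij h); exists (V 0 k).
rewrite /line_fun VE !wedgeE !line_point // !eqxx ![k == _]eq_sym (negPf ik) (negPf jk).
by rewrite [j == i]eq_sym (negPf ij) !mulr0 !subr0.
Qed.

(** One power of z is gained over mere homogeneity by reading the common factor V_k
    in the entry (i, k) instead of (j, k): V_k has degree e + 1, not e + 2. *)
Lemma line_fun_inv z : z != 0 -> line_fun z 1 j k = z ^+ e.+1 * line_fun 1 z^-1 i k.
Proof.
move=> z0; have zE a b : line_fun z 1 a b = z ^+ e.+2 * line_fun 1 z^-1 a b.
  by rewrite -line_funZ ?oner_neq0 // mulr1 mulfV.
have [V [V1 V2]] := @line_fun_k 1 z^-1 (introT orP (or_introl (oner_neq0 _))).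
by rewrite zE V1 V2 mul1r [z ^+ e.+2]exprSr mulrA mulfK.
Qed.

Lemma line_fun_inv_sym z : z != 0 -> line_fun 1 z i k = z ^+ e.+1 * line_fun z^-1 1 j k.
Proof.
move=> z0; rewrite line_fun_inv ?invr_neq0 // invrK mulrA -exprMn mulfV //.
by rewrite expr1n mul1r.
Qed.

Lemma line_poly : exists2 p : {poly C}, (size p <= e.+2)%N & forall x, line_fun x 1 j k = p.[x].
Proof.
by apply: (entire_poly (diff_line_x j k) (diff_line_y i k)) => z; exact: line_fun_inv.
Qed.

Lemma line_poly_sym : exists2 p : {poly C}, (size p <= e.+2)%N & forall x, line_fun 1 x i k = p.[x].
Proof.
by apply: (entire_poly (diff_line_y i k) (diff_line_x j k)) => z; exact: line_fun_inv_sym.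
Qed.

(** If V_k vanished at all points [x : 1] it would vanish at [1 : 0] too, because
    its expression there is also a polynomial. *)
Lemma line_poly_neq0 (p : {poly C}) : (forall x, line_fun x 1 j k = p.[x]) ->
  (exists q : 'rV[C]_3, [/\ q != 0, q 0 k = 0 & exists a, B q a k != 0]) ->
  p != 0.
Proof.
move=> pE [q [q0 qk [a]]]; apply: contraNneq => p0.
have p0x x : line_fun x 1 j k = 0 by rewrite pE p0 horner0.
have qE : q = q 0 i *: E_ i + q 0 j *: E_ j.
  apply/rowP => b; rewrite line_point //.
  have [->//|bi] := eqVneq b i; have [->//|bj] := eqVneq b j.
  suff -> : b = k by [].
  apply/eqP; move: ij ik jk bi bj.
  by case: i => [[|[|[|?]]] ?] //; case: j => [[|[|[|?]]] ?] //; case: k => [[|[|[|?]]] ?] //;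
     case: b => [[|[|[|?]]] ?].
have nz : (q 0 i != 0) || (q 0 j != 0).
  rewrite -negb_and; apply: contra q0 => /andP[/eqP h1 /eqP h2].
  by rewrite qE h1 h2 !scale0r addr0.
have [V [V1 V2]] := line_fun_k nz.
have Vk0 : V = 0.
  (* The point [1 : 0] is the one that the coordinate x misses. *)
  have [qj|qj] := eqVneq (q 0 j) 0; last first.
    have := p0x (q 0 i / q 0 j).
    have -> : line_fun (q 0 i / q 0 j) 1 j k = (q 0 j)^-1 ^+ e.+2 * line_fun (q 0 i) (q 0 j) j k.
      by rewrite -line_funZ ?invr_neq0 // mulVf // mulrC.
    move/eqP; rewrite mulf_eq0 expf_eq0 invr_eq0 (negPf qj) /= V2 mulf_eq0 (negPf qj).
    by move=> /eqP.
  have qi : q 0 i != 0 by rewrite qj eqxx orbF in nz.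
  have [p' _ p'E] := line_poly_sym.
  have p'0 : p' = 0.
    suff : 'X * p' = 0 by move/eqP; rewrite mulf_eq0 polyX_eq0 => /eqP.
    apply: poly_eq0_pointwise => x; rewrite hornerM hornerX -p'E.
    have [->|x0] := eqVneq x 0; first by rewrite mul0r.
    by rewrite line_fun_inv_sym // p0x !mulr0.
  have := p'E 0; rewrite p'0 horner0.
  have -> : line_fun 1 0 i k = (q 0 i)^-1 ^+ e.+2 * line_fun (q 0 i) (q 0 j) i k.
    by rewrite -line_funZ ?invr_neq0 // mulVf // qj mulr0.
  move/eqP; rewrite mulf_eq0 expf_eq0 invr_eq0 (negPf qi) /= V1 mulf_eq0 (negPf qi).
  by move=> /eqP.
rewrite qE -/(line_fun _ _ a k).
have [W WE] := bf_wedge Bf q0.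
have : a = i \/ a = j \/ a = k.
  move: ij ik jk.
  by case: i => [[|[|[|?]]] ?] //; case: j => [[|[|[|?]]] ?] //; case: k => [[|[|[|?]]] ?] //;
     case: a => [[|[|[|?]]] ?] // _ _ _; first [by left; apply: val_inj|by right; left; apply: val_inj
     |by right; right; apply: val_inj].
case=> [->|[->|->]].
- by rewrite V1 Vk0 mulr0.
- by rewrite V2 Vk0 mulr0.
- by rewrite /line_fun -qE WE wedgeE mulrC subrr.
Qed.

Lemma torus_act_line t x y : torus_act t (x *: E_ i + y *: E_ j) =
  (x * t 0 i) *: E_ i + (y * t 0 j) *: E_ j.
Proof.
apply/rowP => a; rewrite mxE !line_point //.
by have [->|_] := eqVneq a i => //; have [->|_] := eqVneq a j => //; rewrite mul0r.
Qed.

(** Here m is the degree of V_k in q_i; any monomial occurring in V_k would do. *)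
Lemma line_weight :
  (exists q : 'rV[C]_3, [/\ q != 0, q 0 k = 0 & exists a, B q a k != 0]) ->
  exists2 m, (m <= e.+1)%N & forall t c, semi_invariant B t c ->
    t 0 i * t 0 j * t 0 k = c * (t 0 i ^+ m.+1 * t 0 j ^+ (e.+2 - m)).
Proof.
move=> nz; have [p sp pE] := line_poly.
have p0 := line_poly_neq0 pE nz.
have sp0 : (0 < size p)%N by rewrite size_poly_gt0.
have mle : ((size p).-1 <= e.+1)%N by lia.
exists (size p).-1 => // t c [t0 c0 tE].
have pm : p`_(size p).-1 != 0 by rewrite -lead_coefE lead_coef_eq0.
have E x : t 0 j * t 0 k * p.[x] = (c * t 0 j ^+ e.+2) * p.[(t 0 i / t 0 j) * x].
  rewrite -!pE /line_fun tE; last by rewrite line_point_neq0 // oner_neq0 orbT.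
  rewrite torus_act_line -mulrA; congr (_ * _).
  rewrite -/(line_fun _ _ j k) -/(line_fun _ _ j k) -line_funZ ?oner_neq0 ?orbT //.
  by rewrite mulr1 mul1r mulrA [t 0 j * _]mulrC divfK // mulrC.
have := scaled_poly_coef E pm; set m := (size p).-1 => h.
rewrite -mulrA h.
have -> : e.+2 = (m + (e.+2 - m))%N by lia.
rewrite exprD addKn expr_div_n [t 0 i ^+ m.+1]exprS.
by field; rewrite expf_neq0.
Qed.
End OneLine.
End BivectorFields.

(** * Exponents at a coordinate vertex *)

Lemma derive_line (K : numFieldType) (V W : normedModType K) (f : V -> W) (x v : V) :
  'D_v f x = 'D_(1 : K) (fun h : K => f (x + h *: v)) 0.
Proof.
rewrite /derive.
have -> : (fun h : K => h^-1 *: ((f \o shift x) (h *: v) - f x)) =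
  (fun h : K => h^-1 *: (((fun h : K => f (x + h *: v)) \o shift 0) (h *: 1) - f (x + 0 *: v))); last by [].
apply/funext => h /=; rewrite scale0r !addr0.
by rewrite [h *: 1]mulr1 [x + _]addrC.
Qed.

(** At a zero of g, only one term of the Leibniz rule survives. *)
Lemma derive_mul0 (K : numFieldType) (V : normedModType K) (f g : V -> K) (x v : V) :
  derivable f x v -> derivable g x v -> g x = 0 ->
  'D_v (fun y => f y * g y) x = f x * 'D_v g x.
Proof.
by move=> df dg g0; rewrite (deriveM df dg) g0 scale0r addr0.
Qed.

Lemma derivable_horner_poly (K : numFieldType) (p : {poly K}) (x : K) : derivable (horner p) x 1.
Proof.
elim/poly_ind: p => [|p r ih].
  by rewrite (_ : horner 0 = cst 0) ?derivable_cst //; apply/funext => y; rewrite horner0.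
rewrite (_ : horner _ = (fun y => p.[y] * y) + cst r); last by apply/funext => y; rewrite hornerMXaddC.
by apply: derivableD; [apply: derivableM|exact: derivable_cst].
Qed.

Lemma derive_horner0 (K : numFieldType) (p : {poly K}) : p`_0 = 0 ->
  'D_(1 : K) (horner p) (0 : K) = p`_1.
Proof.
move=> p0; have /factor_theorem[q pq] : root p 0 by apply/rootP; rewrite horner_coef0.
rewrite polyC0 subr0 in pq.
rewrite (_ : horner p = fun y => q.[y] * y); last by apply/funext => y; rewrite pq hornerMX.
rewrite (@derive_mul0 K K (horner q) id 0 1) //; last exact: derivable_horner_poly.
by rewrite derive_id mulr1 horner_coef0 pq coefMX.
Qed.

Section Vertex.
Variable R : realType.
Local Notation C := R[i].
Local Notation E_ i := (delta_mx 0 i : 'rV[C]_3).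
Variables (e : nat) (B : 'rV[C]_3 -> 'M[C]_3).
Hypothesis Bf : bivector_field e B.

Lemma delta_neq0 i : E_ i != 0.
Proof. by apply/eqP => /rowP/(_ i)/eqP; rewrite !mxE !eqxx oner_eq0. Qed.

Lemma near_neq0 : \forall q \near E_ 0, (q : 'rV[C]_3) != 0.
Proof.
have h : E_ 0 0 0 != 0 by rewrite mxE !eqxx oner_eq0.
by apply: filterS (near_entry h) => q /neq0_entry.
Qed.

Lemma bf_skew (q : 'rV[C]_3) a b : q != 0 -> B q b a = - B q a b.
Proof. by move=> /(bf_wedge Bf)[V ->]; rewrite !wedgeE; ring. Qed.

Lemma bf_plucker (q : 'rV[C]_3) : q != 0 -> q 0 0 * B q 1 2%:R = q 0 1 * B q 0 2%:R - q 0 2%:R * B q 0 1.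
Proof. by move=> /(bf_wedge Bf)[V ->]; rewrite !wedgeE; ring. Qed.

Lemma vertex_poly a b : b != 0 -> exists p : {poly C}, forall y,
  B (E_ 0 + y *: E_ b) 0 a = p.[y].
Proof.
move=> b0; have ob : 0 != b by rewrite eq_sym.
have inv z : z != 0 -> line_fun B 0 b 1 z 0 a = z ^+ e.+2 * line_fun B 0 b z^-1 1 0 a.
  by move=> z0; rewrite -(line_funZ Bf ob) ?oner_neq0 ?orbT // mulfV // mulr1.
have [p _ pE] := entire_poly (diff_line_y Bf ob 0 a) (diff_line_x Bf ob 0 a) inv.
by exists p => y; rewrite -pE /line_fun scale1r.
Qed.

(** The alternatives correspond to a nonzero value of B_0a at the vertex and to
    a nonzero first derivative of B_0a along the edge towards the vertex b.  If
    all of these vanish, then B has a double zero: homogeneity takes care of the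
    radial direction and the Pluecker relation of the entry (1, 2). *)
Lemma vertex_weight :
  ~ (B (E_ 0) = 0 /\ forall a b v, 'd (fun q => B q a b : C) (E_ 0) v = 0) ->
  exists a b, [/\ a != 0, b != 0 &
   (forall t c, semi_invariant B t c -> t 0 a = c * t 0 0 ^+ e.+1) \/
   (forall t c, semi_invariant B t c -> t 0 a = c * t 0 0 ^+ e * t 0 b)].
Proof.
move=> NR; apply: contrapT => nex; apply: NR.
have key a b : a != 0 -> b != 0 -> exists p : {poly C},
    [/\ forall y, B (E_ 0 + y *: E_ b) 0 a = p.[y], p`_0 = 0 & p`_1 = 0].
  move=> a0 b0; have [p pE] := vertex_poly a b0; exists p.
  have main m t c : semi_invariant B t c -> p`_m != 0 -> t 0 0 * t 0 a = c * t 0 0 ^+ e.+2 * (t 0 b / t 0 0) ^+ m.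
    move=> [t0 c0 tE]; apply: scaled_poly_coef => x.
    have ob : 0 != b by rewrite eq_sym.
    have q0 : E_ 0 + x *: E_ b != 0.
      by rewrite -[E_ 0]scale1r line_point_neq0 // oner_neq0.
    rewrite -!pE tE // -mulrA; congr (_ * _).
    have -> : torus_act t (E_ 0 + x *: E_ b) = t 0 0 *: (E_ 0 + (t 0 b / t 0 0 * x) *: E_ b).
      rewrite -[E_ 0]scale1r torus_act_line // scalerDr !scalerA mul1r mulr1.
      by rewrite mulrA [t 0 0 * _]mulrC divfK // mulrC.
    have q1 : E_ 0 + (t 0 b / t 0 0 * x) *: E_ b != 0.
      by rewrite -[E_ 0]scale1r line_point_neq0 // oner_neq0.
    by rewrite (bf_homog Bf (t0 0) q1) [LHS]mxE.
  split => //.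
  - apply/eqP; apply: contrapT => /negP p0; apply: nex; exists a, b; split => //; left => t c tc.
    have t0 := si_neq0 tc 0; apply: (mulfI t0); rewrite (main _ _ _ tc p0) expr0 mulr1.
    by rewrite [in RHS]mulrCA -exprS.
  - apply/eqP; apply: contrapT => /negP p1; apply: nex; exists a, b; split => //; right => t c tc.
    have t0 := si_neq0 tc 0; apply: (mulfI t0); rewrite (main _ _ _ tc p1) expr1.
    by rewrite !exprS; field.
have n1 : (1 : 'I_3) != 0 by [].
have n2 : (2%:R : 'I_3) != 0 by [].
have v0 : forall a, a != 0 -> B (E_ 0) 0 a = 0.
  move=> a a0; have [p [pE p0 _]] := key a 1 a0 n1.
  by have := pE 0; rewrite scale0r addr0 horner_coef0 p0.
have B00 : B (E_ 0) = 0.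
  have b12 : B (E_ 0) 1 2%:R = 0.
    have := bf_plucker (delta_neq0 0); rewrite !v0 // !mulr0 subr0 mxE /= mul1r //.
  have sk a b := bf_skew a b (delta_neq0 0).
  apply/matrixP => a b; rewrite [RHS]mxE.
  have diag a' : B (E_ 0) a' a' = 0.
    have [V ->] := bf_wedge Bf (delta_neq0 0); rewrite wedgeE; ring.
  have [i0|i0] := eqVneq a 0.
    rewrite i0; have [->|/v0//] := eqVneq b 0; exact: diag.
  have [j0|j0] := eqVneq b 0; first by rewrite j0 sk v0 // oppr0.
  have [->|ab] := eqVneq a b; first exact: diag.
  have [[-> ->]|[-> ->]] : (a = 1 /\ b = 2%:R) \/ (a = 2%:R /\ b = 1).
    move: i0 j0 ab; case: a => [[|[|[|?]]] ?] //; case: b => [[|[|[|?]]] ?] // _ _ _;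
    by [left; split; apply: val_inj|right; split; apply: val_inj].
  - exact: b12.
  - by rewrite sk b12 oppr0.
split=> // a b v.
have df a' b' : differentiable (fun q => B q a' b' : C) (E_ 0) by exact: (bf_diff Bf _ _ (delta_neq0 0)).
have dv a' b' w : derivable (fun q => B q a' b' : C) (E_ 0) w by exact: diff_derivable.
have dc a' w : derivable (fun q : 'rV[C]_3 => q 0 a' : C) (E_ 0) w.
  by apply: diff_derivable; exact: differentiable_coord.
have D0 c a' : a' != 0 -> 'D_(E_ c) (fun q => B q 0 a' : C) (E_ 0) = 0.
  move=> a0; rewrite derive_line; have [->|c0] := eqVneq c 0.
    have z0 : \forall h \near (0 : C), 0 = B (E_ 0 + h *: E_ 0) 0 a'.
      have near1 : \forall h \near (0 : C), 1 + h != 0.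
        have cont : {for (0 : C), continuous (fun h : C => 1 + h)}.
          by apply: differentiable_continuous; apply: differentiableD; [exact: differentiable_cst|].
        have n0 : (fun h : C => 1 + h) 0 != 0 by rewrite addr0 oner_neq0.
        exact: cvgr_neq0 cont n0.
      apply: filterS near1 => h h1.
      by rewrite -{1}[E_ 0]scale1r -scalerDl (bf_homog Bf) ?delta_neq0 // B00 scaler0 mxE.
    have := @near_eq_derive _ _ _ _ _ _ (1 : C) z0.
    by rewrite derive_cst.
  have [p [pE p0 p1]] := key a' c a0 c0.
  rewrite (_ : (fun h => _) = horner p); last by apply/funext => h; exact: pE.
  by rewrite derive_horner0.
have E0v a' : a' != 0 -> 'D_v (fun q => B q 0 a' : C) (E_ 0) = 0.
  move=> a0; rewrite (deriveE v (df 0 a')) [v in LHS]row_sum_delta linear_sum big1 // => c _.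
  by rewrite linearZ /= -(deriveE _ (df 0 a')) D0 // scaler0.
have E12 : 'D_v (fun q => B q 1 2%:R : C) (E_ 0) = 0.
  have nE : \forall q \near E_ 0, (q : 'rV[C]_3) != 0.
    exact: near_neq0.
  have nf : \forall q \near E_ 0, (fun q : 'rV[C]_3 => q 0 0 * B q 1 2%:R) q =
     (fun q : 'rV[C]_3 => q 0 1 * B q 0 2%:R - q 0 2%:R * B q 0 1) q.
    by apply: filterS nE => q /bf_plucker.
  have := @near_eq_derive _ _ _ _ _ _ v nf.
  have b12 : B (E_ 0) 1 2%:R = 0 by rewrite B00 mxE.
  have b02 : B (E_ 0) 0 2%:R = 0 by rewrite B00 mxE.
  have b01 : B (E_ 0) 0 1 = 0 by rewrite B00 mxE.
  rewrite (derive_mul0 (dc 0 v) (dv 1 2%:R v) b12).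
  rewrite (deriveB (derivableM (dc 1 v) (dv 0 2%:R v)) (derivableM (dc 2%:R v) (dv 0 1 v))).
  rewrite (derive_mul0 (dc 1 v) (dv 0 2%:R v) b02) (derive_mul0 (dc 2%:R v) (dv 0 1 v) b01).
  by rewrite !E0v // !mulr0 subr0 mxE mul1r.
rewrite -(deriveE v (df a b)).
have skD a' b' : 'D_v (fun q => B q b' a' : C) (E_ 0) = - 'D_v (fun q => B q a' b' : C) (E_ 0).
  have nE : \forall q \near E_ 0, (q : 'rV[C]_3) != 0.
    exact: near_neq0.
  have nf : \forall q \near E_ 0, (fun q => B q b' a' : C) q = (- (fun q => B q a' b' : C)) q.
    by apply: filterS nE => q q0; rewrite bf_skew.
  by rewrite (@near_eq_derive _ _ _ _ _ _ v nf) deriveN.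
have diagD a' : 'D_v (fun q => B q a' a' : C) (E_ 0) = 0.
  have /eqP := skD a' a'; rewrite -addr_eq0 -mulr2n -mulr_natr mulf_eq0 pnatr_eq0 orbF.
  by move/eqP.
have [i0|i0] := eqVneq a 0.
  rewrite i0; have [->|/E0v//] := eqVneq b 0; exact: diagD.
have [j0|j0] := eqVneq b 0; first by rewrite j0 skD E0v // oppr0.
have [->|ab] := eqVneq a b; first exact: diagD.
have [[-> ->]|[-> ->]] : (a = 1 /\ b = 2%:R) \/ (a = 2%:R /\ b = 1).
  move: i0 j0 ab; case: a => [[|[|[|?]]] ?] //; case: b => [[|[|[|?]]] ?] // _ _ _;
  by [left; split; apply: val_inj|right; split; apply: val_inj].
- exact: E12.
- by rewrite skD E12 oppr0.
Qed.
End Vertex.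

(** * Counting solutions of monomial equations *)

Section Counting.
Variable K : closedFieldType.

Lemma root_list (n : nat) (a : K) : (0 < n)%N ->
  exists2 l : seq K, (size l <= n)%N & forall x, x ^+ n = a -> x \in l.
Proof.
move=> n0; pose p : {poly K} := 'X^n - a%:P.
have sp : size p = n.+1 by rewrite size_XnsubC.
have [r pr] := closed_field_poly_normal p.
have p0 : p != 0 by rewrite -size_poly_eq0 sp.
exists r => [|x xn].
  have := congr1 (fun q : {poly K} => size q) pr; rewrite /= sp size_scale ?lead_coef_eq0 //.
  by rewrite size_prod_XsubC => -[->].
have : root p x by rewrite /root !hornerE xn subrr.
by rewrite pr rootZ ?lead_coef_eq0 // root_prod_XsubC.
Qed.

Lemma size_flatten_le (T : Type) (S : eqType) (f : T -> seq S) (r : seq T) n :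
  (forall x, size (f x) <= n)%N -> (size (flatten [seq f x | x <- r]) <= size r * n)%N.
Proof.
move=> fn; elim: r => //= x r IH; rewrite size_cat mulSn.
by apply: leq_add.
Qed.

(** A triangular system: n choices for r, then m choices for s. *)
Lemma torus_solutions (n m : nat) (b : K -> K) : (0 < n)%N -> (0 < m)%N ->
  exists2 l : seq (K * K), (size l <= n * m)%N & forall s r, r ^+ n = 1 -> s ^+ m = b r -> (s, r) \in l.
Proof.
move=> n0 m0; have [l1 s1 h1] := root_list 1 n0.
have H x : exists l : seq K, (size l <= m)%N /\ forall s, s ^+ m = b x -> s \in l.
  by have [l sl hl] := root_list (b x) m0; exists l.
have [f fP] := boolp.choice H.
exists (flatten [seq [seq (s, r) | s <- f r] | r <- l1]).
  apply: leq_trans (size_flatten_le _ (n := m) _) _.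
    by move=> x; rewrite size_map; have [] := fP x.
  by rewrite leq_mul2r s1 orbT.
move=> s r rn sm; apply/flatten_mapP; exists r; first exact: h1.
by apply: map_f; have [_] := fP r; apply.
Qed.

(** Bezout coefficients for the exponents of s put the system in triangular
    form: r^(D / g) = 1 and s^g is a function of r, where g is their gcd. *)
Lemma lattice_solutions (al be ga de : int) (D : nat) : (0 < D)%N ->
  D%:Z = al * de - be * ga ->
  exists2 l : seq (K * K), (size l <= D)%N & forall s r : K, s != 0 -> r != 0 ->
     s ^ al * r ^ be = 1 -> s ^ ga * r ^ de = 1 -> (s, r) \in l.
Proof.
move=> D0 DE; have [u [v uv]] := Bezoutz al ga.
set g := gcdz al ga in uv.
have /dvdzP[al' alE] : (g %| al)%Z by exact: dvdz_gcdl.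
have /dvdzP[ga' gaE] : (g %| ga)%Z by exact: dvdz_gcdr.
have g0 : 0 <= g by [].
pose N := al' * de - be * ga'.
have NE : D%:Z = N * g by rewrite DE /N alE gaE; ring.
have gpos : 0 < g by rewrite lt_def g0 andbT; apply: contraTneq D0 => gE; rewrite -ltz_nat NE gE mulr0.
have Npos : 0 < N by rewrite -(pmulr_lgt0 _ gpos) -NE.
have [n nE] : exists n : nat, N = n%:Z by case: (N) Npos => // n _; exists n.
have [m mE] : exists m : nat, g = m%:Z by exists `|g|%N; rewrite gez0_abs.
have n0 : (0 < n)%N by rewrite -ltz_nat -nE.
have m0 : (0 < m)%N by rewrite -ltz_nat -mE.
have [l sl hl] := torus_solutions (fun r => r ^ (- (u * be + v * de))) n0 m0.
exists l; first by apply: leq_trans sl _; rewrite -lez_nat PoszM -nE -mE NE.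
move=> s r s0 r0 E1 E2; apply: hl.
  rewrite exprnP -nE /N.
  have : (s ^ ga * r ^ de) ^ al' * (s ^ al * r ^ be) ^ (- ga') = 1 by rewrite E1 E2 !exp1rz mulr1.
  rewrite !expfzMl !exprz_exp mulrACA -!expfzDr // alE gaE.
  have -> : ga' * g * al' + al' * g * - ga' = 0 by ring.
  rewrite expr0z mul1r; congr (_ ^ _ = _); ring.
rewrite exprnP -mE -uv.
have : (s ^ al * r ^ be) ^ u * (s ^ ga * r ^ de) ^ v = 1 by rewrite E1 E2 !exp1rz mulr1.
rewrite !expfzMl !exprz_exp mulrACA -!expfzDr // => E.
have -> : u * al + v * ga = al * u + ga * v by ring.
apply: (mulIf (expfz_neq0 (be * u + de * v) r0)); rewrite E -expfzDr //.
by rewrite (_ : _ + _ = 0) ?expr0z //; ring.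
Qed.
End Counting.

(** The index of the lattice generated by the differences of three monomials of
    degree d + 2, one in the interior of each side of the triangle of exponents.
    It is an affine function of each of x, y, z, and is largest at
    x = y = z = 0, the exponents of the Jouanolou foliation. *)
Lemma three_sides_bound (d x y z : nat) : (x <= d)%N -> (y <= d)%N -> (z <= d)%N ->
  exists D : nat, [/\ (0 < D)%N, (D <= d ^ 2 + d + 1)%N &
   D%:Z = (d.+1%:Z - z%:Z) * (d%:Z - x%:Z - y%:Z) + y.+1%:Z * x.+1%:Z].
Proof.
move=> xd yd zd.
pose D := (d.+1%:Z - z%:Z) * (d%:Z - x%:Z - y%:Z) + y.+1%:Z * x.+1%:Z.
have xd' : 0 <= d%:Z - x%:Z by rewrite subr_ge0 lez_nat.
have yd' : 0 <= d%:Z - y%:Z by rewrite subr_ge0 lez_nat.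
have zd' : 0 <= d%:Z - z%:Z by rewrite subr_ge0 lez_nat.
have S (a : nat) : a.+1%:Z = a%:Z + 1 by rewrite -addn1 PoszD.
have D1 : 0 < D.
  have [h|h] := lerP 0 (d%:Z - x%:Z - y%:Z).
    (* Two ways of writing D as a sum of nonnegative products, according to the
       sign of d - x - y. *)
    have -> : D = (x%:Z * y%:Z + (d%:Z - z%:Z) * (d%:Z - x%:Z - y%:Z)) + (d%:Z + 1).
      by rewrite /D !S; ring.
    by apply: ltr_wpDl; [rewrite addr_ge0 ?mulr_ge0|rewrite ltr_wpDl].
  have -> : D = ((d%:Z - x%:Z) * (d%:Z - y%:Z) + z%:Z * - (d%:Z - x%:Z - y%:Z)) + (d%:Z + 1).
    by rewrite /D !S; ring.
  by apply: ltr_wpDl; [rewrite addr_ge0 ?mulr_ge0 ?oppr_ge0 // ltW|rewrite ltr_wpDl].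
have D2 : D <= (d ^ 2 + d + 1)%:Z.
  rewrite -subr_ge0.
  have -> : (d ^ 2 + d + 1)%:Z - D = x%:Z * (d%:Z - y%:Z) + y%:Z * (d%:Z - z%:Z) + z%:Z * (d%:Z - x%:Z).
    by rewrite /D !S !PoszD -mulnn PoszM; ring.
  by rewrite !addr_ge0 ?mulr_ge0.
exists `|D|%N; have DE : `|D|%N%:Z = D by rewrite gez0_abs // ltW.
split=> //; first by rewrite -ltz_nat DE.
by rewrite -lez_nat DE.
Qed.

(** Two homogeneous equations between the t_i become equations in the ratios
    t_0 / t_2 and t_1 / t_2. *)
Lemma three_sides_solutions (K : closedFieldType) (d x y z : nat) :
  (x <= d)%N -> (y <= d)%N -> (z <= d)%N ->
  exists2 l : seq (K * K), (size l <= d ^ 2 + d + 1)%N & forall t0 t1 t2 : K,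
    t0 != 0 -> t1 != 0 -> t2 != 0 ->
    t0 ^+ x.+1 * t1 ^+ (d.+1 - x) = t1 ^+ y.+1 * t2 ^+ (d.+1 - y) ->
    t1 ^+ y.+1 * t2 ^+ (d.+1 - y) = t2 ^+ z.+1 * t0 ^+ (d.+1 - z) ->
    (t0 / t2, t1 / t2) \in l.
Proof.
move=> xd yd zd; have [D [D0 Dle DE]] := three_sides_bound xd yd zd.
have DE' : D%:Z = (d.+1%:Z - z%:Z) * (d%:Z - x%:Z - y%:Z) - (- y.+1%:Z) * x.+1%:Z.
  by rewrite DE mulNr opprK.
have [l sl hl] := lattice_solutions K D0 DE'.
exists l => [|t0 t1 t2 n0 n1 n2 E1 E2]; first exact: leq_trans sl Dle.
have s0 : t0 / t2 != 0 by rewrite mulf_neq0 ?invr_neq0.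
have r0 : t1 / t2 != 0 by rewrite mulf_neq0 ?invr_neq0.
have hom (u v : K) (i : nat) : (i <= d.+1)%N ->
    (u / t2) ^+ i.+1 * (v / t2) ^+ (d.+1 - i) = u ^+ i.+1 * v ^+ (d.+1 - i) / t2 ^+ d.+2.
  move=> hi; have -> : d.+2 = (i.+1 + (d.+1 - i))%N by lia.
  by rewrite exprD !expr_div_n; field; rewrite !expf_neq0.
have tt : t2 / t2 = 1 by rewrite divff.
have F1 : (t0 / t2) ^+ x.+1 * (t1 / t2) ^+ (d.+1 - x) = (t1 / t2) ^+ y.+1.
  by rewrite hom ?leqW // E1 -hom ?leqW // tt expr1n mulr1.
have F2 : (t1 / t2) ^+ y.+1 = (t0 / t2) ^+ (d.+1 - z).
  have := E2; move/(congr1 (fun w => w / t2 ^+ d.+2)); rewrite -!hom ?leqW //.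
  by rewrite tt !expr1n mulr1 mul1r.
apply: hl => //.
  rewrite (_ : d.+1%:Z - z%:Z = (d.+1 - z)%N%:Z); last by rewrite subzn // leqW.
  by rewrite -exprnP -F2 exprnP -expfzDr // subrr expr0z.
have -> : d%:Z - x%:Z - y%:Z = (d.+1 - x)%N%:Z - y.+1%:Z.
  by rewrite -subzn ?leqW //; lia.
rewrite expfzDr // mulrA -!exprnP F1 -invr_expz -exprnP mulfV //.
by rewrite expf_neq0.
Qed.

Lemma small_pairs (K : closedFieldType) (k : nat) : (0 < k)%N ->
  exists2 l : seq (K * K), (size l <= k * k)%N & forall s r, s ^+ k = 1 -> r ^+ k = 1 -> (s, r) \in l.
Proof.
move=> k0; have [l sl hl] := torus_solutions (fun _ : K => 1) k0 k0.
by exists l => // s r hs hr; exact: hl.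
Qed.

(** * Monomial symmetries *)

Section MonomialGroup.
Variable R : realType.
Local Notation C := R[i].
Local Notation E_ i := (delta_mx 0 i : 'rV[C]_3).
Variables (e : nat) (B : 'rV[C]_3 -> 'M[C]_3).
Hypothesis Bf : bivector_field e B.

Definition monomial (tau : {perm 'I_3}) (M : 'M[C]_3) := forall i k, k != i -> M k (tau i) = 0.

Definition monomial_symmetry (M : 'M[C]_3) (tau : {perm 'I_3}) :=
  [/\ M \in unitmx, monomial tau M & exists2 c : C, c != 0 &
     forall q, q != 0 -> M^T *m B q *m M = c *: B (q *m M)].

Lemma monomial_neq0 M tau i : M \in unitmx -> monomial tau M -> M i (tau i) != 0.
Proof.
move=> Mu mM; apply: contraTneq Mu => M0; apply/negP => Mu.
have : M *m delta_mx (tau i) (0 : 'I_1) = 0.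
  apply/colP => k; rewrite -colE !mxE.
  by have [->|/mM//] := eqVneq k i.
move/(congr1 (mulmx (invmx M))); rewrite mulKmx // mulmx0 => /colP/(_ (tau i)).
by rewrite !mxE !eqxx => /eqP; rewrite oner_eq0.
Qed.

Lemma torus_act_diag (t q : 'rV[C]_3) : torus_act t q = q *m diag_mx t.
Proof. by apply/rowP => i; rewrite mul_mx_diag !mxE. Qed.

Lemma semi_invariantP (t : 'rV[C]_3) (c : C) : (forall i, t 0 i != 0) -> c != 0 ->
  (forall q, q != 0 -> diag_mx t *m B q *m diag_mx t = c *: B (q *m diag_mx t)) ->
  semi_invariant B t c.
Proof.
move=> t0 c0 H; split => // q a b /H/matrixP/(_ a b).
rewrite torus_act_diag [X in _ = X]mxE => <-.
by rewrite mul_mx_diag mxE mul_diag_mx mxE; ring.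
Qed.

Lemma semi_invariant_mx (t : 'rV[C]_3) (c : C) : semi_invariant B t c ->
  forall q, q != 0 -> diag_mx t *m B q *m diag_mx t = c *: B (q *m diag_mx t).
Proof.
move=> [t0 c0 H] q q0; apply/matrixP => a b.
rewrite [RHS]mxE -torus_act_diag -H //.
by rewrite mul_mx_diag mxE mul_diag_mx mxE; ring.
Qed.

Lemma unit_cancel (M X Y : 'M[C]_3) : M \in unitmx -> M^T *m X *m M = M^T *m Y *m M -> X = Y.
Proof.
move=> Mu /(congr1 (mulmxr (invmx M))) /=; rewrite !mulmxK //.
by move/(congr1 (mulmx (invmx M^T))); rewrite !mulKmx ?unitmx_tr.
Qed.

Lemma diag_unit (t : 'rV[C]_3) : (forall i, t 0 i != 0) -> diag_mx t \in unitmx.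
Proof.
move=> t0; rewrite unitmxE det_diag unitfE.
by apply/prodf_neq0 => i _.
Qed.

(** The diagonal matrix carrying M2 to M1 when both induce the same permutation. *)
Definition monomial_ratio (M1 M2 : 'M[C]_3) (tau : {perm 'I_3}) : 'rV[C]_3 :=
  \row_i (M1 i (tau i) / M2 i (tau i)).

Lemma monomial_ratioE M1 M2 tau : M2 \in unitmx -> monomial tau M1 -> monomial tau M2 ->
  M1 = diag_mx (monomial_ratio M1 M2 tau) *m M2.
Proof.
move=> M2u m1 m2; apply/matrixP => k j; rewrite mul_diag_mx !mxE.
rewrite -[j](permKV tau); set i := (tau^-1)%g j.
have [->|ki] := eqVneq k i; first by rewrite divfK // monomial_neq0.
by rewrite (m1 _ _ ki) (m2 _ _ ki) mulr0.
Qed.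

Lemma monomial_ratio_semi M1 M2 tau : monomial_symmetry M1 tau -> monomial_symmetry M2 tau ->
  exists c, semi_invariant B (monomial_ratio M1 M2 tau) c.
Proof.
move=> [u1 m1 [c1 c10 E1]] [u2 m2 [c2 c20 E2]].
have ME := monomial_ratioE u2 m1 m2; set t := monomial_ratio _ _ _ in ME *.
have t0 i : t 0 i != 0 by rewrite mxE mulf_neq0 ?invr_neq0 ?monomial_neq0.
exists (c1 / c2); apply: semi_invariantP => // [|q q0]; first by rewrite mulf_neq0 ?invr_neq0.
apply: (unit_cancel u2).
have qt0 : q *m diag_mx t != 0 by exact: mulmx_neq0 (diag_unit t0) q0.
rewrite -scalemxAr -scalemxAl E2 // scalerA divfK //.
have -> : q *m diag_mx t *m M2 = q *m M1 by rewrite -mulmxA -ME.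
by rewrite -E1 // [in RHS]ME trmx_mul tr_diag_mx !mulmxA.
Qed.

(** Conjugation by a monomial matrix permutes the entries of a diagonal matrix
    and does not change the factor. *)
Lemma semi_invariant_perm M tau t c : monomial_symmetry M tau -> semi_invariant B t c ->
  semi_invariant B (\row_i t 0 (tau i)) c.
Proof.
move=> [Mu mM [cM cM0 E]] tc; have [t0 c0 _] := tc; have S := semi_invariant_mx tc.
set t' := \row_i _.
have t'0 i : t' 0 i != 0 by rewrite mxE.
have ME : diag_mx t' *m M = M *m diag_mx t.
  apply/matrixP => k j; rewrite mul_diag_mx mul_mx_diag !mxE.
  rewrite -[j](permKV tau); set i := (tau^-1)%g j.
  have [->|ki] := eqVneq k i; first by rewrite mulrC.
  by rewrite (mM _ _ ki) mulr0 mul0r.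
apply: semi_invariantP => // q q0; apply: (unit_cancel Mu).
have qt0 : q *m diag_mx t' != 0 by exact: mulmx_neq0 (diag_unit t'0) q0.
have MTE : M^T *m diag_mx t' = diag_mx t *m M^T.
  by apply: trmx_inj; rewrite !trmx_mul !tr_diag_mx trmxK ME.
have -> : M^T *m (diag_mx t' *m B q *m diag_mx t') *m M = M^T *m diag_mx t' *m B q *m (diag_mx t' *m M).
  by rewrite !mulmxA.
rewrite -scalemxAr -scalemxAl E // -[q *m _ *m M]mulmxA ME MTE.
have -> : diag_mx t *m M^T *m B q *m (M *m diag_mx t) = diag_mx t *m (M^T *m B q *m M) *m diag_mx t.
  by rewrite !mulmxA.
rewrite E // -scalemxAr -scalemxAl S ?mulmx_neq0 // !scalerA mulmxA.
by rewrite mulrC.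
Qed.

Definition symmetry_perms : {set {perm 'I_3}} := [set tau | `[< exists M, monomial_symmetry M tau >]]%SET.

Lemma in_symmetry_perms tau :
  tau \in symmetry_perms <-> exists M, monomial_symmetry M tau.
Proof. by rewrite /symmetry_perms !finset.inE; split => /asboolP. Qed.

Lemma symmetry_perms_group : group_set symmetry_perms.
Proof.
apply/group_setP; split.
  apply/in_symmetry_perms; exists 1%:M; split; first exact: unitmx1.
    by move=> i k ki; rewrite perm1 mxE (negPf ki).
  by exists 1; [exact: oner_neq0|move=> q _; rewrite trmx1 !mulmx1 mul1mx scale1r].
move=> s t /in_symmetry_perms[M [Mu mM [c c0 E]]] /in_symmetry_perms[N [Nu mN [c' c'0 E']]].
apply/in_symmetry_perms; exists (M *m N); split.
- by rewrite unitmx_mul Mu.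
- move=> i k ki; rewrite permM mxE big1 // => a _.
  have [->|ai] := eqVneq a (s i); first by rewrite mM // mul0r.
  by rewrite mN // mulr0.
- exists (c * c'); first exact: mulf_neq0.
  move=> q q0; have qM0 := mulmx_neq0 Mu q0.
  rewrite trmx_mul; have -> : N^T *m M^T *m B q *m (M *m N) = N^T *m (M^T *m B q *m M) *m N.
    by rewrite !mulmxA.
  by rewrite E // -scalemxAr -scalemxAl E' // scalerA !mulmxA.
Qed.
End MonomialGroup.

(** * The order of a group of monomial symmetries *)

Section Bound.
Variable R : realType.
Local Notation C := R[i].
Local Notation E_ i := (delta_mx 0 i : 'rV[C]_3).
Variables (e : nat) (B : 'rV[C]_3 -> 'M[C]_3).
Hypothesis Bf : bivector_field e B.
Hypothesis noninvariant : forall k, exists q : 'rV[C]_3, [/\ q != 0, q 0 k = 0 & exists a, B q a k != 0].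

Lemma three_weights : exists2 l : seq (C * C), (size l <= e.+1 ^ 2 + e.+1 + 1)%N &
  forall t c, semi_invariant B t c -> (t 0 0 / t 0 2%:R, t 0 1 / t 0 2%:R) \in l.
Proof.
have [x xd hx] := @line_weight _ _ _ Bf 0 1 2%:R isT isT isT (noninvariant _).
have [y yd hy] := @line_weight _ _ _ Bf 1 2%:R 0 isT isT isT (noninvariant _).
have [z zd hz] := @line_weight _ _ _ Bf 2%:R 0 1 isT isT isT (noninvariant _).
have [l sl hl] := three_sides_solutions C xd yd zd.
exists l => // t c tc; have [t0 c0 _] := tc.
apply: hl => //; apply: (mulfI c0).
- by rewrite -(hx _ _ tc) -(hy _ _ tc); ring.
- by rewrite -(hy _ _ tc) -(hz _ _ tc); ring.
Qed.

Hypothesis nonflat : ~ (B (E_ 0) = 0 /\ forall a b v, 'd (fun q => B q a b : C) (E_ 0) v = 0).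
Hypothesis full : symmetry_perms B = [set: {perm 'I_3}]%SET.

Lemma semi_invariant_any_perm (tau : {perm 'I_3}) t c : semi_invariant B t c ->
  semi_invariant B (\row_i t 0 (tau i)) c.
Proof.
have : tau \in symmetry_perms B by rewrite full finset.in_setT.
by move=> /in_symmetry_perms[M] /semi_invariant_perm; apply.
Qed.

Lemma perm_moving_pair (i j : 'I_3) (a b : 'I_3) : i != j -> a != b ->
  exists tau : {perm 'I_3}, tau i = a /\ tau j = b.
Proof.
move=> ij ab; exists (tperm i a * tperm (tperm i a j) b)%g; rewrite !permM tpermL.
split; last by rewrite tpermL.
have h : tperm i a j != a.
  by rewrite -[X in _ != X](tpermL i a) (inj_eq perm_inj) eq_sym.
by apply: tpermD => //; rewrite eq_sym.
Qed.

Lemma ratio_eq1 (u v : C) n : v != 0 -> u ^+ n = v ^+ n -> (u / v) ^+ n = 1.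
Proof. by move=> v0 E; rewrite expr_div_n E divff // expf_neq0. Qed.

(** With all permutations available every relation may be compared with its
    image under a transposition.  A nonzero value at the vertex makes all entries
    equal, an off-diagonal linear part makes their squares equal, and a diagonal
    one makes their e-th powers equal.  In the last case the exponents m + 1 and
    e + 2 - m of a line relation also equalize powers; their sum exceeds e by 3,
    which leaves cube roots of unity. *)
Lemma full_weights : (2 <= e)%N ->
  exists2 l : seq (C * C), (6 * size l <= 3 * (e.+1 ^ 2 + e.+1 + 1))%N &
  forall t c, semi_invariant B t c -> (t 0 0 / t 0 2%:R, t 0 1 / t 0 2%:R) \in l.
Proof.
move=> e2; have [a [b [a0 b0 V]]] := vertex_weight Bf nonflat.
have moved t c (i j i' j' : 'I_3) : semi_invariant B t c -> i != j -> i' != j' ->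
    exists t', [/\ semi_invariant B t' c, t' 0 i = t 0 i' & t' 0 j = t 0 j'].
  move=> tc ij ij'; have [tau [t1 t2]] := perm_moving_pair ij ij'.
  by exists (\row_i t 0 (tau i)); rewrite !mxE t1 t2; split=> //; exact: semi_invariant_any_perm.
have swapped t c (i j : 'I_3) : semi_invariant B t c ->
    exists t', [/\ semi_invariant B t' c, t' 0 i = t 0 j, t' 0 j = t 0 i &
      forall k, k != i -> k != j -> t' 0 k = t 0 k].
  move=> tc; exists (\row_k t 0 (tperm i j k)); rewrite !mxE tpermL tpermR.
  split=> // [|k ki kj]; first exact: semi_invariant_any_perm.
  by rewrite mxE tpermD // eq_sym.
suff [k [k0 kb H]] : exists k, [/\ (0 < k)%N, (6 * (k * k) <= 3 * (e.+1 ^ 2 + e.+1 + 1))%N &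
   forall t c, semi_invariant B t c -> forall i j : 'I_3, i != j -> (t 0 i / t 0 j) ^+ k = 1].
  have [l sl hl] := @small_pairs C k k0; exists l; last by move=> t c tc; apply: hl; exact: H tc _ _ _.
  by apply: leq_trans kb; rewrite leq_mul2l sl.
have base : (39 <= 3 * (e.+1 ^ 2 + e.+1 + 1))%N by nia.
have [a' [a'0 aa']] : exists a' : 'I_3, a' != 0 /\ a' != a.
  have [->|a1] := eqVneq a 1; first by exists 2%:R.
  by exists 1; split => //; rewrite eq_sym.
case: V => V.
  exists 1%N; split=> // [|t c tc i j ij]; first by apply: leq_trans base.
  have [t' [tc' <- <-]] := moved t c a' a i j tc aa' ij.
  have [t'' [tc'' e1 e2' e3]] := swapped t' c a' a tc'.
  have E1 := V _ _ tc'; have E2 := V _ _ tc''.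
  rewrite e2' e3 in E2; [|by rewrite eq_sym ..].
  by rewrite expr1 E1 E2 divff // -E1 (si_neq0 tc').
have [ab|ab] := eqVneq a b.
  have pe t c i : semi_invariant B t c -> c * t 0 i ^+ e = 1.
    move=> tc; have [t' [tc' _ <- _]] := swapped t c i 0 tc.
    have := V _ _ tc'; rewrite -ab -{1}[t' 0 a]mul1r => /(mulIf (si_neq0 tc' a)) <-.
    by [].
  have [m md hm] := @line_weight _ _ _ Bf 0 1 2%:R isT isT isT (noninvariant _).
  have p1 t c : semi_invariant B t c -> forall i j : 'I_3, i != j -> t 0 i ^+ m.+1 = t 0 j ^+ m.+1.
    move=> tc i j ij; have [t' [tc' <- <-]] := moved t c 0 2%:R i j tc isT ij.
    have [t'' [tc'' e1 e2' e3]] := swapped t' c 0 2%:R tc'.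
    have E1 := hm _ _ tc'; have E2 := hm _ _ tc''.
    rewrite e1 e2' e3 // in E2.
    have n1 : t' 0 1 ^+ (e.+2 - m) != 0 by rewrite expf_neq0 // (si_neq0 tc').
    apply: (mulIf n1); apply: (mulfI (si_c0 tc')).
    by rewrite -E1 -E2; ring.
  have p2 t c : semi_invariant B t c -> forall i j : 'I_3, i != j ->
      t 0 i ^+ (e.+2 - m) = t 0 j ^+ (e.+2 - m).
    move=> tc i j ij; have [t' [tc' <- <-]] := moved t c 1 2%:R i j tc isT ij.
    have [t'' [tc'' e1 e2' e3]] := swapped t' c 1 2%:R tc'.
    have E1 := hm _ _ tc'; have E2 := hm _ _ tc''.
    rewrite e1 e2' e3 // in E2.
    have n1 : t' 0 0 ^+ m.+1 != 0 by rewrite expf_neq0 // (si_neq0 tc').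
    apply: (mulfI n1); apply: (mulfI (si_c0 tc')).
    by rewrite -E1 -E2; ring.
  have r3 t c : semi_invariant B t c -> forall i j : 'I_3, i != j ->
      (t 0 i / t 0 j) ^+ e = 1 /\ (t 0 i / t 0 j) ^+ 3 = 1.
    move=> tc i j ij; have tj0 := si_neq0 tc j.
    have re : (t 0 i / t 0 j) ^+ e = 1.
      apply: ratio_eq1 => //; apply: (mulfI (si_c0 tc)).
      by rewrite !(pe _ _ _ tc).
    split=> //; have := ratio_eq1 tj0 (p1 _ _ tc i j ij).
    have := ratio_eq1 tj0 (p2 _ _ tc i j ij) => h2 h1.
    have : (t 0 i / t 0 j) ^+ (m.+1 + (e.+2 - m)) = 1 by rewrite exprD h1 h2 mulr1.
    by rewrite (_ : (m.+1 + (e.+2 - m) = e + 3)%N); [rewrite exprD re mul1r|lia].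
  (* For d = 3 the relations of exponents 2 and 3 leave no freedom; for d >= 4
     the nine pairs of cube roots of unity give 54 <= 3 (d^2 + d + 1). *)
  have [e_2|e_3] : (e = 2 \/ 3 <= e)%N by lia.
    exists 1%N; split=> // [|t c tc i j ij]; first by apply: leq_trans base.
    have [h2 h3] := r3 _ _ tc i j ij.
    by rewrite expr1 -[LHS]mulr1 -[X in _ * X]h2 e_2 -exprS h3.
  exists 3; split=> // [|t c tc i j ij]; first by nia.
  by have [] := r3 _ _ tc i j ij.
exists 2; split=> // [|t c tc i j ij]; first by apply: leq_trans base.
have [t' [tc' <- <-]] := moved t c a b i j tc ab ij.
have [t'' [tc'' e1 e2' e3]] := swapped t' c a b tc'.
have E1 := V _ _ tc'; have E2 := V _ _ tc''.
rewrite e1 e2' e3 1?eq_sym // in E2.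
apply: ratio_eq1; first exact: (si_neq0 tc').
transitivity (c * t' 0 0 ^+ e * t' 0 a * t' 0 b); last by rewrite -E2.
by rewrite expr2 {1}E1; ring.
Qed.

End Bound.

Section Total.
Variable R : realType.
Local Notation C := R[i].
Local Notation E_ i := (delta_mx 0 i : 'rV[C]_3).
Variables (e : nat) (B : 'rV[C]_3 -> 'M[C]_3).
Hypothesis Bf : bivector_field e B.
Hypothesis noninvariant : forall k, exists q : 'rV[C]_3, [/\ q != 0, q 0 k = 0 & exists a, B q a k != 0].
Hypothesis nonflat : ~ (B (E_ 0) = 0 /\ forall a b v, 'd (fun q => B q a b : C) (E_ 0) v = 0).

(** By Lagrange's theorem, an image with more than three elements is everything. *)
Lemma torus_bound : (2 <= e)%N -> exists2 l : seq (C * C),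
  (#|symmetry_perms B| * size l <= 3 * (e.+1 ^ 2 + e.+1 + 1))%N &
  forall t c, semi_invariant B t c -> (t 0 0 / t 0 2%:R, t 0 1 / t 0 2%:R) \in l.
Proof.
move=> e2; pose G := Group (symmetry_perms_group B).
have [h|h] := leqP #|symmetry_perms B| 3.
  have [l sl hl] := three_weights Bf noninvariant; exists l => //.
  exact: leq_mul.
have full : symmetry_perms B = [set: {perm 'I_3}]%SET.
  have cT : #|[set: {perm 'I_3}]%SET| = 6 by rewrite cardsT card_Sn.
  have := cardSg (finset.subsetT G); rewrite cT => dv.
  apply/eqP; rewrite eqEcard finset.subsetT cT /=.
  move: h dv; rewrite /=; move: #|symmetry_perms B| => n h dv.
  have : (n <= 6)%N by exact: dvdn_leq.
  by move: dv h; case: n => [|[|[|[|[|[|[|n]]]]]]].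
have [l sl hl] := full_weights Bf noninvariant nonflat full e2.
exists l => //; rewrite full cardsT card_Sn //.
Qed.

(** S is a list of symmetries up to scalars.  A symmetry is determined by its
    permutation and by the ratios of its entries to those of a fixed symmetry
    with the same permutation. *)
Lemma symmetric_classes_bound (X : eqType) (S : seq X) (f : X -> 'M[C]_3) (tau : X -> {perm 'I_3}) :
  (2 <= e)%N -> uniq S ->
  (forall x, x \in S -> monomial_symmetry B (f x) (tau x)) ->
  (forall x y (a : C), x \in S -> y \in S -> a != 0 -> f x = a *: f y -> x = y) ->
  (size S <= 3 * (e.+1 ^ 2 + e.+1 + 1))%N.
Proof.
move=> e2 uS fS finj; have [l sl hl] := torus_bound e2.
apply: leq_trans sl.
have /boolp.choice[N NP] : forall s : {perm 'I_3}, exists N, s \in symmetry_perms B -> monomial_symmetry B N s.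
  move=> s; case: (boolP (s \in symmetry_perms B)) => [|_]; last by exists 0.
  by move=> /in_symmetry_perms[N NP]; exists N.
pose rat x := monomial_ratio (f x) (N (tau x)) (tau x).
pose phi x := (tau x, (rat x 0 0 / rat x 0 2%:R, rat x 0 1 / rat x 0 2%:R)).
have tauS x : x \in S -> tau x \in symmetry_perms B.
  by move=> xS; apply/in_symmetry_perms; exists (f x); exact: fS.
have ratS x : x \in S -> exists c, semi_invariant B (rat x) c.
  by move=> xS; apply: monomial_ratio_semi; [exact: fS|exact/NP/tauS].
have phi_inj : {in S &, injective phi}.
  move=> x y xS yS [txy r0 r1].
  have [c [rx0 _ _]] := ratS x xS; have [c' [ry0 _ _]] := ratS y yS.
  pose a := rat x 0 2%:R / rat y 0 2%:R.
  have a0 : a != 0 by rewrite mulf_neq0 ?invr_neq0.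
  apply: (finj x y a) => //.
  have [Nu Nm _] := NP _ (tauS x xS).
  have [fxu fxm _] := fS x xS; have [fyu fym _] := fS y yS.
  have -> := monomial_ratioE Nu fxm Nm.
  rewrite -txy in fym.
  have -> := monomial_ratioE Nu fym Nm.
  rewrite scalemxAl; congr (_ *m _).
  have -> : monomial_ratio (f y) (N (tau x)) (tau x) = rat y by rewrite /rat txy.
  rewrite -/(rat x) -linearZ; congr diag_mx; apply/rowP => i; rewrite [RHS]mxE.
  have : i = 0 \/ i = 1 \/ i = 2%:R.
    by case: i => [[|[|[|?]]] ?] //; [left|right; left|right; right]; apply: val_inj.
  rewrite /a; case=> [->|[->|->]].
  - by rewrite -[LHS](divfK (rx0 2%:R)) r0; ring.
  - by rewrite -[LHS](divfK (rx0 2%:R)) r1; ring.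
  - by rewrite divfK.
have um : uniq [seq phi x | x <- S] by rewrite map_inj_in_uniq.
have sub : {subset [seq phi x | x <- S] <= [seq (s, z) | s <- enum (symmetry_perms B), z <- l]}.
  move=> _ /mapP[x xS ->]; apply: allpairs_f; first by rewrite mem_enum tauS.
  by have [c /hl] := ratS x xS.
by have := uniq_leq_size um sub; rewrite size_map size_allpairs -cardE.
Qed.
End Total.

(** * Coordinates adapted to the three lines *)

Lemma congruence_conj (K : fieldType) n (L M X : 'M[K]_n) : L \in unitmx ->
  (invmx L *m M *m L)^T *m (L^T *m X *m L) *m (invmx L *m M *m L) =
  L^T *m (M^T *m X *m M) *m L.
Proof.
move=> Lu; have E : L *m (invmx L *m M *m L) = M *m L by rewrite -mulmxA mulKVmx.
move: (invmx L *m M *m L) E => N E.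
have -> : N^T *m (L^T *m X *m L) *m N = (L *m N)^T *m X *m (L *m N).
  by rewrite trmx_mul !mulmxA.
by rewrite E trmx_mul !mulmxA.
Qed.

Section Coordinates.
Variable R : realType.
Local Notation C := R[i].
Local Notation E_ i := (delta_mx 0 i : 'rV[C]_3).

(** If M maps the i-th coordinate line into the union of the three, then the
    product of the three coordinates of q M vanishes on that line, so one of
    these linear forms vanishes there.  This says that the corresponding column
    of M is supported in the row i. *)
Lemma exists_monomial (M : 'M[C]_3) : M \in unitmx ->
  (forall i (q : 'rV[C]_3), q != 0 -> q 0 i = 0 -> exists j, (q *m M) 0 j = 0) ->
  exists tau, monomial tau M.
Proof.
move=> Mu H.
have /boolp.choice[f fP] : forall i, exists j, forall k, k != i -> M k j = 0.
  move=> i; pose a := lift i (0 : 'I_2); pose b := lift i (1 : 'I_2).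
  have ai : a != i by rewrite eq_sym neq_lift.
  have bi : b != i by rewrite eq_sym neq_lift.
  have ab : a != b by rewrite (inj_eq lift_inj).
  pose P j := (M a j)%:P * 'X + (M b j)%:P.
  have P0 : \prod_j P j = 0.
    apply: poly_eq0_pointwise => x; rewrite horner_prod.
    have q0 : x *: E_ a + 1 *: E_ b != 0 by rewrite line_point_neq0 // oner_neq0 orbT.
    have qi : (x *: E_ a + 1 *: E_ b) 0 i = 0.
      by rewrite line_point // eq_sym (negPf ai) eq_sym (negPf bi).
    have [j qj] := H i _ q0 qi.
    rewrite (bigD1 j) //= (_ : (P j).[x] = 0) ?mul0r // -[RHS]qj.
    by rewrite !hornerE mulmxDl -!scalemxAl -!rowE !mxE mul1r mulrC.
  have /prodf_eq0[j _ /eqP Pj] : \prod_j P j == 0 by apply/eqP.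
  exists j => k ki.
  have Mb : M b j = 0.
    have := congr1 (fun p : {poly C} => p`_0) Pj.
    by rewrite /P coef0 coefD coefMX !coefC /= add0r.
  have Ma : M a j = 0.
    have := congr1 (fun p : {poly C} => p`_1) Pj.
    by rewrite /P coef0 coefD coefMX !coefC /= addr0.
  have : k = a \/ k = b.
    have [k' ->|E] := unliftP i k; last by rewrite E eqxx in ki.
    by case: k' => [[|[|?]] ?] //; [left|right]; congr lift; apply: val_inj.
  by case=> ->.
have finj : injective f.
  move=> i i' E; apply/eqP; apply: contrapT => /negP ii'.
  have : M *m delta_mx (f i) (0 : 'I_1) = 0.
    apply/colP => k; rewrite -colE !mxE.
    have [->|/fP//] := eqVneq k i; by rewrite E fP.
  move/(congr1 (mulmx (invmx M))); rewrite mulKmx // mulmx0 => /colP/(_ (f i)).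
  by rewrite !mxE !eqxx => /eqP; rewrite oner_eq0.
by exists (perm finj) => i k ki; rewrite permE fP.
Qed.

Variables (e : nat) (A : 'rV[C]_3 -> 'M[C]_3) (L : 'M[C]_3).
Hypothesis Af : bivector_field e A.
Hypothesis Lu : L \in unitmx.

Definition change_coords (q : 'rV[C]_3) : 'M[C]_3 := L^T *m A (q *m invmx L) *m L.

Lemma invL_unit : invmx L \in unitmx. Proof. by rewrite unitmx_inv. Qed.

Lemma change_coords_diff q a b : q != 0 -> differentiable (fun q => change_coords q a b : C) q.
Proof.
move=> q0.
rewrite (_ : (fun q => _) = fun q => \sum_(j < 3) (\sum_(i < 3) L^T a i * A (q *m invmx L) i j) * L j b).
  rewrite (_ : (fun q => _) = \sum_(j < 3) (fun q => (\sum_(i < 3) L^T a i * A (q *m invmx L) i j) * L j b)).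
    apply: differentiable_sum => j; apply: differentiableM; last exact: differentiable_cst.
    rewrite (_ : (fun q => _) = \sum_(i < 3) (fun q => L^T a i * A (q *m invmx L) i j)).
      apply: differentiable_sum => i; apply: differentiableM; first exact: differentiable_cst.
      apply: (@differentiable_comp _ _ _ _ (fun q => q *m invmx L) (fun q => A q i j)).
        by apply: differentiable_row => c; exact: differentiable_mulmx_entry.
      by apply: (bf_diff Af); apply: mulmx_neq0 => //; exact: invL_unit.
    by apply/funext => q'; rewrite fct_sumE.
  by apply/funext => q'; rewrite fct_sumE.
by apply/funext => q'; rewrite mxE; apply: eq_bigr => j _; rewrite mxE.
Qed.

Lemma change_coords_field : bivector_field e change_coords.
Proof.
split.
- move=> c q c0 q0; rewrite /change_coords -scalemxAl (bf_homog Af) ?mulmx_neq0 ?invL_unit //.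
  by rewrite -scalemxAr -scalemxAl.
- move=> q q0; have [V VE] := bf_wedge Af (mulmx_neq0 invL_unit q0).
  have qL : q *m invmx L *m L = q by rewrite mulmxKV.
  have W := wedge_mulmx L (q *m invmx L) V; rewrite qL in W.
  by exists (V *m L); rewrite /change_coords VE; exact: W.
- by move=> q a b; exact: change_coords_diff.
Qed.

Lemma change_coordsK p : A p = (invmx L)^T *m change_coords (p *m L) *m invmx L.
Proof.
rewrite /change_coords mulmxK // !mulmxA -trmx_mul mulmxV // trmx1 mul1mx.
by rewrite mulmxK.
Qed.

(** A double zero is a notion independent of linear coordinates. *)
Lemma flat_change_coords p :
  change_coords (p *m L) = 0 ->
  (forall a b v, 'd (fun q => change_coords q a b : C) (p *m L) v = 0) -> p != 0 ->
  A p = 0 /\ forall a b v, 'd (fun q => A q a b : C) p v = 0.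
Proof.
move=> B0 dB p0; split; first by rewrite change_coordsK B0 mulmx0 mul0mx.
move=> a b v.
pose N := invmx L; pose F i j (q : 'rV[C]_3) : C := change_coords (q *m L) i j.
have pL0 := mulmx_neq0 Lu p0.
have dm : differentiable (fun q : 'rV[C]_3 => q *m L) p.
  by apply: differentiable_row => c; exact: differentiable_mulmx_entry.
have dF i j : differentiable (F i j) p.
  have dc := @change_coords_diff (p *m L) i j pL0.
  exact: (differentiable_comp dm dc).
have DF i j : is_derive p v (F i j) 0.
  apply: DeriveDef; first exact: diff_derivable.
  have db := @change_coords_diff (p *m L) i j pL0.
  by rewrite (deriveE v (dF i j)) (diff_comp dm db) /= dB.
have AE : (fun q => A q a b) = \sum_(j < 3) \sum_(i < 3) (N^T a i * N j b) *: F i j.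
  apply/funext => q; rewrite change_coordsK mxE fct_sumE; apply: eq_bigr => j _.
  rewrite mxE mulr_suml fct_sumE; apply: eq_bigr => i _.
  by rewrite /F -[RHS]/(_ * _) mulrAC.
have dA : differentiable (fun q => A q a b : C) p by exact: (bf_diff Af).
rewrite -(deriveE v dA) AE derive_sum => [|j].
  rewrite big1 // => j _; rewrite derive_sum => [|i]; last exact: derivableZ.
  by rewrite big1 // => i _; rewrite deriveZ // derive_val scaler0.
by apply: derivable_sum => i; exact: derivableZ.
Qed.
End Coordinates.

Theorem theorem4p9 (R : realType) (d : nat) (F : foliation R)
    (l : 'I_3 -> 'cV[R[i]]_3) :
  (3 <= d)%N ->
  has_degree F d ->
  finite_set (Aut F) ->
  (forall i, l i != 0) ->
  general_position l ->
  (forall M : 'M[R[i]]_3, Aut F (pgl M) ->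
     act M @` (\bigcup_i line (l i)) = \bigcup_i line (l i)) ->
  (forall i, ~ invariant_line F (l i)) ->
  (forall x, Sing F x -> (\bigcup_i line (l i)) x -> reduced_singularity F x) ->
  (#|` fset_set (Aut F)| <= 3 * (d ^ 2 + d + 1))%N.
Proof.
case: d => // e d3 [h [h_nv h_coc]] finA _ [_ gen] perm_lines noninv red.
have e2 : (2 <= e)%N by [].
have h_eq i j k m x : fol_open i x -> fol_open j x -> chart_dom k x -> chart_dom m x ->
    h i k x * @fol_trans _ F i j x = (rep x 0 m / rep x 0 k) ^+ e * h j m x.
  move=> Ui Uj Dk Dm; have := h_coc i j k m x Ui Uj Dk Dm => /= ->.
  by rewrite (_ : e.+1%:Z - 1 = e%:Z) // -addn1 PoszD addrK.
have [A A_local] := bivector_exists h_eq.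
have Af : bivector_field e A.
  split.
  - by move=> c q c0 q0; exact: (bivectorZ A_local).
  - by move=> q q0; exact: (bivector_wedge A_local).
  - by move=> q a b q0; exact: (differentiable_bivector h_nv A_local).
pose L : 'M[R[i]]_3 := \matrix_(a, b) l b a 0.
have Ll i : L *m delta_mx i (0 : 'I_1) = l i by apply/colP => a; rewrite -colE !mxE.
have lE (p : 'rV[R[i]]_3) i : (p *m l i = 0) <-> (p *m L) 0 i = 0.
  rewrite -Ll mulmxA -colE; split => [/matrixP/(_ 0 0)|E]; first by rewrite !mxE.
  by apply/matrixP => a b; rewrite !ord1 mxE E mxE.
have Lu : L \in unitmx.
  rewrite unitmxE unitfE; apply/negP => /det0P[p p0 pL].
  by apply: (gen (proj p)) => i; apply/line_proj => //; apply/lE; rewrite pL mxE.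
pose B := change_coords A L.
have Bf : bivector_field e B by exact: change_coords_field.
have noninvB k : exists q : 'rV[R[i]]_3, [/\ q != 0, q 0 k = 0 & exists a, B q a k != 0].
  apply: contrapT => nex; apply: (noninv k); apply: (invariant_line_bivector h_nv A_local).
  move=> p p0 /lE pk; have q0 := mulmx_neq0 Lu p0.
  have Bq : B (p *m L) *m delta_mx k (0 : 'I_1) = 0.
    apply/colP => a; rewrite -colE mxE [RHS]mxE; apply/eqP; apply: contrapT => /negP ne.
    by apply: nex; exists (p *m L); split => //; exists a.
  have dE : invmx L *m l k = delta_mx k 0 by rewrite -Ll mulKmx.
  have E : A p *m l k = (invmx L)^T *m (B (p *m L) *m (invmx L *m l k)).
    by rewrite (change_coordsK A Lu) !mulmxA.
  by rewrite E dE Bq mulmx0.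
pose v0 : 'rV[R[i]]_3 := delta_mx 0 0.
(* The vertex [1 : 0 : 0] is on the lines L_2 and L_3, so reducedness applies. *)
have nonflat : ~ (B v0 = 0 /\ forall a b v, 'd (fun q => B q a b : R[i]) v0 v = 0).
  move=> [B0 dB]; pose p : 'rV[R[i]]_3 := v0 *m invmx L.
  have pL : p *m L = v0 by rewrite mulmxKV.
  have p0 : p != 0 by apply: mulmx_neq0; rewrite ?unitmx_inv // delta_neq0.
  have [|| A0 dA] := @flat_change_coords _ e A L Af Lu p _ _ p0; rewrite ?pL //.
  have [sing nred] := vanishing_not_reduced h_nv A_local p0 A0 dA.
  apply: nred; apply: red => //; exists 1 => //; apply/line_proj => //; apply/lE.
  by rewrite pL mxE.
pose S := enum_fset (fset_set (Aut F)).
have SA X : X \in S -> Aut F X.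
  move=> XS; have : X \in fset_set (Aut F) by exact: XS.
  by rewrite in_fset_set // => /set_mem.
have data X : exists MT : 'M[R[i]]_3 * 'M[R[i]]_3 * {perm 'I_3}, Aut F X ->
    [/\ X = pgl MT.1.1, MT.1.1 = L *m MT.1.2 *m invmx L & monomial_symmetry B MT.1.2 MT.2].
  case: (pselect (Aut F X)) => [XA|nX]; last by exists (0, 0, 1%g).
  have [M [Mu Mp] XE] := XA; pose N := invmx L *m M *m L.
  have NE : M = L *m N *m invmx L by rewrite /N -!mulmxA mulKVmx // mulmxV // mulmx1.
  have Nu : N \in unitmx by rewrite !unitmx_mul unitmx_inv Lu Mu.
  have MA : Aut F (pgl M) by rewrite XE.
  have [tau mono] : exists tau, monomial tau N.
    apply: exists_monomial => // i q q0 qi; pose p := q *m invmx L.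
    have pL : p *m L = q by rewrite mulmxKV.
    have p0 : p != 0 by apply: mulmx_neq0; rewrite ?unitmx_inv.
    have : (\bigcup_i line (l i)) (act M (proj p)).
      rewrite -(perm_lines M MA); exists (proj p) => //; exists i => //.
      by apply/line_proj => //; apply/lE; rewrite pL.
    rewrite act_proj // => -[j _] /line_proj => /(_ (mulmx_neq0 Mu p0)) /lE Mj.
    by exists j; rewrite /N !mulmxA.
  exists (M, N, tau) => _; split=> //=; split=> //.
  have [c c0 cE] := automorphism_factor h_nv A_local Mu Mp; exists c => // q q0.
  have p0 := mulmx_neq0 (invL_unit Lu) q0.
  rewrite /B /change_coords.
  have -> : q *m N *m invmx L = q *m invmx L *m M by rewrite /N !mulmxA mulmxK.
  have E := congruence_conj M (A (q *m invmx L)) Lu.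
  rewrite -/N in E; rewrite E.
  by rewrite cE // -scalemxAr -scalemxAl.
have [f fP] := boolp.choice data.
apply: (@symmetric_classes_bound _ _ _ Bf noninvB nonflat _ S (fun X => (f X).1.2) (fun X => (f X).2)) => //.
- exact: fset_uniq.
- by move=> X /SA/fP[].
- move=> X Y a /SA/fP[XE NX _] /SA/fP[YE NY _] a0 E.
  have {}E : (f X).1.1 = a *: (f Y).1.1.
    by rewrite NX NY E -scalemxAr -scalemxAl.
  rewrite XE YE E; apply/seteqP; split => N [b b0 ->].
    by exists (b * a); [exact: mulf_neq0|rewrite scalerA].
  by exists (b / a); [rewrite mulf_neq0 // invr_neq0|rewrite scalerA divfK].
Qed.
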